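(* Let $X$ be a UMD space, let $1<p<\infty$, and let $A$ be the generator of an analytic semigroup on $X$ that has maximal $L^p$-regularity. Then there is a constant $C_{p,X}$ (which may depend on $p$, $X$ and $A$) such that for every stepsize $\tau>0$, every integer $N\ge 1$ and all $f_1,\dots,f_N\in X$, the solution $(u_n)_{n=1}^N$ of the backward Euler scheme $$\frac{u_n-u_{n-1}}{\tau}=Au_n+f_n,\qquad 1\le n\le N,\qquad u_0=0,$$ satisfies, with $\dot u_n=(u_n-u_{n-1})/\tau$, $$\big\|(\dot u_n)_{n=1}^N\big\|_{\ell^p(X)}+\big\|(Au_n)_{n=1}^N\big\|_{\ell^p(X)}\le C_{p,X}\,\big\|(f_n)_{n=1}^N\big\|_{\ell^p(X)} .$$ In particular the constant is independent of $N$ and $\tau$.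
   Context: A (complex) Banach space $X$ is a UMD space if the Hilbert transform $Hf(t)=\mathrm{P.V.}\int_{\mathbb R}\frac{1}{t-s}f(s)\,ds$ is bounded on $L^p(\mathbb R;X)$ for all $1<p<\infty$. A generator $A$ of an analytic semigroup on $X$ has maximal $L^p$-regularity if there is a constant $C$ such that for every $f\in L^p(\mathbb R_+;X)$ the solution $u$ of $u'(t)=Au(t)+f(t)$, $t>0$, $u(0)=0$, satisfies $\|u'\|_{L^p(\mathbb R_+;X)}+\|Au\|_{L^p(\mathbb R_+;X)}\le C\|f\|_{L^p(\mathbb R_+;X)}$. (This property for some $p\in(1,\infty)$ is equivalent to it for all $p\in(1,\infty)$.) For a finite sequence $(v_n)$ in $X$, $\|(v_n)\|_{\ell^p(X)}=\big(\sum_n\|v_n\|_X^p\big)^{1/p}$. *)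

(* Defs.v *)
From HB Require Import structures.
From mathcomp Require Import all_boot all_order all_algebra.
From mathcomp Require Import all_classical all_reals all_analysis.
From mathcomp Require Export complex.

Set Implicit Arguments.
Unset Strict Implicit.
Unset Printing Implicit Defensive.

Import Order.TTheory GRing.Theory Num.Theory.
Import numFieldNormedType.Exports.

Local Open Scope classical_set_scope.
Local Open Scope ring_scope.
Local Open Scope complex_scope.

Section bochner.
Context {R : realType} {X : completeNormedModType R[i]}.
Local Notation mu := (@lebesgue_measure R).
Implicit Types (D : set R) (f g : R -> X) (x v : X) (p : R).

(* The norm of [X] takes its values in [R[i]]; this is the same number in R. *)
Definition rnorm x : R := complex.Re `|x|.

(* A representation [\sum_i 1_(A_i) x_i] of an integrable simple function. *)
Record simple := Simple {
  simple_len : nat;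
  simple_set : 'I_simple_len -> set R;
  simple_vec : 'I_simple_len -> X;
  simple_measurable : forall i, measurable (simple_set i);
  simple_finite : forall i, (mu (simple_set i) < +oo)%E }.

Definition simple_fun (s : simple) (t : R) : X :=
  \sum_(i < simple_len s) (\1_(simple_set i) t)%:C *: simple_vec i.

Definition simple_integral D (s : simple) : X :=
  \sum_(i < simple_len s)
    (fine (mu (simple_set i `&` D)))%:C *: simple_vec i.

(* Simple functions on sets of finite measure suffice, as mu is sigma-finite. *)
Definition strongly_measurable D f : Prop :=
  exists s : nat -> simple,
    forall t, D t -> simple_fun (s k) t @[k --> \oo] --> f t.

Definition is_bochner_integral D f v : Prop :=
  strongly_measurable D f /\
  exists s : nat -> simple,
    (\int[mu]_(t in D) (rnorm (f t - simple_fun (s k) t))%:E)%E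
      @[k --> \oo] --> 0%E /\
    simple_integral D (s k) @[k --> \oo] --> v.

(* The junk value for functions that are not Bochner integrable is 0. *)
Definition bochner_integral D f : X := xget 0 (is_bochner_integral D f).

Definition Lpnorm p D f : \bar R :=
  'N[mu]_(p%:E)[(fun t => (rnorm (f t))%:E) \_ D].

(* Functions, not classes: every class of almost everywhere equal functions in
   L^p(D; X) has a representative which is strongly measurable in this strict,
   everywhere pointwise, sense. *)
Definition in_Lp p D f : Prop :=
  strongly_measurable D f /\ (Lpnorm p D f < +oo)%E.

(* [P.V. \int_R f(s) / (t - s) ds = y] *)
Definition hilbert_transform_at f (t : R) (y : X) : Prop :=
  bochner_integral [set s | e < `|t - s|] (fun s => ((t - s)^-1)%:C *: f s)
    @[e --> (0 : R)^'+] --> y.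

Definition lp_norm p (N : nat) (v : nat -> X) : R :=
  (\sum_(1 <= n < N.+1) rnorm (v n) `^ p) `^ p^-1.

End bochner.

Arguments simple {R} X.

Definition UMD {R : realType} (X : completeNormedModType R[i]) : Prop :=
  forall p : R, 1 < p ->
  exists C : R, forall f : R -> X, in_Lp p setT f ->
  exists g : R -> X,
    [/\ in_Lp p setT g,
        {ae @lebesgue_measure R, forall t, hilbert_transform_at f t (g t)} &
        (Lpnorm p setT g <= C%:E * Lpnorm p setT f)%E].

(* A possibly unbounded operator; the values outside [dom] are irrelevant. *)
Record operator {R : realType} (X : completeNormedModType R[i]) := Operator {
  dom : set X;
  app :> X -> X }.

Section generator.
Context {R : realType} {X : completeNormedModType R[i]}.

Definition sector (theta : R) : set R[i] :=
  [set z | exists r phi : R,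
     [/\ 0 < r, `|phi| < theta & z = (r * cos phi) +i* (r * sin phi)]].

(* Strong holomorphy is the same as holomorphy in operator norm. *)
Definition analytic_semigroup (T : R[i] -> X -> X) : Prop :=
  exists2 theta : R, 0 < theta <= pi / 2 &
  [/\ forall z, sector theta z -> linear (T z) /\ continuous (T z),
      forall x, T 0 x = x,
      forall z w x, sector theta z -> sector theta w ->
        T (z + w) x = T z (T w x),
      forall x z, sector theta z -> derivable (T^~ x : R[i]^o -> X) z 1 &
      forall x, T z x @[z --> within (sector theta) (nbhs (0 : R[i]^o))] --> x].

Definition infinitesimal_generator (T : R[i] -> X -> X) (A : operator X) :
    Prop :=
  forall x y : X, (dom A x /\ A x = y) <->
    (h^-1)%:C *: (T h%:C x - x) @[h --> (0 : R)^'+] --> y.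

Definition generates_analytic_semigroup (A : operator X) : Prop :=
  exists2 T, analytic_semigroup T & infinitesimal_generator T A.

Definition Rplus : set R := [set t | 0 < t].

(* [u] solves u' = A u + f, u(0) = 0; [u'] and [Au] are measurable
   representatives of the derivative of [u] and of the function
   [t |-> A (u t)], which is defined for almost every [t] only. *)
Definition cauchy_solution (A : operator X) (f u u' Au : R -> X) : Prop :=
  [/\ u 0 = 0,
      forall t : R, Rplus t -> is_bochner_integral `]0, t[ u' (u t) &
      {ae @lebesgue_measure R, forall t, Rplus t ->
        [/\ dom A (u t), A (u t) = Au t & u' t = Au t + f t]}].

(* The solution is unique when [A] generates a semigroup. *)
Definition maximal_regularity (p : R) (A : operator X) : Prop :=
  exists C : R, forall f : R -> X, in_Lp p Rplus f ->
  exists u u' Au : R -> X,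
    [/\ cauchy_solution A f u u' Au,
        in_Lp p Rplus u',
        in_Lp p Rplus Au &
        (Lpnorm p Rplus u' + Lpnorm p Rplus Au
           <= C%:E * Lpnorm p Rplus f)%E].

Definition diff_quot (tau : R) (u : nat -> X) (n : nat) : X :=
  (tau^-1)%:C *: (u n - u n.-1).

Definition backward_euler (A : operator X) (tau : R) (N : nat)
    (f u : nat -> X) : Prop :=
  u 0%N = 0 /\
  forall n, (1 <= n <= N)%N ->
    dom A (u n) /\ diff_quot tau u n = A (u n) + f n.

End generator.

(* Main.v *)
(* The backward Euler scheme is the expectation of the continuous problem along a Poisson
   process: let [S_1 < S_2 < ...] be arrival times with mean spacing [tau], and let [u] solve
   [u' = A u + f] with the random force equal to [f_n] on the interval from [S_(n-1)] to [S_n].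
   Then the expectations of [u (S_n)] solve the scheme, and since [u] at time [t] depends on the
   past only, the sum over [n] of [tau * E |A u (S_n)|^p] is the expected integral of [|A u|^p];
   maximal regularity bounds it by the expected integral of [|f|^p], which is the sum of
   [tau * |f_n|^p]. To avoid measurability in the random parameter, the Poisson process is
   replaced by Bernoulli trials on a grid of mesh [q * tau], of which finitely many are used; the
   scheme is then solved up to an error that vanishes as [q -> 0].

   The case of one step shows that [1/tau - A] has almost full range, hence is onto since [A] is
   closed, with a bound on [A (1/tau - A)^-1] that is uniform in [tau]. Injectivity holds for
   large [1/tau] because [A] generates a semigroup, and the uniform bound propagates it to all
   [1/tau > 0]. This turns approximate solutions of the scheme into exact ones. *)
Require Import Defs.
From mathcomp Require Import all_boot all_order all_algebra.
From mathcomp Require Import all_classical all_reals all_analysis.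
From mathcomp Require Import measurable_realfun ring lra.
Import Order.TTheory GRing.Theory Num.Theory.
Import numFieldNormedType.Exports.
Set Implicit Arguments.
Unset Strict Implicit.
Unset Printing Implicit Defensive.
Local Open Scope classical_set_scope.
Local Open Scope ring_scope.
Local Open Scope complex_scope.

(** * Norm and semigroups *)

(** Maximal regularity yields, for each force separately, some solution [u], with [A u] known almost
    everywhere only. Two devices result. Point values of [u] are replaced by its integrals over the
    cells of the grid, which lie in [dom A] because the generator commutes with the Bochner integral
    ([hille]); the price is the variation of [u] over a cell, which Hölder's inequality bounds
    through [u']. And an arrival is independent of the present state only if that state depends on
    earlier forces alone, which is why uniqueness for the Cauchy problem is proved. The energy
    balance and Jensen's inequality both rest on one count ([occupation]): [q] times the expected
    number of cells preceded by exactly [n] arrivals is at most 1. The mesh is fixed before the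
    number [K] of trials, so crude bounds polynomial in [K] suffice against a tail probability that
    decays geometrically. Approximate solutions have the constant of maximal regularity; a factor 2
    is lost in comparing them with exact ones. That comparison may be exponential in [N], since the
    residual is chosen after [N]. *)

Section norm.
Context {R : realType} {X : completeNormedModType R[i]}.
Implicit Types (x y z : X).

Lemma normE x : `|x| = (rnorm x)%:C.
Proof. by rewrite /rnorm RRe_real ?normr_real. Qed.

Lemma rnorm_ge0 x : 0 <= rnorm x.
Proof. by rewrite -ler0c -normE normr_ge0. Qed.

Lemma rnormD x y : rnorm (x + y) <= rnorm x + rnorm y.
Proof. by rewrite -lecR rmorphD /= -!normE ler_normD. Qed.

Lemma rnormN x : rnorm (- x) = rnorm x.
Proof. by rewrite /rnorm normrN. Qed.

Lemma rdistC x y : rnorm (x - y) = rnorm (y - x).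
Proof. by rewrite /rnorm distrC. Qed.

Lemma rnorm0 : rnorm (0 : X) = 0.
Proof. by rewrite /rnorm normr0. Qed.

Lemma rnormB x y : rnorm (x - y) <= rnorm x + rnorm y.
Proof. by rewrite -(rnormN y) rnormD. Qed.

Lemma rnorm_eq0 x : rnorm x = 0 -> x = 0.
Proof. by move=> h; apply/eqP; rewrite -normr_eq0 normE h. Qed.

Lemma rnorm_le0 x : rnorm x <= 0 -> x = 0.
Proof. by move=> h; apply: rnorm_eq0; apply/eqP; rewrite eq_le h rnorm_ge0. Qed.

Lemma rnormZ (c : R) x : rnorm (c%:C *: x) = `|c| * rnorm x.
Proof.
by apply: complexI; rewrite rmorphM /= -!normE normrZ normc_def /= expr0n /= addr0 sqrtr_sqr.
Qed.

Lemma rnormZ_ge0 (c : R) x : 0 <= c -> rnorm (c%:C *: x) = c * rnorm x.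
Proof. by move=> c0; rewrite rnormZ ger0_norm. Qed.

Lemma rnorm_triangle z x y : rnorm (x - y) <= rnorm (x - z) + rnorm (z - y).
Proof. by rewrite -[x - y](subrKA z) rnormD. Qed.

Lemma ler_rnorm_dist x y : rnorm x <= rnorm y + rnorm (x - y).
Proof. by rewrite -[X in rnorm X <= _](subrK y) addrC rnormD. Qed.

Lemma rnorm_distB x y : `|rnorm x - rnorm y| <= rnorm (x - y).
Proof.
rewrite ler_norml lerBlDl ler_rnorm_dist andbT lerNl opprB lerBlDl.
by rewrite rdistC ler_rnorm_dist.
Qed.

Lemma rnorm_sum (I : Type) (r : seq I) (P : pred I) (F : I -> X) :
  rnorm (\sum_(i <- r | P i) F i) <= \sum_(i <- r | P i) rnorm (F i).
Proof.
elim/big_ind2: _ => [|a b c d h1 h2|//]; first by rewrite rnorm0.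
by apply: (le_trans (rnormD _ _)); apply: lerD.
Qed.

Lemma gt0_complex (e : R[i]) : 0 < e -> exists2 d : R, 0 < d & e = d%:C.
Proof.
move=> e0; exists (complex.Re e); last by rewrite RRe_real // gtr0_real.
by rewrite -ltcR RRe_real // gtr0_real.
Qed.

Lemma cvg_rnormP (T : Type) (F : set_system T) {FF : Filter F} (u : T -> X) (l : X) :
  u @ F --> l <-> rnorm (u t - l) @[t --> F] --> (0 : R).
Proof.
split=> [ul|ul].
  apply/cvgrPdist_lt => e e0.
  have e0' : (0 : R[i]) < e%:C by rewrite (ltcR 0).
  have /cvgrPdist_lt/(_ e%:C e0') := ul.
  apply: filterS => t; rewrite normE ltcR sub0r normrN ger0_norm ?rnorm_ge0 //.
  by rewrite rdistC.
apply/cvgrPdist_lt => _ /gt0_complex [e e0 ->].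
have /cvgrPdist_lt/(_ _ e0) := ul.
apply: filterS => t; rewrite normE ltcR sub0r normrN ger0_norm ?rnorm_ge0 //.
by rewrite rdistC.
Qed.

Lemma cvg_squeeze0 (T : Type) (F : set_system T) {FF : Filter F} (a b : T -> R) :
  (\forall t \near F, 0 <= a t <= b t) -> b @ F --> (0 : R) -> a @ F --> (0 : R).
Proof.
by move=> ab b0; apply: (@squeeze_cvgr _ _ _ _ (fun=> 0) b) => //; exact: cvg_cst.
Qed.

Lemma cvg_rnorm (T : Type) (F : set_system T) {FF : Filter F} (u : T -> X) (l : X) :
  u @ F --> l -> rnorm (u t) @[t --> F] --> rnorm l.
Proof.
move=> /cvg_rnormP ul; apply/cvgrPdist_lt => e e0.
have /cvgrPdist_lt/(_ _ e0) := ul; apply: filterS => t.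
rewrite sub0r normrN ger0_norm ?rnorm_ge0 // => /(le_lt_trans _); apply.
by rewrite rdistC rnorm_distB.
Qed.

Lemma rnorm_cauchy (u : nat -> X) :
  (forall e : R, 0 < e -> exists n0 : nat,
    forall n m, (n0 <= n)%N -> (n0 <= m)%N -> rnorm (u n - u m) < e) ->
  exists l : X, u @ \oo --> l.
Proof.
move=> h; suff : cvg (u @ \oo) by move=> ?; exists (lim (u @ \oo)).
apply/cauchy_cvgP/cauchy_ballP => _ /gt0_complex [e /h[n0 hn] ->].
exists ([set u n | n in [set n | (n0 <= n)%N]], [set u n | n in [set n | (n0 <= n)%N]]).
  by split; exists n0 => // n /= n1; exists n.
move=> [_ _] [/= [n h1 <-] [m h2 <-]]; rewrite -ball_normE /= normE ltcR; exact: hn.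
Qed.

Lemma near_right0 (P : R -> Prop) :
  (\forall t \near (0 : R)^'+, P t) <-> exists2 d : R, 0 < d & forall t, 0 < t -> t < d -> P t.
Proof.
split.
  move=> /nbhs_ballP [d /= d0 hd]; exists d => // t t0 td; apply: hd => //=.
  by rewrite /ball /= sub0r normrN gtr0_norm.
move=> [d d0 hd]; apply/nbhs_ballP; exists d => //= t.
by rewrite /ball /= sub0r normrN => /ltr_normlP [_ td] t0; apply: hd.
Qed.

Lemma cvg_right0P (f : R -> X) (l : X) :
  f t @[t --> (0 : R)^'+] --> l <->
  forall e : R, 0 < e -> exists2 d : R, 0 < d &
    forall t, 0 < t -> t < d -> rnorm (f t - l) < e.
Proof.
rewrite cvg_rnormP; split => [h e e0|h].
  apply/near_right0; have /cvgrPdist_lt/(_ _ e0) := h.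
  by apply: filterS => t; rewrite sub0r normrN ger0_norm ?rnorm_ge0.
apply/cvgrPdist_lt => e /h/near_right0.
by apply: filterS => t; rewrite sub0r normrN ger0_norm ?rnorm_ge0.
Qed.

Lemma cvg_seqP (u : nat -> X) (l : X) :
  u @ \oo --> l <->
  forall e : R, 0 < e -> exists n0 : nat, forall n, (n0 <= n)%N -> rnorm (u n - l) < e.
Proof.
rewrite cvg_rnormP; split => [h e e0|h].
  have /cvgrPdist_lt/(_ _ e0) [n0 _ hn] := h.
  by exists n0 => n /hn /=; rewrite sub0r normrN ger0_norm ?rnorm_ge0.
apply/cvgrPdist_lt => e /h [n0 hn]; exists n0 => // n /hn.
by rewrite /= sub0r normrN ger0_norm ?rnorm_ge0.
Qed.

Lemma continuous_rnormP (L : X -> X) : continuous L ->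
  forall x (e : R), 0 < e -> exists2 d : R, 0 < d & forall y,
    rnorm (y - x) <= d -> rnorm (L y - L x) < e.
Proof.
move=> cL x e e0; have e0' : (0 : R[i]) < e%:C by rewrite (ltcR 0).
have /cvgrPdist_lt/(_ e%:C e0') := cL x.
move=> /nbhs_ballP [_ /gt0_complex [d d0 ->]] hd.
exists (d / 2) => [|y yd]; first by rewrite divr_gt0.
have := hd y; rewrite -ball_normE /= !normE !ltcR rdistC [rnorm (L x - _)]rdistC; apply.
by rewrite rdistC; apply: (le_lt_trans yd); rewrite ltr_pdivrMr // ltr_pMr // ltr1n.
Qed.


Lemma lin0 (L : X -> X) : linear L -> L 0 = 0.
Proof. by move=> lL; have := lL (-1) 0 0; rewrite scaleN1r addNr scaleN1r addNr. Qed.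

Lemma linZ (L : X -> X) : linear L -> forall c x, L (c *: x) = c *: L x.
Proof. by move=> lL c x; have := lL c x 0; rewrite !addr0 (lin0 lL) addr0. Qed.

Lemma linD (L : X -> X) : linear L -> forall x y, L (x + y) = L x + L y.
Proof. by move=> lL x y; have := lL 1 x y; rewrite !scale1r. Qed.

Lemma linB (L : X -> X) : linear L -> forall x y, L (x - y) = L x - L y.
Proof. by move=> lL x y; rewrite linD // -scaleN1r linZ // scaleN1r. Qed.

Lemma lin_sum (L : X -> X) : linear L -> forall (I : Type) (r : seq I) (P : pred I) (F : I -> X),
  L (\sum_(i <- r | P i) F i) = \sum_(i <- r | P i) L (F i).
Proof.
move=> lL I r P F; elim/big_rec2: _ => [|i y1 y2 _ <-]; first exact: lin0.
by rewrite linD.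
Qed.

Lemma bounded_rnorm (L : X -> X) : linear L -> continuous L ->
  exists2 M : R, 0 < M & forall x, rnorm (L x) <= M * rnorm x.
Proof.
move=> lL cL.
have [d d0 hd] := continuous_rnormP cL 0 ltr01.
exists d^-1 => [|x]; first by rewrite invr_gt0.
have [x0|x0] := eqVneq (rnorm x) 0.
  by rewrite x0 (rnorm_eq0 x0) (lin0 lL) rnorm0 mulr0.
have xp : 0 < rnorm x by rewrite lt_def x0 rnorm_ge0.
have dx : 0 <= d / rnorm x by rewrite divr_ge0 // ltW.
have := hd ((d / rnorm x)%:C *: x).
rewrite (lin0 lL) !subr0 (linZ lL) !(rnormZ_ge0 _ dx) divfK // => /(_ (lexx _)).
by rewrite mulrAC ltr_pdivrMr // mul1r => /ltW h; rewrite -ler_pdivrMl ?invr_gt0 // invrK.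
Qed.

(** What an analytic semigroup leaves on the half-line. A sector does not contain 0, so the laws are
    required for positive times and [T 0] is treated apart. *)
Definition C0_semigroup (T : R -> X -> X) : Prop :=
  [/\ forall s, 0 < s -> linear (T s) /\ continuous (T s),
      forall x, T 0 x = x,
      forall s t x, 0 < s -> 0 < t -> T (s + t) x = T s (T t x) &
      forall x, T s x @[s --> (0 : R)^'+] --> x].

(** * Local bounds for strongly continuous semigroups *)

Section semigroup.
Context (T : R -> X -> X) (sgT : C0_semigroup T).

Lemma sg_linear s : 0 <= s -> linear (T s).
Proof.
case: sgT => h h0 _ _; rewrite le_eqVlt => /predU1P[<-|/h[]//] c x y.
by rewrite !h0.
Qed.

Lemma sgD s t x : 0 <= s -> 0 <= t -> T (s + t) x = T s (T t x).
Proof.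
case: sgT => _ h0 h _; rewrite le_eqVlt => /predU1P[<-|s0]; first by rewrite add0r h0.
rewrite le_eqVlt => /predU1P[<-|t0]; first by rewrite addr0 h0.
exact: h.
Qed.

(* Nested balls, as in the uniform boundedness principle: otherwise [T s x] would be
   unbounded as [s -> 0] for some [x]. *)
Lemma sg_bounded_near0 : exists d M : R, [/\ 0 < d, 0 < M &
  forall s x, 0 < s -> s <= d -> rnorm (T s x) <= M * rnorm x].
Proof.
apply: contrapT => hn.
have big (k : nat) (r : R) : 0 < r -> exists s z, [/\ 0 < s, s <= k.+1%:R^-1,
  rnorm z <= r & k%:R < rnorm (T s z)].
  move=> r0; apply: contrapT => hk; apply: hn.
  exists k.+1%:R^-1, (k.+1%:R / r); split.
  - by rewrite invr_gt0.
  - by rewrite divr_gt0.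
  move=> s x s0 sk; have lT := sg_linear (ltW s0).
  have [x0|x0] := eqVneq (rnorm x) 0.
    by rewrite x0 (rnorm_eq0 x0) (lin0 lT) rnorm0 mulr0.
  have xp : 0 < rnorm x by rewrite lt_def x0 rnorm_ge0.
  have rx : 0 <= r / rnorm x by rewrite divr_ge0 // ltW.
  rewrite leNgt; apply/negP => hx; apply: hk; exists s, ((r / rnorm x)%:C *: x); split=> //.
    by rewrite (rnormZ_ge0 _ rx) divfK.
  rewrite (linZ lT) (rnormZ_ge0 _ rx).
  rewrite mulrAC ltr_pdivlMr // -ltr_pdivrMl // mulrC.
  apply: le_lt_trans hx; rewrite mulrAC ler_pM2r // ler_pM2r ?invr_gt0 //.
  by rewrite ler_nat.
(* One stage of the nesting; a pair is a center and a radius. The new ball lies in the old one, and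
   some [T s] with small [s] has norm at least [k] on all of it. A nonpositive radius gets a junk
   value. *)
have step (kb : nat * (X * R)) : exists b' : X * R, 0 < kb.2.2 ->
    [/\ 0 < b'.2, b'.2 <= kb.2.2 / 2, rnorm (b'.1 - kb.2.1) <= kb.2.2 / 2 &
     exists s, [/\ 0 < s, s <= kb.1.+1%:R^-1 & forall y,
       rnorm (y - b'.1) <= b'.2 -> kb.1%:R <= rnorm (T s y)]].
  case: kb => k [x r] /=; have [r0|r0] := ltP 0 r; last by exists (x, r).
  have r20 : 0 < r / 2 by rewrite divr_gt0.
  have [s [z [s0 sk zr kz]]] := big k.+1 _ r20.
  have lT := sg_linear (ltW s0).
  have sk' : s <= k.+1%:R^-1.
    by apply: (le_trans sk); rewrite lef_pV2 ?posrE // ler_nat.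
  have cT : continuous (T s) by case: sgT => /(_ s s0)[].
  (* one of [x + z], [x - z] has a large image, as [2 T z = T (x + z) - T (x - z)] *)
  have [x' xx' kx'] : exists2 x', rnorm (x' - x) <= r / 2 & k.+1%:R < rnorm (T s x').
    have [h|h] := ltP k.+1%:R (rnorm (T s (x + z))).
      by exists (x + z) => //; rewrite addrAC subrr add0r.
    exists (x - z); first by rewrite addrAC subrr add0r rnormN.
    rewrite ltNge; apply/negP => h'.
    have e : (2 : R)%:C *: T s z = T s (x + z) - T s (x - z).
      rewrite (linD lT) (linB lT) opprB addrC addrA subrK.
      by rewrite rmorph_nat scaler_nat mulr2n.
    have := rnormB (T s (x + z)) (T s (x - z)); rewrite -e rnormZ_ge0 //.
    by move: h h' kz; move: (rnorm _) (rnorm _) (rnorm _) => a b c; lra.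
  have [d d0 hd] := continuous_rnormP cT x' ltr01.
  exists (x', Num.min d (r / 2)) => _ /=; split => //.
  - by rewrite lt_min d0.
  - by rewrite ge_min lexx orbT.
  exists s; split=> // y; rewrite le_min => /andP[/hd yd _].
  have := ler_rnorm_dist (T s x') (T s y); rewrite rdistC.
  by move: kx' yd; rewrite -natr1; move: (rnorm _) (rnorm _) (rnorm _) => a b c; lra.
have [nx hnx] := choice step.
pose fix b (n : nat) : X * R := if n is m.+1 then nx (m, b m) else (0, 1).
have bp n : 0 < (b n).2.
  by elim: n => [|n IH] //=; have [] := hnx (n, b n) IH.
have bS n := hnx (n, b n) (bp n).
have bn n : (b n).2 <= n.+1%:R^-1.
  elim: n => [|n IH]; first by rewrite invr1.
  have [_ h _ _] := bS n; apply: (le_trans h); rewrite -[b n]/(n, b n).2 /=.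
  apply: le_trans (_ : n.+1%:R^-1 / 2 <= _); first by rewrite ler_pM2r.
  by rewrite -invfM -natrM lef_pV2 ?posrE ?ltr0n ?muln_gt0 // ler_nat muln2 -addnn addSn ltnS
    leq_addl.
have bc n j : rnorm ((b (n + j)%N).1 - (b n).1) + (b (n + j)%N).2 <= (b n).2.
  elim: j => [|j IH]; first by rewrite addn0 subrr rnorm0 add0r.
  have [_ h1 h2 _] := bS (n + j)%N; rewrite addnS.
  have := rnorm_triangle (b (n + j)%N).1 (b (n + j).+1).1 (b n).1.
  by move: IH h1 h2 => /=; move: (rnorm _) (rnorm _) (rnorm _) => u v w; lra.
have bc' n m : (n <= m)%N -> rnorm ((b m).1 - (b n).1) <= (b n).2.
  move=> nm; have := bc n (m - n)%N; rewrite subnKC // => h.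
  by apply: le_trans h; rewrite lerDl ltW.
have [x xl] : exists x : X, (fun n => (b n).1) @ \oo --> x.
  apply: rnorm_cauchy => e e0; have [n0 hn0] : exists n0 : nat, 2 / e < n0%:R.
    by exists (Num.truncn (2 / e)).+1; rewrite truncnS_gt.
  exists n0 => n m h1 h2; rewrite (le_lt_trans (rnorm_triangle (b n0).1 _ _)) //.
  rewrite [rnorm ((b n0).1 - _)]rdistC; have := bc' _ _ h1; have := bc' _ _ h2.
  have : 2 * (b n0).2 < e.
    have n0p : 0 < (n0%:R : R) by apply: le_lt_trans hn0; rewrite divr_ge0 ?ltW.
    apply: (@le_lt_trans _ _ (2 / n0.+1%:R)); first by rewrite ler_pM2l ?bn.
    rewrite ltr_pdivrMr // mulrC -ltr_pdivrMr //; apply: (lt_trans hn0).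
    by rewrite ltr_nat.
  by move: (rnorm _) (rnorm _) => u v; lra.
have xb n : rnorm (x - (b n).1) <= (b n).2.
  have h : (fun m => (b m).1 - (b n).1) @ \oo --> x - (b n).1.
    by apply: cvgB => //; exact: cvg_cst.
  apply: (cvgr_to_le (cvg_rnorm h)); exists n => // m /=; exact: bc'.
have [_ _ _ /(_ x)/cvg_right0P/(_ _ ltr01)[d d0 hd]] := sgT.
(* At the common point [x] of the balls, strong continuity bounds [T s x] by [rnorm x + 1] for
   [s < d]. A stage [k] beyond both this bound and [d^-1] contradicts it. *)
have [k [hk1 hk2]] : exists k : nat, d^-1 < k%:R /\ rnorm x + 1 < k%:R.
  exists (Num.truncn (Num.max d^-1 (rnorm x + 1))).+1.
  have := truncnS_gt (Num.max d^-1 (rnorm x + 1)); rewrite gt_max => /andP[h1 h2].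
  by split.
have [_ _ _ [s [s0 sk hs]]] := bS k.
have kp : 0 < (k%:R : R) by apply: lt_trans hk1; rewrite invr_gt0.
have sd : s < d.
  apply: (le_lt_trans sk); rewrite -[ltRHS]invrK ltf_pV2 ?posrE ?invr_gt0 //.
  by apply: (lt_trans hk1); rewrite ltr_nat.
have := hd _ s0 sd; have := hs _ (xb k.+1); have := ler_rnorm_dist (T s x) x.
by move: hk2; move: (rnorm _) (rnorm _) (rnorm _) => u v w /=; lra.
Qed.

Lemma sg_bounded (t0 : R) : exists2 M : R, 1 <= M &
  forall s x, 0 <= s -> s <= t0 -> rnorm (T s x) <= M * rnorm x.
Proof.
have [d [M [d0 M0 hd]]] := sg_bounded_near0.
pose M1 := Num.max 1 M; have M11 : 1 <= M1 by rewrite le_max lexx.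
have M1p : 0 < M1 by apply: lt_le_trans M11.
have hd1 s x : 0 <= s -> s <= d -> rnorm (T s x) <= M1 * rnorm x.
  rewrite le_eqVlt => /predU1P[<- _|s0 sd].
    by case: sgT => _ -> _ _; rewrite ler_peMl ?rnorm_ge0.
  by apply: (le_trans (hd _ _ s0 sd)); rewrite ler_wpM2r ?rnorm_ge0 // le_max lexx orbT.
have hn n s x : 0 <= s -> s <= d -> rnorm (T (n%:R * s) x) <= M1 ^+ n * rnorm x.
  move=> s0 sd; elim: n x => [|n IH] x.
    by case: sgT => _ h0 _ _; rewrite mul0r h0 expr0 mul1r.
  rewrite -natr1 mulrDl mul1r sgD ?mulr_ge0 // (le_trans (IH _)) // exprSr -mulrA.
  by rewrite ler_wpM2l ?hd1 // exprn_ge0 // ltW.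
pose n := (Num.truncn (t0 / d)).+1.
exists (M1 ^+ n) => [|s x s0 st]; first by rewrite exprn_ege1.
have -> : s = n%:R * (s / n%:R) by rewrite mulrC divfK // pnatr_eq0.
apply: hn; first by rewrite divr_ge0.
rewrite ler_pdivrMr ?ltr0n // mulrC -ler_pdivrMr //.
apply: le_trans (ltW (truncnS_gt _)); by rewrite ler_pM2r ?invr_gt0.
Qed.

Lemma sg_telescope M t0 : (forall s x, 0 <= s -> s <= t0 -> rnorm (T s x) <= M * rnorm x) ->
  forall n s x, 0 <= s -> n%:R * s <= t0 ->
    rnorm (T (n%:R * s) x - x) <= n%:R * (M * rnorm (T s x - x)).
Proof.
move=> hM; elim=> [|n IH] s x s0 ns.
  by rewrite !mul0r; case: sgT => _ -> _ _; rewrite subrr rnorm0.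
have ns' : n%:R * s <= t0.
  by apply: le_trans ns; rewrite ler_wpM2r // ler_nat.
rewrite -[in leLHS]natr1 mulrDl mul1r sgD ?mulr_ge0 //.
apply: (le_trans (rnorm_triangle (T (n%:R * s) x) _ _)).
rewrite -(linB (sg_linear _)) ?mulr_ge0 // -natr1 mulrDl mul1r addrC.
by apply: lerD; [exact: IH|apply: hM; rewrite ?mulr_ge0].
Qed.

(* [T h - 1] is the sum over [k < n] of [T (k h / n) (T (h / n) - 1)]; let [n -> oo]. *)
Lemma sg_diff_bound M t0 x y : (forall s x, 0 <= s -> s <= t0 -> rnorm (T s x) <= M * rnorm x) ->
  0 < M -> (h^-1)%:C *: (T h x - x) @[h --> (0 : R)^'+] --> y ->
  forall h, 0 < h -> h <= t0 -> rnorm (T h x - x) <= h * (M * rnorm y).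
Proof.
move=> hM M0 /cvg_right0P hy h h0 ht; apply/ler_addgt0Pr => e e0.
have hM0 : 0 < h * M by rewrite mulr_gt0.
have [d d0 hd] := hy _ (divr_gt0 e0 hM0).
pose n := (Num.truncn (h / d)).+1.
have n0 : 0 < (n%:R : R) by rewrite ltr0n.
have hnd : h / n%:R < d.
  by rewrite ltr_pdivrMr // mulrC -ltr_pdivrMr // truncnS_gt.
have hn0 : 0 < h / n%:R by rewrite divr_gt0.
have hE : n%:R * (h / n%:R) = h by rewrite mulrC divfK // gt_eqF.
have := sg_telescope hM (n := n) (s := h / n%:R) x (ltW hn0); rewrite hE => /(_ ht).
move=> /le_trans; apply.
have := hd _ hn0 hnd; set q := _ *: _ => hq.
have -> : T (h / n%:R) x - x = (h / n%:R)%:C *: q.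
  by rewrite /q scalerA -rmorphM /= mulfV ?gt_eqF // scale1r.
rewrite (rnormZ_ge0 _ (ltW hn0)).
have -> : n%:R * (M * (h / n%:R * rnorm q)) = h * M * rnorm q.
  by rewrite -[in RHS]hE; ring.
rewrite mulrA; apply: le_trans (_ : h * M * (rnorm y + e / (h * M)) <= _); last first.
  by rewrite mulrDr [h * M * (e / _)]mulrC divfK ?gt_eqF.
rewrite ler_pM2l // (le_trans (ler_rnorm_dist _ y)) // lerD2l ltW //.
Qed.
End semigroup.

(** The points [s] with [rnorm (g r) <= r * e] on all of [[0, s]] have a supremum. Left continuity
    puts it into the set, and the vanishing right derivative moves it further unless it is [t]. Only
    right derivatives enter, since the generator is a right derivative at 0. *)
Lemma right_derivative0 (g : R -> X) (t : R) :
  0 <= t -> g 0 = 0 ->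
  (forall s, 0 <= s -> s < t -> forall e, 0 < e -> exists2 d, 0 < d &
     forall h, 0 < h -> h < d -> s + h <= t -> rnorm (g (s + h) - g s) <= h * e) ->
  (forall s, 0 < s -> s <= t -> forall e, 0 < e -> exists2 d, 0 < d &
     forall r, 0 <= r -> r < s -> s - r < d -> rnorm (g s - g r) <= e) ->
  g t = 0.
Proof.
move=> t0 g0 hR hL; apply: rnorm_le0; apply/ler_addgt0Pr => e0 e0p; rewrite add0r.
pose e := e0 / (t + 1); have e0' : 0 < e by rewrite divr_gt0 // ltr_wpDl.
suff : rnorm (g t) <= t * e.
  move=> /le_trans; apply; rewrite /e mulrCA ger_pMr // ler_pdivrMr ?ltr_wpDl // mul1r.
  by rewrite lerDl.
pose S := [set s : R | 0 <= s <= t /\ forall r, 0 <= r <= s -> rnorm (g r) <= r * e].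
have S0 : S 0.
  by split=> [|r]; rewrite ?lexx // -eq_le => /eqP <-; rewrite g0 rnorm0 mul0r.
have supS : has_sup S by split; [exists 0|exists t => s [/andP[]]].
pose c := sup S.
have c0 : 0 <= c by apply: sup_upper_bound.
have ct : c <= t by apply: ge_sup; [exists 0|move=> s [/andP[]]].
have below r : 0 <= r -> r < c -> rnorm (g r) <= r * e.
  move=> r0 rc; have rc' : 0 < c - r by rewrite subr_gt0.
  have [s [_ hs] rs] := sup_adherent rc' supS.
  by apply: hs; rewrite r0 ltW //; move: rs; rewrite -/c opprB addrC subrK.
have hc : rnorm (g c) <= c * e.
  move: c0; rewrite le_eqVlt => /predU1P[<-|c0]; first by rewrite g0 rnorm0 mul0r.
  apply/ler_addgt0Pr => e' e'0; have [d d0 hd] := hL _ c0 ct _ e'0.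
  pose r := Num.max 0 (c - d / 2).
  have d20 : 0 < d / 2 by rewrite divr_gt0.
  have rc : r < c by rewrite gt_max c0 ltrBlDr ltrDl.
  have r0 : 0 <= r by rewrite le_max lexx.
  have cr : c - r < d.
    have : c - d / 2 <= r by rewrite le_max lexx orbT.
    by move: d0; lra.
  have := hd _ r0 rc cr; have := below _ r0 rc; have := ler_rnorm_dist (g c) (g r).
  have : r * e <= c * e by rewrite ler_pM2r // ltW.
  by move: (rnorm _) (rnorm _) (rnorm _) => u v w; lra.
have Sc : S c.
  split; first by rewrite c0.
  by move=> r /andP[r0]; rewrite le_eqVlt => /predU1P[->|]//; apply: below.
move: ct; rewrite le_eqVlt => /predU1P[<-//|ct].
have [d d0 hd] := hR _ c0 ct _ e0'.
pose h := Num.min (d / 2) (t - c).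
have h0 : 0 < h by rewrite lt_min divr_gt0 // subr_gt0.
have hd2 : h <= d / 2 by rewrite ge_min lexx.
have htc : h <= t - c by rewrite ge_min lexx orbT.
suff : S (c + h) by move=> /(sup_upper_bound supS); rewrite -/c gerDl leNgt h0.
split; first by move: hd2 c0 h0 htc; move: h => h'; lra.
move=> r /andP[r0 rh]; have [rc|rc] := leP r c.
  by move: rc; rewrite le_eqVlt => /predU1P[->|]//; apply: below.
have rc0 : 0 < r - c by rewrite subr_gt0.
have rcd : r - c < d by move: rh hd2 d0; clear; lra.
have := hd _ rc0 rcd; rewrite addrC subrK => /(_ _) h1.
have : r <= t by move: rh htc; clear; lra.
move=> /h1; have := ler_rnorm_dist (g r) (g c); move: hc.
by move: (rnorm _) (rnorm _) (rnorm _) => u v w; lra.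
Qed.

End norm.

(** * Bochner integrals *)

Section bochner_theory.
Context {R : realType} {X : completeNormedModType R[i]}.
Local Notation mu := (@lebesgue_measure R).
Implicit Types (D E : set R) (f g : R -> X) (v w x y : X) (s : simple X) (L : X -> X).

Definition simple_add (s1 s2 : simple X) : simple X :=
  @Simple R X (simple_len s1 + simple_len s2)
    (fun i => match fintype.split i with inl j => simple_set j | inr j => simple_set j end)
    (fun i => match fintype.split i with inl j => simple_vec j | inr j => simple_vec j end)
    (fun i => match fintype.split i as z return measurable
         (match z with inl j => simple_set j | inr j => simple_set j end) with
       inl j => simple_measurable j | inr j => simple_measurable j end)
    (fun i => match fintype.split i as z return (mu
         (match z with inl j => simple_set j | inr j => simple_set j end) < +oo)%E with
       inl j => simple_finite j | inr j => simple_finite j end).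

Definition simple_map L (s : simple X) : simple X :=
  @Simple R X (simple_len s) (@simple_set _ _ s) (fun i => L (simple_vec i))
    (@simple_measurable _ _ s) (@simple_finite _ _ s).

Lemma sum_split (m n : nat) (F : 'I_m -> X) (G : 'I_n -> X) :
  \sum_(i < m + n) (match fintype.split i with inl j => F j | inr j => G j end) =
  \sum_i F i + \sum_i G i.
Proof.
rewrite big_split_ord /=; congr (_ + _); apply: eq_bigr => i _.
  by rewrite (unsplitK (inl i)).
by rewrite (unsplitK (inr i)).
Qed.

Lemma simple_addE s1 s2 t :
  simple_fun (simple_add s1 s2) t = simple_fun s1 t + simple_fun s2 t.
Proof.
by rewrite /simple_fun -sum_split; apply: eq_bigr => i _ /=; case: (fintype.split i).
Qed.

Lemma simple_add_integral D s1 s2 :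
  simple_integral D (simple_add s1 s2) = simple_integral D s1 + simple_integral D s2.
Proof.
by rewrite /simple_integral -sum_split; apply: eq_bigr => i _ /=; case: (fintype.split i).
Qed.

Lemma simple_mapE L s t : linear L -> simple_fun (simple_map L s) t = L (simple_fun s t).
Proof.
by move=> lL; rewrite /simple_fun (lin_sum lL); apply: eq_bigr => i _; rewrite (linZ lL).
Qed.

Lemma simple_map_integral L D s : linear L ->
  simple_integral D (simple_map L s) = L (simple_integral D s).
Proof.
by move=> lL; rewrite /simple_integral (lin_sum lL); apply: eq_bigr => i _; rewrite (linZ lL).
Qed.

(** Induction on the number of sets, for all offsets [y] at once: on the first set and off it, the
    function is of the same kind with one set less, the vector of that set having moved into [y]. *)
Lemma measurable_rnorm_sum n (A : 'I_n -> set R) (v : 'I_n -> X) y :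
  (forall i, measurable (A i)) ->
  measurable_fun setT (fun t => rnorm (y + \sum_(i < n) (\1_(A i) t)%:C *: v i)).
Proof.
elim: n A v y => [|n IH] A v y mA.
  by apply: (@eq_measurable_fun _ _ _ _ _ (cst (rnorm y))) => // t _; rewrite big_ord0 addr0.
pose S t := \sum_(i < n) (\1_(A (lift ord0 i)) t)%:C *: v (lift ord0 i).
apply: (@eq_measurable_fun _ _ _ _ _ (fun t =>
   \1_(A ord0) t * rnorm (y + v ord0 + S t) + (1 - \1_(A ord0) t) * rnorm (y + S t))).
  move=> t _; rewrite big_ord_recl /= -/(S t) addrA indicE; case: (t \in A ord0).
    by rewrite mul1r subrr mul0r addr0 scale1r.
  by rewrite mul0r subr0 mul1r add0r scale0r addr0.
by apply: measurable_funD; apply: measurable_funM; try exact: IH;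
  try apply: measurable_funB => //; exact: measurable_indic.
Qed.

Lemma sm_simple D s : strongly_measurable D (simple_fun s).
Proof. by exists (fun=> s) => t _; exact: cvg_cst. Qed.

Lemma sm_add D f g : strongly_measurable D f -> strongly_measurable D g ->
  strongly_measurable D (fun t => f t + g t).
Proof.
move=> [s hs] [s' hs']; exists (fun k => simple_add (s k) (s' k)) => t Dt.
under eq_fun do rewrite simple_addE.
by apply: cvgD; [exact: hs|exact: hs'].
Qed.

Lemma sm_lin D f L : linear L -> continuous L -> strongly_measurable D f ->
  strongly_measurable D (fun t => L (f t)).
Proof.
move=> lL cL [s hs]; exists (fun k => simple_map L (s k)) => t Dt.
under eq_fun do rewrite simple_mapE //.
exact: (cvg_comp _ _ (hs t Dt) (cL (f t))).
Qed.

Lemma linear_scale (c : R[i]) : linear (fun x => c *: x).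
Proof. by move=> a x y; rewrite scalerDr !scalerA mulrC. Qed.

Lemma continuous_scale (c : R[i]) : continuous (fun x => c *: x).
Proof. exact: scaler_continuous. Qed.

Lemma sm_opp D f : strongly_measurable D f -> strongly_measurable D (fun t => - f t).
Proof.
move=> /(sm_lin (linear_scale (-1)) (@continuous_scale (-1))) [s hs].
by exists s => t /hs; rewrite scaleN1r.
Qed.

Lemma sm_sub D f g : strongly_measurable D f -> strongly_measurable D g ->
  strongly_measurable D (fun t => f t - g t).
Proof. by move=> hf /sm_opp; exact: sm_add. Qed.

Lemma sm_subset D E f : E `<=` D -> strongly_measurable D f -> strongly_measurable E f.
Proof. by move=> ED [s hs]; exists s => t /ED /hs. Qed.

Lemma sm_rnorm D f : measurable D -> strongly_measurable D f ->
  measurable_fun D (fun t => rnorm (f t)).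
Proof.
move=> mD [s hs]; apply: (@measurable_fun_cvg _ _ _ _ (fun k t => rnorm (simple_fun (s k) t))).
  move=> k; apply: measurable_funTS; rewrite /simple_fun.
  have := measurable_rnorm_sum (simple_vec (s := s k)) 0 (simple_measurable (s := s k)).
  by under eq_fun do rewrite add0r.
by move=> t Dt; apply: cvg_rnorm; exact: hs.
Qed.

Lemma sm_ernorm D f : measurable D -> strongly_measurable D f ->
  measurable_fun D (fun t => (rnorm (f t))%:E).
Proof. by move=> mD /(sm_rnorm mD) h; apply/measurable_EFinP. Qed.

Definition L1norm D f : \bar R := (\int[mu]_(t in D) (rnorm (f t))%:E)%E.

Lemma L1norm_ge0 D f : (0 <= L1norm D f)%E.
Proof. by apply: integral_ge0 => t _; rewrite lee_fin rnorm_ge0. Qed.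

Lemma L1normD D f g : measurable D -> strongly_measurable D f -> strongly_measurable D g ->
  (L1norm D (fun t => f t + g t)%R <= L1norm D f + L1norm D g)%E.
Proof.
move=> mD hf hg; rewrite /L1norm -ge0_integralD //; last first.
- exact: sm_ernorm.
- by move=> t _; rewrite lee_fin rnorm_ge0.
- exact: sm_ernorm.
- by move=> t _; rewrite lee_fin rnorm_ge0.
apply: ge0_le_integral => //.
- by move=> t _; rewrite lee_fin rnorm_ge0.
- by apply: sm_ernorm => //; exact: sm_add.
- by apply: emeasurable_funD; exact: sm_ernorm.
by move=> t _; rewrite -EFinD lee_fin rnormD.
Qed.

Lemma L1normN D f : L1norm D (fun t => - f t) = L1norm D f.
Proof. by apply: eq_integral => t _; rewrite rnormN. Qed.

Lemma L1norm_eq D f g : (forall t, D t -> f t = g t) -> L1norm D f = L1norm D g.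
Proof. by move=> fg; apply: eq_integral => t; rewrite inE => /fg ->. Qed.

Lemma L1norm_subset D E f : measurable D -> measurable E -> E `<=` D ->
  strongly_measurable D f -> (L1norm E f <= L1norm D f)%E.
Proof.
move=> mD mE ED hf; apply: ge0_subset_integral => //.
- exact: sm_ernorm.
- by move=> t _; rewrite lee_fin rnorm_ge0.
Qed.

Lemma L1norm_bound D f (c : R) : measurable D -> strongly_measurable D f ->
  (forall t, D t -> rnorm (f t) <= c) -> (L1norm D f <= c%:E * mu D)%E.
Proof.
move=> mD hf fc; rewrite -integral_cst //; apply: ge0_le_integral => //.
- by move=> t _; rewrite lee_fin rnorm_ge0.
- exact: sm_ernorm.
Qed.

Lemma L1norm_lin D f L (M : R) : measurable D -> strongly_measurable D f ->
  linear L -> continuous L -> 0 <= M -> (forall x, rnorm (L x) <= M * rnorm x) ->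
  (L1norm D (fun t => L (f t)) <= M%:E * L1norm D f)%E.
Proof.
move=> mD hf lL cL M0 hM; rewrite /L1norm -ge0_integralZl_EFin //; last first.
- exact: sm_ernorm.
- by move=> t _; rewrite lee_fin rnorm_ge0.
apply: ge0_le_integral => //.
- by move=> t _; rewrite lee_fin rnorm_ge0.
- by apply: sm_ernorm => //; exact: sm_lin.
- by apply: emeasurable_funM => //; exact: sm_ernorm.
- by move=> t _; rewrite -EFinM lee_fin.
Qed.

(* The sets may overlap: splitting [E] along the first one moves its vector into [y]. *)
Lemma rnorm_integral_sum n (A : 'I_n -> set R) (v : 'I_n -> X) y E :
  (forall i, measurable (A i)) -> measurable E -> (mu E < +oo)%E ->
  ((rnorm ((fine (mu E))%:C *: y + \sum_(i < n) (fine (mu (A i `&` E)))%:C *: v i))%:E <=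
   \int[mu]_(t in E) (rnorm (y + \sum_(i < n) (\1_(A i) t)%:C *: v i))%:E)%E.
Proof.
elim: n A v y E => [|n IH] A v y E mA mE fE.
  under eq_integral do rewrite big_ord0 addr0.
  rewrite big_ord0 addr0 integral_cst // rnormZ_ge0 ?fine_ge0 // EFinM fineK 1?muleC //.
  by rewrite ge0_fin_numE.
pose E1 := E `&` A ord0; pose E2 := E `\` A ord0.
have mE1 : measurable E1 by exact: measurableI.
have mE2 : measurable E2 by exact: measurableD.
have fin F : measurable F -> F `<=` E -> (mu F < +oo)%E.
  by move=> mF FE; apply: le_lt_trans fE; apply: le_measure => //; rewrite inE.
have fE1 : (mu E1 < +oo)%E by apply: fin => //; exact: subIsetl.
have fE2 : (mu E2 < +oo)%E by apply: fin => //; exact: subDsetl.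
have EE : E = E1 `|` E2 by rewrite setUIDK.
pose S t := \sum_(i < n) (\1_(A (lift ord0 i)) t)%:C *: v (lift ord0 i).
have split_mu B : measurable B ->
  fine (mu (B `&` E)) = fine (mu (B `&` E1)) + fine (mu (B `&` E2)).
  move=> mB; rewrite -fineD.
  - rewrite -measureU; first by rewrite -setIUr -EE.
    + exact: measurableI.
    + exact: measurableI.
    + by rewrite setIACA setIid /E1 /E2 setDE setIACA setICr !setI0.
  - by rewrite ge0_fin_numE //; apply: fin; [exact: measurableI|rewrite EE => t [_ ?]; left].
  - by rewrite ge0_fin_numE //; apply: fin; [exact: measurableI|rewrite EE => t [_ ?]; right].
rewrite [X in (_ <= X)%E](_ : _ = \int[mu]_(t in E1) (rnorm (y + v ord0 + S t))%:E +
    \int[mu]_(t in E2) (rnorm (y + S t))%:E)%E; last first.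
  rewrite EE ge0_integral_setU //.
  - congr (_ + _)%E; apply: eq_integral => t; rewrite inE big_ord_recl indicE => -[h1 h2].
      by rewrite mem_set // scale1r addrA.
    by rewrite memNset // scale0r add0r.
  - apply/measurable_EFinP/measurable_funTS; exact: (measurable_rnorm_sum v y mA).
  - by move=> t _; rewrite lee_fin rnorm_ge0.
  - by apply/disj_setPS => t [[_ h] [_]]; apply.
apply: le_trans (leeD (IH (fun i => A (lift ord0 i)) (fun i =>
  v (lift ord0 i)) (y + v ord0) _ (fun i => mA (lift ord0 i)) mE1 fE1) (IH (fun i =>
  A (lift ord0 i)) (fun i => v (lift ord0 i)) y _ (fun i => mA (lift ord0 i)) mE2 fE2)) => //.
rewrite -EFinD lee_fin; apply: le_trans (rnormD _ _); rewrite le_eqVlt; apply/orP; left;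
  apply/eqP.
congr rnorm; rewrite big_ord_recl /= -[E]setTI (split_mu setT) // !setTI.
have -> : A ord0 `&` E = E1 by rewrite setIC.
have sA i := split_mu _ (mA (lift ord0 i)).
under eq_bigr => i _ do rewrite (sA i) rmorphD /= scalerDl.
rewrite big_split /= rmorphD /= !scalerDl !scalerDr.
by rewrite [X in _ + X = _]addrA addrACA; congr (_ + _); rewrite addrA.
Qed.

Lemma rnorm_simple_integral D s : measurable D -> (mu D < +oo)%E ->
  ((rnorm (simple_integral D s))%:E <= L1norm D (simple_fun s))%E.
Proof.
move=> mD fD; have := rnorm_integral_sum (simple_vec (s := s)) 0 (simple_measurable (s := s)) mD
  fD.
rewrite scaler0 add0r => /le_trans; apply.
by under eq_integral do rewrite add0r.
Qed.


Lemma ae_mono (P Q : R -> Prop) : {ae mu, forall t, P t} -> (forall t, P t -> Q t) ->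
  {ae mu, forall t, Q t}.
Proof. by move=> hP PQ; apply: negligibleS hP => t; apply: contra_not => /PQ. Qed.

Lemma cvg0_EFin_le (a : nat -> R) (b : nat -> \bar R) : (forall k, 0 <= a k) ->
  (forall k, ((a k)%:E <= b k)%E) -> b @ \oo --> 0%E -> a @ \oo --> (0 : R).
Proof.
move=> a0 ab b0; suff /fine_cvgP[] : (a k)%:E @[k --> \oo] --> (0 : R)%:E by [].
apply: (@squeeze_cvge _ _ _ _ (fun=> 0%E) _ b) => //; last exact: cvg_cst.
by apply: nearW => k; rewrite lee_fin a0 ab.
Qed.

Lemma bochner_bound D f v : measurable D -> (mu D < +oo)%E ->
  is_bochner_integral D f v -> ((rnorm v)%:E <= L1norm D f)%E.
Proof.
move=> mD fD [hf [s [s0 sv]]].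
have [->|fo] := eqVneq (L1norm D f) +oo%E; first by rewrite leey.
have h : (L1norm D (fun t => f t - simple_fun (s k) t)%R + L1norm D f)%E @[k --> \oo] --> (0 +
  L1norm D f)%E.
  apply: cvgeD => //; last exact: cvg_cst.
have h' : (rnorm (simple_integral D (s k)))%:E @[k --> \oo] --> (rnorm v)%:E.
  by apply: cvg_EFin; [exact: nearW|exact: cvg_rnorm sv].
rewrite -[leRHS]add0e; apply: (lee_cvg_to h' h).
apply: nearW => k; apply: (le_trans (rnorm_simple_integral _ mD fD)).
rewrite [X in (X <= _)%E](_ : _ = L1norm D (fun t => - (f t - simple_fun (s k) t) + f t)%R).
  rewrite -(L1normN D (fun t => f t - simple_fun (s k) t)%R).
  apply: L1normD => //; apply: sm_opp; apply: sm_sub => //; exact: sm_simple.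
by apply: L1norm_eq => t _; rewrite opprB subrK.
Qed.

Lemma bochner_simple D s : is_bochner_integral D (simple_fun s) (simple_integral D s).
Proof.
split; first exact: sm_simple.
exists (fun=> s); split; last exact: cvg_cst.
rewrite (_ : (fun=> _) = (fun=> 0%E)); first exact: cvg_cst.
apply/funext => k; rewrite integral0_eq // => t _; by rewrite subrr rnorm0.
Qed.

Lemma bochner_add D f g v w : measurable D ->
  is_bochner_integral D f v -> is_bochner_integral D g w ->
  is_bochner_integral D (fun t => f t + g t) (v + w).
Proof.
move=> mD [hf [s [s0 sv]]] [hg [s' [s0' sw]]]; split; first exact: sm_add.
exists (fun k => simple_add (s k) (s' k)); split; last first.
  by under eq_fun do rewrite simple_add_integral; exact: cvgD.
apply: (@squeeze_cvge _ _ _ _ (fun=> 0%E) _ (fun k => L1norm D (fun t =>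
  f t - simple_fun (s k) t)%R + L1norm D (fun t => g t - simple_fun (s' k) t)%R)%E).
- apply: nearW => k; apply/andP; split; first exact: L1norm_ge0.
  rewrite [X in (X <= _)%E](_ : _ = L1norm D (fun t =>
    (f t - simple_fun (s k) t) + (g t - simple_fun (s' k) t))%R).
    by apply: L1normD => //; apply: sm_sub => //; exact: sm_simple.
  by apply: L1norm_eq => t _; rewrite simple_addE opprD addrACA.
- exact: cvg_cst.
- by rewrite -[X in _ --> X]adde0; exact: cvgeD.
Qed.

Lemma bochner_lin D f v L : measurable D -> linear L -> continuous L ->
  is_bochner_integral D f v -> is_bochner_integral D (fun t => L (f t)) (L v).
Proof.
move=> mD lL cL [hf [s [s0 sv]]]; split; first exact: sm_lin.
exists (fun k => simple_map L (s k)); split; last first.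
  under eq_fun do rewrite simple_map_integral //; exact: (cvg_comp _ _ sv (cL v)).
have [M M0 hM] := bounded_rnorm lL cL.
apply: (@squeeze_cvge _ _ _ _ (fun=> 0%E) _ (fun k => M%:E * L1norm D (fun t =>
  f t - simple_fun (s k) t)%R)%E).
- apply: nearW => k; apply/andP; split; first exact: L1norm_ge0.
  rewrite [X in (X <= _)%E](_ : _ = L1norm D (fun t => L (f t - simple_fun (s k) t))).
    by apply: L1norm_lin => //; [apply: sm_sub => //; exact: sm_simple|exact: ltW].
  by apply: L1norm_eq => t _; rewrite simple_mapE // (linB lL).
- exact: cvg_cst.
- by rewrite -(mule0 M%:E); exact: cvgeZl.
Qed.

Lemma bochner_opp D f v : measurable D ->
  is_bochner_integral D f v -> is_bochner_integral D (fun t => - f t) (- v).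
Proof.
move=> mD /(bochner_lin mD (linear_scale (-1)) (@continuous_scale (-1))).
by rewrite scaleN1r; under eq_fun do rewrite scaleN1r.
Qed.

Lemma bochner_sub D f g v w : measurable D ->
  is_bochner_integral D f v -> is_bochner_integral D g w ->
  is_bochner_integral D (fun t => f t - g t) (v - w).
Proof. by move=> mD hf /(bochner_opp mD); exact: bochner_add. Qed.

Lemma bochner_ae D f g v : measurable D -> strongly_measurable D g ->
  {ae mu, forall t, D t -> f t = g t} -> is_bochner_integral D f v -> is_bochner_integral D g v.
Proof.
move=> mD hg fg [hf [s [s0 sv]]]; split => //; exists s; split => //.
rewrite (_ : (fun _ => _) = (fun k =>
  \int[mu]_(t in D) (rnorm (f t - simple_fun (s k) t))%:E)%E) //.
apply/funext => k; apply: ae_eq_integral => //.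
- by apply: sm_ernorm => //; apply: sm_sub => //; exact: sm_simple.
- by apply: sm_ernorm => //; apply: sm_sub => //; exact: sm_simple.
- by apply: (@ae_mono (fun t => D t -> f t = g t)) => // t h Dt; rewrite h.
Qed.

Lemma bochner_dist D f g v w : measurable D -> (mu D < +oo)%E ->
  is_bochner_integral D f v -> is_bochner_integral D g w ->
  ((rnorm (v - w))%:E <= L1norm D (fun t => f t - g t)%R)%E.
Proof. by move=> mD fD hf hg; apply: bochner_bound => //; exact: bochner_sub. Qed.

(** On a set of finite measure a uniform error [e k] costs at most [e k * mu D] in [L1norm], so the
    integrals of the approximants are Cauchy. *)
Lemma bochner_uniform D f (s : nat -> simple X) (e : nat -> R) : measurable D -> (mu D < +oo)%E ->
  e @ \oo --> (0 : R) -> (forall k t, D t -> rnorm (f t - simple_fun (s k) t) <= e k) ->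
  exists v, is_bochner_integral D f v.
Proof.
move=> mD fD e0 hs.
have muD : mu D = (fine (mu D))%:E by rewrite fineK // ge0_fin_numE.
have sf : strongly_measurable D f.
  exists s => t Dt; apply/cvg_rnormP; apply: cvg_squeeze0 e0.
  by apply: nearW => k; rewrite rnorm_ge0 rdistC hs.
have [v hv] : exists v, (fun k => simple_integral D (s k)) @ \oo --> v.
  apply: rnorm_cauchy => d d0.
  pose c := fine (mu D) + 1; have c0 : 0 < c by rewrite ltr_wpDl ?fine_ge0.
  have dc : 0 < d / (2 * c) by rewrite divr_gt0 // mulr_gt0.
  have /cvgrPdist_lt/(_ _ dc) [n0 _ hn0] := e0; exists n0 => n m hn hm.
  have en k : (n0 <= k)%N -> e k < d / (2 * c).
    by move=> /hn0 /=; rewrite sub0r normrN => /ltr_normlP[].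
  have := bochner_dist mD fD (bochner_simple D (s n)) (bochner_simple D (s m)).
  have hb : (L1norm D (fun t => simple_fun (s n) t - simple_fun (s m) t)%R <= (e n + e m)%:E *
    mu D)%E.
    apply: L1norm_bound => //; first by apply: sm_sub; exact: sm_simple.
    move=> t Dt; rewrite (le_trans (rnorm_triangle (f t) _ _)) // lerD ?hs //.
    by rewrite rdistC hs.
  move=> /le_trans /(_ hb); rewrite muD -EFinM lee_fin => /le_lt_trans; apply.
  apply: le_lt_trans (_ : d / (2 * c) * 2 * fine (mu D) < d).
    by rewrite ler_wpM2r ?fine_ge0 // mulr_natr mulr2n lerD // ltW // en.
  rewrite -mulrA mulrAC ltr_pdivrMr ?mulr_gt0 // ltr_pM2l // ltr_pM2l //.
  by rewrite /c ltrDl.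
exists v; split => //; exists s; split => //.
apply: (@squeeze_cvge _ _ _ _ (fun=> 0%E) _ (fun k => (e k * fine (mu D))%:E)).
- apply: nearW => k; apply/andP; split; first exact: L1norm_ge0.
  rewrite EFinM -muD; apply: L1norm_bound => //; last by move=> t; exact: hs.
  by apply: sm_sub => //; exact: sm_simple.
- exact: cvg_cst.
- apply/cvg_EFin; first exact: nearW.
  by rewrite -(mul0r (fine (mu D))); apply: cvgM => //; exact: cvg_cst.
Qed.

(** [N] is there for open intervals: cutting one at a point loses that point. *)
Lemma simple_integral_split D E1 E2 N s : measurable D -> measurable E1 -> measurable E2 ->
  measurable N ->
  D = E1 `|` (N `|` E2) -> E1 `&` E2 = set0 -> mu N = 0%E ->
  simple_integral D s = simple_integral E1 s + simple_integral E2 s.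
Proof.
move=> mD m1 m2 mN DE d12 N0; rewrite /simple_integral -big_split /=; apply: eq_bigr => i _.
rewrite -scalerDl -rmorphD /=; congr (_%:C *: _).
have mA := simple_measurable i; have fA := simple_finite i.
set A := simple_set i in mA fA *.
have fin F : measurable F -> F `<=` A -> mu F \is a fin_num.
  move=> mF FA; rewrite ge0_fin_numE //; apply: le_lt_trans fA.
  by apply: le_measure => //; rewrite inE.
rewrite -fineD; [|by apply: fin; [exact: measurableI|move=> t []]..].
congr fine; rewrite (measureDI mu (A := A `&` D) (B := E1)) //; last exact: measurableI.
rewrite addeC; congr (_ + _)%E.
  by congr (mu _); rewrite -setIA; congr (_ `&` _); apply: setIidr; rewrite DE => t; left.
apply/eqP; rewrite eq_le; apply/andP; split.
  apply: (@le_trans _ _ (mu ((A `&` E2) `|` N))).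
    apply: le_measure; rewrite ?inE.
    - by apply: measurableD => //; exact: measurableI.
    - by apply: measurableU => //; exact: measurableI.
    - by rewrite DE => t [[At [//|[Nt|E2t]]] _]; [right|left].
  apply: (le_trans (measureU2 _ _ _)) => //; first exact: measurableI.
  by rewrite -[leRHS]adde0; apply: leeD => //; rewrite le_eqVlt; apply/orP; left; apply/eqP;
    exact: N0.
apply: le_measure; rewrite ?inE.
- exact: measurableI.
- by apply: measurableD => //; exact: measurableI.
- move=> t [At E2t]; split; first by split => //; rewrite DE; right; right.
  by move=> E1t; have : (E1 `&` E2) t by []; rewrite d12.
Qed.

(** The simple functions approximating [f] on [D] also serve on [E1] and [E2]. Their integrals over
    [E1] tend to [w] by [bochner_dist], so those over [E2] tend to the difference, and existence on
    [E2] comes for free. *)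
Lemma bochner_split D E1 E2 N f v w : measurable D -> (mu D < +oo)%E -> measurable E1 ->
  measurable E2 -> measurable N ->
  D = E1 `|` (N `|` E2) -> E1 `&` E2 = set0 -> mu N = 0%E ->
  is_bochner_integral D f v -> is_bochner_integral E1 f w -> is_bochner_integral E2 f (v - w).
Proof.
move=> mD fD m1 m2 mN DE d12 N0 [hf [s [s0 sv]]] hw.
have sub1 : E1 `<=` D by rewrite DE => t; left.
have sub2 : E2 `<=` D by rewrite DE => t; right; right.
have f1 : (mu E1 < +oo)%E by apply: le_lt_trans fD; apply: le_measure; rewrite ?inE.
have sk k : strongly_measurable D (fun t => f t - simple_fun (s k) t).
  by apply: sm_sub => //; exact: sm_simple.
split; first exact: sm_subset hf.
exists s; split.
  apply: (@squeeze_cvge _ _ _ _ (fun=> 0%E) _ (fun k => L1norm D (fun t =>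
    f t - simple_fun (s k) t)%R)) => //; last exact: cvg_cst.
  by apply: nearW => k; rewrite L1norm_ge0 L1norm_subset.
have sw : (fun k => simple_integral E1 (s k)) @ \oo --> w.
  apply/cvg_rnormP.
  apply: (@cvg0_EFin_le _ (fun k => L1norm D (fun t => f t - simple_fun (s k) t)%R)) => // k.
    exact: rnorm_ge0.
  rewrite rdistC; apply: (le_trans (bochner_dist m1 f1 hw (bochner_simple E1 (s k)))).
  exact: L1norm_subset.
have E k : simple_integral E2 (s k) = simple_integral D (s k) - simple_integral E1 (s k).
  by rewrite (simple_integral_split _ mD m1 m2 mN DE d12 N0) addrAC subrr add0r.
by under eq_fun do rewrite E; exact: cvgB.
Qed.

Lemma mu_itvoo (a b : R) : a <= b -> mu `]a, b[ = (b - a)%:E.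
Proof.
move=> ab; rewrite lebesgue_measure_itv /= lte_fin; case: ltP => // ba.
have -> : a = b by apply/eqP; rewrite eq_le ab ba.
by rewrite subrr.
Qed.

Lemma mu_itvoo_fin (a b : R) : (mu `]a, b[ < +oo)%E.
Proof. by rewrite lebesgue_measure_itv /=; case: ifP => _; rewrite ltry. Qed.

Lemma bochner_itv_split (a b c : R) f v w : a < b -> b < c ->
  is_bochner_integral `]a, c[ f v -> is_bochner_integral `]a, b[ f w ->
  is_bochner_integral `]b, c[ f (v - w).
Proof.
move=> ab bc; apply: (@bochner_split _ _ _ [set b]) => //.
- exact: mu_itvoo_fin.
- apply/seteqP; split => t /=; rewrite !in_itv /=.
    move=> /andP[at_ tc]; case: (ltgtP t b) => [tb|bt|->]; [left|right; right|right; left] => //.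
      by rewrite at_.
  move=> [/andP[-> tb]|[->|/andP[bt ->]]]; rewrite ?andbT ?ab ?bc //; first exact: lt_trans bc.
  exact: lt_trans bt.
- by apply/seteqP; split => // t /=; rewrite !in_itv /= => -[/andP[_ h1] /andP[h2 _]];
  have := lt_trans h1 h2; rewrite ltxx.
- exact: lebesgue_measure_set1.
Qed.

Definition itv_simple (a b : R) x : simple X :=
  @Simple R X 1 (fun=> `]a, b[%classic) (fun=> x) (fun=> measurable_itv _) (fun=> mu_itvoo_fin a
    b).

Lemma itv_simpleE a b x t : a < t -> t < b -> simple_fun (itv_simple a b x) t = x.
Proof.
by move=> at_ tb; rewrite /simple_fun big_ord1 indicE mem_set ?scale1r //= in_itv /= at_ tb.
Qed.

Lemma bochner_itv_cst (a b : R) x : a <= b ->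
  is_bochner_integral `]a, b[ (fun=> x) ((b - a)%:C *: x).
Proof.
move=> ab; have := bochner_simple `]a, b[ (itv_simple a b x).
rewrite /simple_integral big_ord1 /= setIid mu_itvoo //=.
apply: bochner_ae => //; last first.
  by apply: aeW => t /=; rewrite in_itv /= => /andP[h1 h2]; rewrite itv_simpleE.
exists (fun=> itv_simple a b x) => t /=; rewrite in_itv /= => /andP[h1 h2].
by rewrite itv_simpleE //; exact: cvg_cst.
Qed.

Lemma bochner_const_dist (a b : R) f v x (e : R) : a <= b ->
  is_bochner_integral `]a, b[ f v -> (forall t, a < t -> t < b -> rnorm (f t - x) <= e) ->
  rnorm (v - (b - a)%:C *: x) <= (b - a) * e.
Proof.
move=> ab hf he; rewrite -lee_fin.
apply: (le_trans (bochner_dist _ (mu_itvoo_fin a b) hf (bochner_itv_cst x ab))) => //.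
rewrite mulrC EFinM -mu_itvoo //; apply: L1norm_bound => //.
  by apply: sm_sub; [case: hf|case: (bochner_itv_cst x ab)].
by move=> t /=; rewrite in_itv /= => /andP[]; exact: he.
Qed.

Definition step_simple (a d : R) (n : nat) f : simple X :=
  @Simple R X n (fun i => `[(a + i%:R * d), (a + i.+1%:R * d)[%classic) (fun i =>
    f (a + i%:R * d))
    (fun=> measurable_itv _)
    (fun i => (fun b c : R => ltac:(by rewrite lebesgue_measure_itv /=; case: ifP => _;
      rewrite ltry) : (mu `[b, c[ < +oo)%E) _ _).

Lemma step_simpleE (a d : R) n f (i : 'I_n) t : 0 < d -> a + i%:R * d <= t ->
  t < a + i.+1%:R * d ->
  simple_fun (step_simple a d n f) t = f (a + i%:R * d).
Proof.
move=> d0 h1 h2; rewrite /simple_fun (bigD1 i) //= big1 ?addr0.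
  by rewrite indicE mem_set ?scale1r //= in_itv /= h1 h2.
move=> j ji; rewrite indicE memNset ?scale0r //= in_itv /= => /andP[h3 h4].
have ij : (i < j.+1)%N.
  by rewrite -(ltr_nat R) -(ltr_pM2r d0) -(ltrD2l a); exact: le_lt_trans h4.
have ji' : (j < i.+1)%N.
  by rewrite -(ltr_nat R) -(ltr_pM2r d0) -(ltrD2l a); exact: le_lt_trans h2.
by rewrite !ltnS in ij ji'; move: ji; rewrite -val_eqE /= eqn_leq ij ji'.
Qed.

(** Step functions taking the values at the left endpoints of a fine partition are uniformly close
    to [f]. *)
Lemma bochner_continuous (a b : R) f : a < b ->
  (forall e : R, 0 < e -> exists2 d : R, 0 < d &
    forall r t : R, a <= r -> r <= t -> t < b -> t - r < d -> rnorm (f t - f r) <= e) ->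
  exists v, is_bochner_integral `]a, b[ f v.
Proof.
move=> ab hf.
have : forall k : nat, exists s : simple X, forall t,
  a < t -> t < b -> rnorm (f t - simple_fun s t) <= k.+1%:R^-1.
  move=> k; have k0 : 0 < (k.+1%:R^-1 : R) by rewrite invr_gt0.
  have [d d0 hd] := hf _ k0.
  pose n := (Num.truncn ((b - a) / d)).+1; pose h := (b - a) / n%:R.
  have n0 : 0 < (n%:R : R) by rewrite ltr0n.
  have h0 : 0 < h by rewrite divr_gt0 // subr_gt0.
  have hd' : h < d by rewrite ltr_pdivrMr // mulrC -ltr_pdivrMr // truncnS_gt.
  exists (step_simple a h n f) => t at_ tb.
  pose i := Num.truncn ((t - a) / h).
  have ta : 0 <= (t - a) / h by rewrite divr_ge0 ?ltW // subr_gt0.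
  have /andP[i1 i2] : i%:R <= (t - a) / h < i.+1%:R by exact: truncn_itv.
  have i1' : a + i%:R * h <= t by rewrite addrC -lerBrDr -ler_pdivlMr.
  have i2' : t < a + i.+1%:R * h by rewrite addrC -ltrBlDr -ltr_pdivrMr.
  have i_n : (i < n)%N.
    rewrite -(ltr_nat R); apply: (le_lt_trans i1);
      rewrite ltr_pdivrMr // /h mulrC divfK ?gt_eqF //.
    by rewrite ltrD2r.
  rewrite (step_simpleE f (i := Ordinal i_n) h0 i1' i2') /=; apply: hd => //.
    by rewrite lerDl mulr_ge0 // ltW.
  by apply: lt_trans hd'; move: i2'; rewrite -natr1 mulrDl mul1r; lra.
move=> /choice [s hs]; apply: (@bochner_uniform _ _ s (fun k => k.+1%:R^-1)) => //.
- exact: mu_itvoo_fin.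
- exact: cvg_harmonic.
- by move=> k t /=; rewrite in_itv /= => /andP[]; exact: hs.
Qed.

End bochner_theory.

(** * The generator and uniqueness for the Cauchy problem *)

Section generator_theory.
Context {R : realType} {X : completeNormedModType R[i]}.
Local Notation mu := (@lebesgue_measure R).

Lemma bochner_L1norm_fin (D : set R) (f : R -> X) v : measurable D -> (mu D < +oo)%E ->
  is_bochner_integral D f v -> (L1norm D f < +oo)%E.
Proof.
move=> mD fD [hf [s [s0 _]]].
have : \forall k \near \oo, ((\int[mu]_(t in D) (rnorm (f t - simple_fun (s k) t))%:E)%E < +oo)%E.
  have /fine_cvgP[h _] := s0.
  by apply: filterS h => k; rewrite ge0_fin_numE // L1norm_ge0.
move=> [k _ /(_ k (leqnn k)) hk].
have ssm : strongly_measurable D (simple_fun (s k)) by exact: sm_simple.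
rewrite (@L1norm_eq _ _ D f (fun t => (f t - simple_fun (s k) t) + simple_fun (s k) t));
  last first.
  by move=> t _; rewrite subrK.
apply: (le_lt_trans (L1normD mD (sm_sub hf ssm) ssm)); apply: lte_add_pinfty; first exact: hk.
apply: (@le_lt_trans _ _ ((\sum_(i < simple_len (s k)) rnorm (simple_vec i))%:E * mu D)%E).
  apply: L1norm_bound => // t _; apply: (le_trans (rnorm_sum _ _ _)); apply: ler_sum => i _.
  by rewrite rnormZ_ge0 // ler_piMl ?rnorm_ge0 // indicE; case: (_ \in _).
apply: lte_mul_pinfty => //; by rewrite lee_fin sumr_ge0 // => i _; exact: rnorm_ge0.
Qed.

Context (T : R -> X -> X) (A : operator X).
Hypothesis sgT : C0_semigroup T.
Hypothesis genA : forall x y : X, (dom A x /\ A x = y) <->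
  (h^-1)%:C *: (T h x - x) @[h --> (0 : R)^'+] --> y.

Lemma gen_lin (c : R[i]) x y : dom A x -> dom A y ->
  dom A (c *: x + y) /\ A (c *: x + y) = c *: A x + A y.
Proof.
move=> dx dy; apply/genA.
have /genA hx : dom A x /\ A x = A x by [].
have /genA hy : dom A y /\ A y = A y by [].
have h : c *: ((h^-1)%:C *: (T h x - x)) + (h^-1)%:C *: (T h y - y) @[h --> (0 : R)^'+] --> c *:
  A x + A y.
  by apply: cvgD => //; apply: (cvg_comp _ _ hx); exact: continuous_scale.
apply: cvg_trans h; apply: near_eq_cvg; apply/near_right0; exists 1 => // t t0 _.
have lT := sg_linear sgT (ltW t0).
by rewrite (linD lT) (linZ lT) scalerA mulrC -scalerA -scalerDr scalerBr opprD addrACA.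
Qed.

Lemma gen0 : dom A 0 /\ A 0 = 0.
Proof.
apply/genA; apply/cvg_right0P => e e0; exists 1 => // t t0 _.
by rewrite (lin0 (sg_linear sgT (ltW t0))) !subr0 scaler0 rnorm0.
Qed.

Lemma genD x y : dom A x -> dom A y -> dom A (x + y) /\ A (x + y) = A x + A y.
Proof. by move=> dx /(gen_lin 1 dx); rewrite !scale1r. Qed.

Lemma genZ c x : dom A x -> dom A (c *: x) /\ A (c *: x) = c *: A x.
Proof. by move=> dx; have := gen_lin c dx gen0.1; rewrite gen0.2 !addr0. Qed.

Lemma genB x y : dom A x -> dom A y -> dom A (x - y) /\ A (x - y) = A x - A y.
Proof.
move=> dx dy; have [d e] := genZ (-1) dy; rewrite !scaleN1r in d e.
by rewrite -e; exact: genD.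
Qed.

Lemma gen_sum (I : Type) (r : seq I) (P : pred I) (F : I -> X) : (forall i, P i -> dom A (F i)) ->
  dom A (\sum_(i <- r | P i) F i) /\ A (\sum_(i <- r | P i) F i) = \sum_(i <- r | P i) A (F i).
Proof.
move=> dF; elim/big_rec2: _ => [|i y1 y2 Pi [d e]]; first exact: gen0.
by rewrite -e; exact: genD (dF _ Pi) d.
Qed.

Lemma gen_diff_bound : exists2 M : R, 1 <= M & forall h x, dom A x -> 0 < h -> h <= 1 ->
  rnorm (T h x - x) <= h * (M * rnorm (A x)).
Proof.
have [M M1 hM] := sg_bounded sgT 1; exists M => // h x dx; apply: (sg_diff_bound sgT hM) => //.
  exact: lt_le_trans M1.
exact/genA.
Qed.

(** Since [T h] passes under the integral, the difference quotient of [v] minus [a] is the integral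
    of that of [u] minus [g]. The integrand tends to 0 almost everywhere and is at most
    [(M + 1) * rnorm (g t)] by [gen_diff_bound], so dominated convergence applies. *)
Lemma hille D (u g : R -> X) v a : measurable D -> (mu D < +oo)%E ->
  is_bochner_integral D u v -> is_bochner_integral D g a ->
  {ae mu, forall t, D t -> dom A (u t) /\ A (u t) = g t} ->
  dom A v /\ A v = a.
Proof.
move=> mD fD hu hg hA; apply/genA/cvg_right0P => e e0; apply: contrapT => hn.
(* Dominated convergence concerns sequences, so a failure of the limit is turned into a sequence
   [h k] tending to 0 along which the error stays at least [e]. *)
have : forall k : nat, exists h : R, [/\ 0 < h,
  h < k.+1%:R^-1 & e <= rnorm ((h^-1)%:C *: (T h v - v) - a)].
  move=> k; apply: contrapT => hk; apply: hn; exists k.+1%:R^-1 => [|t t0 tk].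
    by rewrite invr_gt0.
  by rewrite ltNge; apply/negP => ht; apply: hk; exists t.
move=> /choice [h hh].
have h0 k : 0 < h k by have [] := hh k.
have h1 k : h k <= 1.
  by have [_ /ltW/le_trans h2 _] := hh k; apply: h2; rewrite invf_le1 ?ltr0n // ler1n.
have lT k : linear (T (h k)) by exact: sg_linear (ltW (h0 k)).
have cT k : continuous (T (h k)) by case: sgT => /(_ _ (h0 k))[].
pose F k t := ((h k)^-1)%:C *: (T (h k) (u t) - u t) - g t.
have hF k : is_bochner_integral D (F k) (((h k)^-1)%:C *: (T (h k) v - v) - a).
  apply: bochner_sub => //.
  apply: (bochner_lin mD (linear_scale _) (@continuous_scale _ _ _)).
  by apply: bochner_sub => //; exact: bochner_lin.
have [M M1 hM] := gen_diff_bound.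
have M0 : 0 <= M + 1 by rewrite addr_ge0 // (le_trans _ M1).
have Fsm k : strongly_measurable D (F k) by case: (hF k).
have gsm : strongly_measurable D g by case: hg.
have hlim : (\int[mu]_(t in D) (rnorm (F k t))%:E)%E @[k --> \oo] --> 0%E.
  have hdc := @dominated_convergence _ _ _ mu D mD (fun k t => (rnorm (F k t))%:E) (fun=> 0%E)
    (fun t => ((M + 1) * rnorm (g t))%:E).
  have and3_3 : forall P Q S : Prop, [/\ P, Q & S] -> S by move=> ? ? ? [].
  rewrite -(integral0 mu D); apply: (and3_3 _ _ _ (hdc _ _ _ _ _)).
  - by move=> k; apply: sm_ernorm.
  - exact: measurable_cst.
  - apply: (@ae_mono _ (fun t => D t -> dom A (u t) /\ A (u t) = g t)) => // t h3 Dt.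
    have /genA/cvg_right0P hc := h3 Dt.
    apply: cvg_EFin; first exact: nearW.
    apply/cvgrPdist_lt => d d0; have [d' d'0 hd'] := hc _ d0.
    exists (Num.truncn d'^-1).+1 => // k /= hk.
    rewrite sub0r normrN ger0_norm ?rnorm_ge0 //; apply: hd' => //.
    have [_ + _] := hh k; move=> /lt_le_trans; apply.
    rewrite -[leRHS]invrK lef_pV2 ?posrE ?invr_gt0 //.
    apply: (le_trans (ltW (truncnS_gt _))); rewrite ler_nat; exact: leqW.
  - apply/integrableP; split.
      by apply/measurable_EFinP/measurable_funM => //; exact: sm_rnorm.
    under eq_integral => t _.
      rewrite gee0_abs; last by rewrite lee_fin mulr_ge0 ?rnorm_ge0.
      rewrite EFinM; over.
    rewrite ge0_integralZl_EFin //.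
    + by apply: lte_mul_pinfty => //; exact: (bochner_L1norm_fin mD fD hg).
    + by move=> t _; rewrite lee_fin rnorm_ge0.
    + exact: sm_ernorm.
  - apply: (@ae_mono _ (fun t => D t -> dom A (u t) /\ A (u t) = g t)) => // t h3 k Dt.
    have [h4 h5] := h3 Dt.
    rewrite gee0_abs ?lee_fin ?rnorm_ge0 //.
    have hk : 0 <= (h k)^-1 by rewrite invr_ge0 ltW.
    apply: (le_trans (rnormB _ _)); rewrite mulrDl mul1r lerD2r (rnormZ_ge0 _ hk).
    by rewrite ler_pdivrMl // -h5 hM.
have := @cvg0_EFin_le _ (fun k => rnorm (((h k)^-1)%:C *: (T (h k) v - v) - a)) _ _ _ hlim.
move=> /(_ (fun=> rnorm_ge0 _)) /(_ (fun k => bochner_bound mD fD (hF k))).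
move=> /cvgrPdist_lt/(_ _ e0) [k _ /(_ k (leqnn k))].
rewrite sub0r normrN ger0_norm ?rnorm_ge0 //; have [_ _ +] := hh k.
by move=> /le_lt_trans h6 /h6; rewrite ltxx.
Qed.

(* With [W] the primitive of [w], the function [s |-> T (t - s) (W s)] has right derivative zero. *)
Lemma cauchy_unique (t0 : R) (w w' : R -> X) : 0 < t0 -> w 0 = 0 ->
  (forall t, 0 < t -> t <= t0 -> is_bochner_integral `]0, t[ w' (w t)) ->
  {ae mu, forall t, 0 < t -> t < t0 -> dom A (w t) /\ A (w t) = w' t} ->
  (forall e : R, 0 < e -> exists2 d : R, 0 < d &
    forall r t : R, 0 <= r -> r <= t -> t <= t0 -> t - r < d -> rnorm (w t - w r) <= e) ->
  forall t, 0 < t -> t <= t0 -> w t = 0.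
Proof.
move=> t0p w0 hw hA mod_w.
(* [w t] is in the domain for almost every [t] only. Its primitive is in the domain for every [t],
   and [hille] gives [A (W t) = w t], so [W] is a classical solution and [W = 0] implies [w = 0]. *)
have [W [W0 hW]] : exists W : R -> X, W 0 = 0 /\
    forall t, 0 < t -> t <= t0 -> is_bochner_integral `]0, t[ w (W t).
  have : forall t, exists v : X, (t = 0 -> v = 0) /\ (0 < t -> t <= t0 ->
    is_bochner_integral `]0, t[ w v).
    move=> t; have [tp|tp] := ltP 0 t; last by exists 0; split => // h;
      move: (lt_le_trans h tp); rewrite ltxx.
    have [tt|tt] := leP t t0; last by exists 0; split => // _ h; move: (lt_le_trans tt h);
      rewrite ltxx.
    have [v hv] : exists v, is_bochner_integral `]0, t[ w v.
      apply: bochner_continuous => // e /mod_w [d d0 hd]; exists d => // r s r0 rs st rd.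
      by apply: hd => //; rewrite ltW // (lt_le_trans st).
    by exists v; split => // t1; rewrite t1 ltxx in tp.
  by move=> /choice [W hW]; exists W; split => [|t]; [apply: (hW 0).1|apply: (hW t).2].
have AW t : 0 <= t -> t <= t0 -> dom A (W t) /\ A (W t) = w t.
  rewrite le_eqVlt => /predU1P[<- _|tp tt]; first by rewrite W0 w0; exact: gen0.
  apply: (hille _ (mu_itvoo_fin 0 t) (hW t tp tt) (hw t tp tt)) => //.
  apply: (@ae_mono _ (fun t => 0 < t -> t < t0 -> dom A (w t) /\ A (w t) = w' t)) => // s h.
  by rewrite /= in_itv /= => /andP[s0 st]; apply: h => //; exact: lt_le_trans tt.
have Winc r t : 0 <= r -> r < t -> t <= t0 -> is_bochner_integral `]r, t[ w (W t - W r).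
  rewrite le_eqVlt => /predU1P[<- tp tt|r0 rt tt]; first by rewrite W0 subr0; exact: hW.
  by apply: (bochner_itv_split r0 rt); apply: hW => //;
    [exact: lt_trans rt|exact/ltW/(lt_le_trans rt)].
suff W_0 t : 0 < t -> t <= t0 -> W t = 0.
  by move=> t tp tt; rewrite -(AW t (ltW tp) tt).2 W_0 //; exact: gen0.2.
move=> tp tt; have [M M1 hM] := sg_bounded sgT t; have M0 : 0 < M by apply: lt_le_trans M1.
pose g s := T (t - s) (W s).
have gt_ : g t = W t by rewrite /g subrr; case: sgT.
rewrite -gt_; apply: right_derivative0 => [||s s0 st e e0|s s0 st e e0]; first exact: ltW.
- by rewrite /g subr0 W0 (lin0 (sg_linear sgT (ltW tp))).
- have st0 : s <= t0 by exact/ltW/(lt_le_trans st).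
  have eM : 0 < e / (2 * M) by rewrite divr_gt0 // mulr_gt0.
  have [d1 d10 hd1] := mod_w _ eM.
  have /genA/cvg_right0P /(_ _ eM) [d2 d20 hd2] := AW s s0 st0.
  exists (Num.min d1 d2) => [|h h0]; first by rewrite lt_min d10.
  rewrite lt_min => /andP[hhd1 hhd2] sh.
  have ssh : s < s + h by rewrite ltrDl.
  have tsh : 0 <= t - (s + h) by rewrite subr_ge0.
  have lT := sg_linear sgT tsh.
  (* Both brackets are [o(h)]: the first because [w s] is the right derivative of [W] at [s], the
     second because [w s = A (W s)] is that of the orbit of [W s] at 0. *)
  have -> : g (s + h) - g s = T (t - (s + h)) ((W (s + h) - W s - h%:C *: w s) - (T h (W s) - W
    s - h%:C *: w s)).
    rewrite /g [t - s](_ : _ = (t - (s + h)) + h); last by rewrite opprD addrA subrK.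
    rewrite (sgD sgT _ tsh (ltW h0)) -(linB lT); congr (T _ _).
    by rewrite opprB addrA subrK opprB addrA subrK.
  apply: (le_trans (hM _ _ tsh _)); first by rewrite lerBlDr lerDl (le_trans s0) // ltW.
  have b1 : rnorm (W (s + h) - W s - h%:C *: w s) <= h * (e / (2 * M)).
    have := bochner_const_dist (ltW ssh) (Winc _ _ s0 ssh (le_trans sh tt)).
    move=> /(_ (w s) (e / (2 * M))); rewrite [s + h - s]addrAC subrr add0r; apply => r sr rsh.
    apply: hd1 => //; [exact: ltW|exact/ltW/(lt_le_trans rsh)/(le_trans sh)|].
    by apply: lt_trans hhd1; rewrite ltrBlDr addrC.
  have b2 : rnorm (T h (W s) - W s - h%:C *: w s) <= h * (e / (2 * M)).
    have -> : T h (W s) - W s - h%:C *: w s = h%:C *: ((h^-1)%:C *: (T h (W s) - W s) - w s).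
      by rewrite scalerBr scalerA -rmorphM /= mulfV ?gt_eqF // scale1r.
    by rewrite (rnormZ_ge0 _ (ltW h0)) ler_pM2l // ltW // hd2.
  have := rnormB (W (s + h) - W s - h%:C *: w s) (T h (W s) - W s - h%:C *: w s).
  move=> /le_trans /(_ (lerD b1 b2)) b3.
  apply: (le_trans (ler_wpM2l (ltW M0) b3)).
  rewrite [leLHS](_ : _ = h * e) //; field; exact: lt0r_neq0.
- have st0 : s <= t0 by exact: le_trans tt.
  have [d1 d10 hd1] := mod_w _ ltr01.
  (* Left continuity: just before [s] the norm of [w] is at most [B], so [W] is Lipschitz there with
     constant [B], and the orbits of its values with constant [M' * B]. *)
  pose B := rnorm (w s) + 1; have B0 : 0 < B by rewrite ltr_wpDl // rnorm_ge0.
  have [M' M'1 hM'] := gen_diff_bound.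
  have M'0 : 0 < M' by apply: lt_le_trans M'1.
  have C0 : 0 < M * (B + M' * B) by rewrite mulr_gt0 // addr_gt0 // mulr_gt0.
  exists (Num.min (Num.min d1 1) (e / (M * (B + M' * B)))).
    by rewrite !lt_min d10 ltr01 divr_gt0.
  move=> r r0 rs; rewrite !lt_min => /andP[/andP[rd1 rd1'] rd2].
  have sr0 : 0 < s - r by rewrite subr_gt0.
  have ts : 0 <= t - s by rewrite subr_ge0.
  have lT := sg_linear sgT ts.
  have rt0 : r <= t0 by exact/ltW/(lt_le_trans rs).
  have -> : g s - g r = T (t - s) ((W s - W r) - (T (s - r) (W r) - W r)).
    rewrite /g [t - r](_ : _ = (t - s) + (s - r)); last by rewrite addrA subrK.
    rewrite (sgD sgT _ ts (ltW sr0)) -(linB lT); congr (T _ _).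
    by rewrite opprB addrA subrK.
  apply: (le_trans (hM _ _ ts _)); first by rewrite lerBlDr lerDl ltW.
  have b1 : rnorm (W s - W r) <= (s - r) * B.
    have := bochner_const_dist (ltW rs) (Winc _ _ r0 rs st0).
    move=> /(_ (w s) 1) h; apply: (le_trans (ler_rnorm_dist _ ((s - r)%:C *: w s))).
    rewrite /B mulrDr mulr1 rnormZ_ge0 ?(ltW sr0) // lerD2l -[leRHS]mulr1; apply: h => q rq qs.
    rewrite rdistC; apply: hd1 => //; [exact/ltW/(le_lt_trans r0)|exact: ltW|].
    by apply: lt_trans rd1; rewrite ltrD2l ltrN2.
  have b2 : rnorm (T (s - r) (W r) - W r) <= (s - r) * (M' * B).
    have [dW eW] := AW r r0 rt0.
    apply: (le_trans (hM' _ _ dW sr0 (ltW rd1'))); rewrite eW ler_pM2l // ler_pM2l //.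
    apply: (le_trans (ler_rnorm_dist _ (w s))); rewrite lerD2l rdistC; apply: hd1 => //;
      exact: ltW.
  have := rnormB (W s - W r) (T (s - r) (W r) - W r).
  move=> /le_trans /(_ (lerD b1 b2)) b3; apply: (le_trans (ler_wpM2l (ltW M0) b3)).
  rewrite -mulrDr mulrCA; move: rd2; rewrite ltr_pdivlMr // => /ltW; exact.
Qed.

End generator_theory.

(** * Estimates in L^p and solutions with piecewise constant force *)

Section powers.
Context {R : realType}.
Implicit Types (p y s : R).

Lemma powR_mono p x y : 0 <= p -> 0 <= x -> x <= y -> x `^ p <= y `^ p.
Proof.
by move=> p0 x0 xy; apply: ge0_ler_powR => //; rewrite nnegrE // (le_trans x0).
Qed.

Lemma powR_le_inv p x y : 0 < p -> 0 <= x -> 0 <= y -> x `^ p <= y `^ p -> x <= y.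
Proof.
move=> p0 x0 y0 h; rewrite leNgt; apply/negP => yx.
have h2 : y `^ p <= x `^ p by apply: powR_mono => //; exact: ltW.
have e : x `^ p = y `^ p by apply/eqP; rewrite eq_le h h2.
by have := powR_injective p0 x0 y0 e => e'; rewrite e' ltxx in yx.
Qed.

(* The [p]-th power lies above its tangent at [s]. *)
Lemma powR_tangent p y s : 1 < p -> 0 <= y -> 0 <= s ->
  s `^ (p - 1) * y <= p^-1 * y `^ p + (1 - p^-1) * s `^ p.
Proof.
move=> p1 y0 s0; have p0 : 0 < p by exact: lt_trans p1.
have p10 : 0 < p - 1 by rewrite subr_gt0.
have q0 : 0 < p / (p - 1) by rewrite divr_gt0.
have := conjugate_powR y0 (powR_ge0 s (p - 1)) p0 q0.
rewrite invf_div -powRrM [(p - 1) * (p / (p - 1))]mulrCA divff ?gt_eqF // mulr1.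
have Q : (p - 1) / p = 1 - p^-1 by rewrite mulrBl mul1r divff ?gt_eqF.
move=> H; rewrite [leLHS]mulrC [p^-1 * _]mulrC [(1 - p^-1) * _]mulrC -Q.
by apply: H; rewrite Q addrC subrK.
Qed.

Lemma powR_pred p s : 0 <= s -> 1 < p -> s `^ (p - 1) * s = s `^ p.
Proof.
move=> s0 p1; rewrite -[X in _ * X](powRr1 s0) -powRD; first by rewrite subrK.
by rewrite subrK; apply/implyP => /eqP h; move: p1; rewrite h ltr10.
Qed.

(** The tangent inequality at the weighted mean [s], summed with the weights. A total weight below 1
    is allowed because the constant term of the inequality, a multiple of the [p]-th power of [s],
    is nonnegative. *)
Lemma jensen_sum (I : Type) (r : seq I) (w c : I -> R) p : 1 < p ->
  (forall i, 0 <= w i) -> (forall i, 0 <= c i) -> \sum_(i <- r) w i <= 1 ->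
  (\sum_(i <- r) w i * c i) `^ p <= \sum_(i <- r) w i * c i `^ p.
Proof.
move=> p1 w0 c0 w1; have p0 : 0 < p by exact: lt_trans p1.
set s := \sum_(i <- r) w i * c i.
have s0 : 0 <= s by apply: sumr_ge0 => i _; rewrite mulr_ge0.
set m := \sum_(i <- r) w i in w1.
have h : s `^ (p - 1) * s <= p^-1 * \sum_(i <- r) w i * c i `^ p + m * ((1 - p^-1) * s `^ p).
  have -> : s `^ (p - 1) * s = \sum_(i <- r) s `^ (p - 1) * (w i * c i) by rewrite -mulr_sumr.
  rewrite mulr_sumr mulr_suml -big_split /=; apply: ler_sum => i _.
  rewrite mulrCA [p^-1 * _]mulrCA -mulrDr; apply: ler_wpM2l => //.
  exact: powR_tangent.
rewrite powR_pred // in h.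
have sp : 0 <= (1 - p^-1) * s `^ p.
  by rewrite mulr_ge0 ?powR_ge0 // subr_ge0 invf_le1 // ltW.
have : m * ((1 - p^-1) * s `^ p) <= (1 - p^-1) * s `^ p by rewrite ler_piMl.
move: h; set S := \sum_(i <- r) _; move=> h1 h2.
have : p^-1 * s `^ p <= p^-1 * S by move: h1 h2; rewrite mulrBl mul1r; lra.
by rewrite ler_pM2l // invr_gt0.
Qed.

End powers.

(** * Hölder's inequality, and step functions on a grid *)

Section Lp.
Context {R : realType} {X : completeNormedModType R[i]}.
Local Notation mu := (@lebesgue_measure R).
Implicit Types (D E : set R) (f g : R -> X) (p : R).

Definition pnorm p D f : \bar R := (\int[mu]_(t in D) (rnorm (f t) `^ p)%:E)%E.

Lemma pnorm_ge0 p D f : (0 <= pnorm p D f)%E.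
Proof. by apply: integral_ge0 => t _; rewrite lee_fin powR_ge0. Qed.

Lemma sm_powR p D f : measurable D -> strongly_measurable D f ->
  measurable_fun D (fun t => rnorm (f t) `^ p).
Proof.
move=> mD hf; apply: (@measurableT_comp _ _ _ _ _ _ (fun x : R => x `^ p)).
  exact: measurable_powR.
exact: sm_rnorm.
Qed.

Lemma sm_pnorm p D f : measurable D -> strongly_measurable D f ->
  measurable_fun D (fun t => (rnorm (f t) `^ p)%:E).
Proof. by move=> mD hf; apply/measurable_EFinP; exact: sm_powR. Qed.

Lemma pnorm_subset p D E f : measurable D -> measurable E -> E `<=` D ->
  strongly_measurable D f -> (pnorm p E f <= pnorm p D f)%E.
Proof.
move=> mD mE ED hf; apply: ge0_subset_integral => //; first exact: sm_pnorm.
by move=> t _; rewrite lee_fin powR_ge0.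
Qed.

Lemma Lpnorm_pow p D f : 0 < p -> (Lpnorm p D f `^ p)%E = pnorm p D f.
Proof.
move=> p0; rewrite /Lpnorm poweR_Lnorm ?gt_eqF // /pnorm [RHS]integral_mkcond.
apply: eq_integral => t _; rewrite /patch; case: ifP => _.
  by rewrite gee0_abs ?lee_fin ?rnorm_ge0 // poweR_EFin.
have -> : (point : \bar R) = 0%E by [].
by rewrite /= normr0 powR0 ?gt_eqF.
Qed.

Lemma Lpnorm_ge0 p D f : (0 <= Lpnorm p D f)%E.
Proof. exact: Lnorm_ge0. Qed.

Lemma Lpnorm_le_pnorm p (C : R) D f g : 0 < p -> 0 <= C ->
  (Lpnorm p D f <= C%:E * Lpnorm p D g)%E ->
  (pnorm p D f <= (C `^ p)%:E * pnorm p D g)%E.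
Proof.
move=> p0 C0 h; rewrite -!Lpnorm_pow // -poweR_EFin -poweRM ?Lpnorm_ge0 ?lee_fin //.
apply: gt0_ler_poweR => //; first exact: ltW.
  by rewrite in_itv /= Lpnorm_ge0 leey.
by rewrite in_itv /= leey andbT mule_ge0 ?Lpnorm_ge0 ?lee_fin.
Qed.

Lemma pnorm_Lpnorm_fin p D f : 0 < p -> (pnorm p D f < +oo)%E -> (Lpnorm p D f < +oo)%E.
Proof.
move=> p0; rewrite -Lpnorm_pow //; case: (Lpnorm p D f) => [r|h|_]; rewrite ?ltry ?ltNyr //.
by move: h; rewrite /= gt_eqF.
Qed.

Lemma Lpnorm_pnorm_fin p D f : 0 < p -> (Lpnorm p D f < +oo)%E -> (pnorm p D f < +oo)%E.
Proof.
move=> p0; rewrite -Lpnorm_pow //; have := Lpnorm_ge0 p D f.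
by case: (Lpnorm p D f) => [r||] //= _ _; rewrite ltry.
Qed.

(** The tangent inequality at the mean [s] of the norm, integrated over the interval. It is written
    for averages because Jensen's inequality over the paths later takes averages of these
    averages. *)
Lemma L1norm_Holder p (a b : R) f (al : R) : 1 < p -> a < b ->
  strongly_measurable `]a, b[ f -> (L1norm `]a, b[ f < +oo)%E -> (pnorm p `]a, b[ f <= al%:E)%E ->
  (fine (L1norm `]a, b[ f) / (b - a)) `^ p <= al / (b - a).
Proof.
move=> p1 ab hf f1 fp; have p0 : 0 < p by exact: lt_trans p1.
have h0 : 0 < b - a by rewrite subr_gt0.
set c := fine _; have c0 : 0 <= c by rewrite fine_ge0 // L1norm_ge0.
have cE : L1norm `]a, b[ f = c%:E by rewrite fineK // ge0_fin_numE // L1norm_ge0.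
set s := c / (b - a); have s0 : 0 <= s by rewrite divr_ge0 // ltW.
have mI : measurable `]a, b[%classic by exact: measurable_itv.
have p1' : 0 <= 1 - p^-1 by rewrite subr_ge0 invf_le1 // ltW.
have key : (((s `^ (p - 1)) * c)%:E <= (p^-1 * al + (1 - p^-1) * s `^ p * (b - a))%:E)%E.
  rewrite EFinM -cE /L1norm -ge0_integralZl_EFin ?powR_ge0 //; last first.
  - exact: sm_ernorm.
  - by move=> t _; rewrite lee_fin rnorm_ge0.
  apply: (@le_trans _ _ (\int[mu]_(t in `]a,
    b[) ((p^-1 * rnorm (f t) `^ p)%:E + ((1 - p^-1) * s `^ p)%:E))%E).
    apply: ge0_le_integral => //.
    - by move=> t _; rewrite -EFinM lee_fin mulr_ge0 ?powR_ge0 ?rnorm_ge0.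
    - apply/measurable_EFinP; apply: measurable_funM => //; exact: sm_rnorm.
    - apply: emeasurable_funD => //; apply/measurable_EFinP; apply: measurable_funM => //.
      exact: sm_powR.
    - move=> t _; rewrite -EFinM -EFinD lee_fin; apply: powR_tangent => //; exact: rnorm_ge0.
  rewrite ge0_integralD //.
  - rewrite EFinD; apply: leeD.
      under eq_integral do rewrite EFinM.
      rewrite ge0_integralZl_EFin //.
      + by rewrite EFinM; apply: lee_wpmul2l => //; rewrite lee_fin invr_ge0 ltW.
      + by move=> t _; rewrite lee_fin powR_ge0.
      + exact: sm_pnorm.
      + by rewrite invr_ge0 ltW.
    by rewrite integral_cst // [X in (_ <= X)%E]EFinM -(mu_itvoo (ltW ab)).
  - by move=> t _; rewrite lee_fin mulr_ge0 ?powR_ge0 // invr_ge0 ltW.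
  - apply/measurable_EFinP; apply: measurable_funM => //; exact: sm_powR.
  - by move=> t _; rewrite lee_fin mulr_ge0 ?powR_ge0.
have cs : c = s * (b - a) by rewrite /s divfK // gt_eqF.
rewrite lee_fin [X in _ * X <= _]cs mulrA powR_pred // in key.
rewrite ler_pdivlMr //.
have : p^-1 * (s `^ p * (b - a)) <= p^-1 * al by move: key; rewrite mulrBl mul1r mulrBl -mulrA;
  lra.
by rewrite ler_pM2l // invr_gt0.
Qed.

Definition cell (h : R) (k : nat) : set R := `](k%:R * h), (k.+1%:R * h)[%classic.

Lemma measurable_cell h k : measurable (cell h k).
Proof. exact: measurable_itv. Qed.

Lemma cellP h k t : cell h k t <-> k%:R * h < t /\ t < k.+1%:R * h.
Proof. by rewrite /cell /= in_itv /=; split => [/andP|[-> ->]]. Qed.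

Lemma pnorm_cells p (h : R) f (K : nat) : 0 < h -> strongly_measurable (@Rplus R) f ->
  (\sum_(k < K) pnorm p (cell h k) f <= pnorm p (@Rplus R) f)%E.
Proof.
move=> h0 hf.
have IR (b : R) : `]0, b[%classic `<=` (@Rplus R) by move=> t /=; rewrite in_itv /= => /andP[].
have mR : measurable (@Rplus R).
  by rewrite (_ : @Rplus R = `]0, +oo[%classic) //; apply/seteqP; split => t /=;
    rewrite in_itv /= andbT.
apply: (@le_trans _ _ (pnorm p `]0, (K%:R * h)[ f)); last by apply: pnorm_subset.
elim: K => [|K IH]; first by rewrite big_ord0 pnorm_ge0.
rewrite big_ord_recr /=; apply: (le_trans (leeD IH (lexx _))).
have Kh : 0 <= K%:R * h by rewrite mulr_ge0 // ltW.
have KK : K%:R * h <= K.+1%:R * h by rewrite ler_pM2r // ler_nat.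
have s1 : `]0, (K%:R * h)[%classic `|` `](K%:R * h), (K.+1%:R * h)[%classic `<=` `]0,
  (K.+1%:R * h)[%classic.
  move=> t [] /=; rewrite !in_itv /= => /andP[h1 h2]; first by rewrite h1 (lt_le_trans h2).
  by rewrite h2 andbT; exact: le_lt_trans h1.
have sf D : D `<=` (@Rplus R) -> strongly_measurable D f by move=> DR; exact: sm_subset hf.
rewrite /pnorm -ge0_integral_setU //; try exact: measurable_cell.
- apply: ge0_subset_integral => //; first by apply: measurableU => //; exact: measurable_cell.
  + by apply: sm_pnorm => //; exact: sf.
  + by move=> t _; rewrite lee_fin powR_ge0.
- apply: sm_pnorm; first by apply: measurableU => //; exact: measurable_cell.
  by apply: sf => t /s1; exact: IR.
- by move=> t _; rewrite lee_fin powR_ge0.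
- apply/disj_setPS => t [] /=; rewrite !in_itv /= => /andP[_ h1] /andP[h2 _].
  by have := lt_trans h1 h2; rewrite ltxx.
Qed.

(** The cells are open, so the value at the grid points is 0; they form a null set. *)
Definition cells (h : R) (K : nat) (phi : nat -> X) (t : R) : X :=
  \sum_(k < K) (\1_(cell h k) t)%:C *: phi k.

Lemma sm_cells D h K phi : strongly_measurable D (cells h K phi).
Proof.
exists (fun=> @Simple R X K (fun k => cell h k) (fun k => phi k)
  (fun=> measurable_itv _) (fun=> mu_itvoo_fin _ _)) => t _.
exact: cvg_cst.
Qed.

Lemma cellsE h K phi (k : 'I_K) t : 0 < h -> k%:R * h < t -> t < k.+1%:R * h ->
  cells h K phi t = phi k.
Proof.
move=> h0 h1 h2; rewrite /cells (bigD1 k) //= big1 ?addr0.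
  by rewrite indicE mem_set ?scale1r //; apply/cellP.
move=> j ji; rewrite indicE memNset ?scale0r // => /cellP[h3 h4].
have ij : (k < j.+1)%N by rewrite -(ltr_nat R) -(ltr_pM2r h0); exact: lt_trans h4.
have ji' : (j < k.+1)%N by rewrite -(ltr_nat R) -(ltr_pM2r h0); exact: lt_trans h2.
by rewrite !ltnS in ij ji'; move: ji; rewrite -val_eqE /= eqn_leq ij ji'.
Qed.

Lemma pnorm_cells_eq p h K phi : 0 < h -> 0 < p ->
  (pnorm p (@Rplus R) (cells h K phi) <= (\sum_(k < K) h * rnorm (phi k) `^ p)%:E)%E.
Proof.
move=> h0 p0.
have mR : measurable (@Rplus R).
  by rewrite (_ : @Rplus R = `]0, +oo[%classic) //; apply/seteqP; split => t /=;
    rewrite in_itv /= andbT.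
pose F (k : 'I_K) t := ((rnorm (phi k) `^ p)%:E * (\1_(cell h k) t)%:E)%E.
have mF k : measurable_fun (@Rplus R) (F k).
  by apply/measurable_EFinP; apply: measurable_funM => //; apply: measurable_indic;
    exact: measurable_cell.
have F0 k t : (0 <= F k t)%E by rewrite /F -EFinM lee_fin mulr_ge0 ?powR_ge0.
apply: (@le_trans _ _ (\int[mu]_(t in @Rplus R) \sum_(k < K) F k t)%E).
  apply: ge0_le_integral => //.
  - by move=> t _; rewrite lee_fin powR_ge0.
  - by apply: sm_pnorm => //; exact: sm_cells.
  - exact: emeasurable_fun_sum.
  move=> t _; have [[k /andP[k1 k2]]|hn] := pselect (exists k : 'I_K, k%:R * h < t < k.+1%:R * h).
    rewrite (cellsE phi h0 k1 k2) (bigD1 k) //= {1}/F indicE mem_set ?mule1 /=; last exact/cellP.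
    by rewrite leeDl // sume_ge0.
  rewrite /cells big1 => [|k _]; last first.
    by rewrite indicE memNset ?scale0r // => /cellP[? ?]; apply: hn; exists k; apply/andP.
  by rewrite rnorm0 powR0 ?gt_eqF // sume_ge0.
rewrite ge0_integral_sum // -sumEFin; apply: lee_sum => k _.
rewrite /F ge0_integralZl_EFin ?powR_ge0 //; last by apply/measurable_EFinP/measurable_indic;
  exact: measurable_cell.
rewrite integral_indic //; last exact: measurable_cell.
rewrite [(h * _)%R]mulrC EFinM; apply: lee_wpmul2l; first by rewrite lee_fin powR_ge0.
apply: (@le_trans _ _ (mu (cell h k))).
  have mc := @measurable_cell h k.
  by apply: le_measure; rewrite ?inE //; apply: measurableI.
rewrite mu_itvoo; last by rewrite ler_pM2r // ler_nat.
by rewrite -mulrBl -natrB // subSnn mul1r.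
Qed.

End Lp.

(** * Causality, and the data of a solution on the grid *)

Section cells_solution.
Context {R : realType} {X : completeNormedModType R[i]}.
Local Notation mu := (@lebesgue_measure R).
Implicit Types (f u v : R -> X).

Lemma mRplus : measurable (@Rplus R).
Proof.
by rewrite (_ : @Rplus R = `]0, +oo[%classic) //; apply/seteqP; split => t /=;
  rewrite in_itv /= andbT.
Qed.

Lemma itv_Rplus (a b : R) : 0 <= a -> `]a, b[%classic `<=` (@Rplus R).
Proof. by move=> a0 t /=; rewrite in_itv /= => /andP[+ _]; exact: le_lt_trans. Qed.

Definition primitive (u v : R -> X) : Prop :=
  u 0 = 0 /\ forall t : R, 0 < t -> is_bochner_integral `]0, t[ v (u t).

Lemma primitive_itv u v (a b : R) : primitive u v -> 0 <= a -> a < b ->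
  is_bochner_integral `]a, b[ v (u b - u a).
Proof.
move=> [u0 hu]; rewrite le_eqVlt => /predU1P[<- b0|a0 ab]; first by rewrite u0 subr0; exact: hu.
by apply: (bochner_itv_split a0 ab); apply: hu => //; exact: lt_trans ab.
Qed.

Lemma primitive_Holder u v (a b : R) (p be : R) : 1 < p -> primitive u v -> 0 <= a -> a < b ->
  (pnorm p `]a, b[ v <= be%:E)%E ->
  (fine (L1norm `]a, b[ v) / (b - a)) `^ p <= be / (b - a).
Proof.
move=> p1 uv a0 ab hb; have hi := primitive_itv uv a0 ab.
apply: L1norm_Holder => //; first by case: hi.
by apply: (bochner_L1norm_fin _ (mu_itvoo_fin a b) hi).
Qed.

Lemma primitive_dist u v (a b : R) : primitive u v -> 0 <= a -> a <= b ->
  rnorm (u b - u a) <= fine (L1norm `]a, b[ v).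
Proof.
move=> uv a0; rewrite le_eqVlt => /predU1P[->|ab].
  by rewrite subrr rnorm0 fine_ge0 // L1norm_ge0.
have hi := primitive_itv uv a0 ab.
have fin := bochner_L1norm_fin (measurable_itv _) (mu_itvoo_fin a b) hi.
rewrite -lee_fin fineK; last by rewrite ge0_fin_numE // L1norm_ge0.
exact: bochner_bound (mu_itvoo_fin a b) hi.
Qed.

(** By Hölder's inequality the [p]-th power of the increment is at most [B] times the power [p - 1]
    of [t - r]. The witness [d] is chosen so that [B + 1] times its power [p - 1] is the [p]-th
    power of [e]. *)
Lemma primitive_modulus u v (p : R) : 1 < p -> primitive u v ->
  strongly_measurable (@Rplus R) v -> (pnorm p (@Rplus R) v < +oo)%E ->
  forall e : R, 0 < e -> exists2 d : R, 0 < d &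
    forall r t : R, 0 <= r -> r <= t -> t - r < d -> rnorm (u t - u r) <= e.
Proof.
move=> p1 uv sv fv e e0; pose B := fine (pnorm p (@Rplus R) v).
have p0 : 0 < p by exact: lt_trans p1.
have p10 : 0 < p - 1 by rewrite subr_gt0.
have B0 : 0 <= B by rewrite fine_ge0 // pnorm_ge0.
have BE : pnorm p (@Rplus R) v = B%:E by rewrite fineK // ge0_fin_numE // pnorm_ge0.
have eB : 0 < e `^ p / (B + 1) by rewrite divr_gt0 ?powR_gt0 // ltr_wpDl.
exists ((e `^ p / (B + 1)) `^ (p - 1)^-1); first by rewrite powR_gt0.
move=> r t r0; rewrite le_eqVlt => /predU1P[->|rt] trd; first by rewrite subrr rnorm0 ltW.
have tr0 : 0 < t - r by rewrite subr_gt0.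
have h1 : (pnorm p `]r, t[ v <= B%:E)%E.
  by rewrite -BE; apply: pnorm_subset => //; [exact: mRplus|exact: itv_Rplus].
have := primitive_Holder p1 uv r0 rt h1; set c := fine _ => hc.
have c0 : 0 <= c by rewrite fine_ge0 // L1norm_ge0.
apply: (le_trans (primitive_dist uv r0 (ltW rt))); rewrite -/c.
apply: (@powR_le_inv _ p) => //; first exact: ltW.
have -> : c = c / (t - r) * (t - r) by rewrite divfK // gt_eqF.
rewrite powRM ?divr_ge0 ?(ltW tr0) // -[X in _ * X `^ p](divfK (lt0r_neq0 tr0)) //.
rewrite divfK ?lt0r_neq0 //; apply: le_trans (ler_wpM2r (powR_ge0 _ _) hc) _.
rewrite -(powR_pred (ltW tr0) p1) mulrCA mulrC divfK ?gt_eqF //.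
have h2 : (t - r) `^ (p - 1) <= e `^ p / (B + 1).
  apply: le_trans (powR_mono (ltW p10) (ltW tr0) (ltW trd)) _.
  by rewrite -powRrM mulVf ?gt_eqF // powRr1 // ltW.
apply: (le_trans (ler_wpM2l B0 h2)); rewrite mulrA ler_pdivrMr ?ltr_wpDl // mulrC.
by rewrite ler_pM2l ?powR_gt0 // lerDl.
Qed.

Context (T : R -> X -> X) (A : operator X) (p C : R).
Hypothesis sgT : C0_semigroup T.
Hypothesis genA : forall x y : X, (dom A x /\ A x = y) <->
  (h^-1)%:C *: (T h x - x) @[h --> (0 : R)^'+] --> y.
Hypothesis p1 : 1 < p.
Hypothesis C0 : 0 <= C.
Hypothesis regA : forall f : R -> X, in_Lp p (@Rplus R) f ->
  exists u u' Au : R -> X,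
    [/\ cauchy_solution A f u u' Au, in_Lp p (@Rplus R) u', in_Lp p (@Rplus R) Au &
        (Lpnorm p (@Rplus R) u' + Lpnorm p (@Rplus R) Au <= C%:E * Lpnorm p (@Rplus R) f)%E].

Lemma cauchy_primitive f u u' Au : cauchy_solution A f u u' Au -> primitive u u'.
Proof. by case=> u0 hu _; split => // t /hu. Qed.

(** [regA] provides solutions for different forces without relating them; uniqueness for their
    difference does. This makes the state on the grid a function of the past Bernoulli trials. *)
Lemma cauchy_causal f1 f2 u1 u1' Au1 u2 u2' Au2 (t0 : R) : 0 < t0 ->
  cauchy_solution A f1 u1 u1' Au1 -> in_Lp p (@Rplus R) u1' ->
  cauchy_solution A f2 u2 u2' Au2 -> in_Lp p (@Rplus R) u2' ->
  (forall t, 0 < t -> t < t0 -> f1 t = f2 t) ->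
  forall t, 0 <= t -> t <= t0 -> u1 t = u2 t.
Proof.
move=> t0p s1 [m1 f1'] s2 [m2 f2'] f12 t t_0 tt0.
have p0 : 0 < p by exact: lt_trans p1.
have P1 := cauchy_primitive s1; have P2 := cauchy_primitive s2.
case: s1 s2 => [u10 hu1 ae1] [u20 hu2 ae2].
move: t_0; rewrite le_eqVlt => /predU1P[<-|tp]; first by rewrite u10 u20.
apply/eqP; rewrite -subr_eq0; apply/eqP.
apply: (@cauchy_unique _ _ T A sgT genA t0 (fun t => u1 t - u2 t) (fun t => u1' t - u2' t)) => //.
- by rewrite u10 u20 subr0.
- by move=> s s0 _; apply: bochner_sub => //; [exact: hu1|exact: hu2].
- have ae12 := negligibleU ae1 ae2; apply: negligibleS ae12 => s; apply: contra_notP.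
  move=> /not_orP [/contrapT h1 /contrapT h2] s0 st.
  have [d1 e1 e1'] := h1 s0; have [d2 e2 e2'] := h2 s0.
  have [d e] := genB sgT genA d1 d2; split => //.
  by rewrite e e1 e2 e1' e2' (f12 _ s0 st) opprD addrACA subrr addr0.
- move=> e e0; have e20 : 0 < e / 2 by rewrite divr_gt0.
  have [d1 d10 hd1] := primitive_modulus p1 P1 m1 (Lpnorm_pnorm_fin p0 f1') e20.
  have [d2 d20 hd2] := primitive_modulus p1 P2 m2 (Lpnorm_pnorm_fin p0 f2') e20.
  exists (Num.min d1 d2) => [|r s r0 rs _]; first by rewrite lt_min d10.
  rewrite lt_min => /andP[h1 h2].
  rewrite opprB [u2 r - u1 r]addrC addrACA [- u2 s + u2 r]addrC -(opprB (u2 s)).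
  apply: (le_trans (rnormB _ _)); have := hd1 _ _ r0 rs h1; have := hd2 _ _ r0 rs h2.
  by move: (rnorm _) (rnorm _) => x y; lra.
Qed.

(** The integral [bb] of [u] is in [dom A] by [hille], which the value [u b] need not be. [D], the
    integral of the norm of [u'], bounds [u t - u b] on the interval and hence the error of using
    the final value. *)
Lemma cell_data f u u' Au x (a b : R) : cauchy_solution A f u u' Au ->
  in_Lp p (@Rplus R) u' -> in_Lp p (@Rplus R) Au -> 0 <= a -> a < b ->
  (forall t, a < t -> t < b -> f t = x) ->
  exists (aa bb : X) (D : R), [/\ u b - u a = aa + (b - a)%:C *: x, dom A bb /\ A bb = aa,
    (rnorm aa / (b - a)) `^ p <= fine (pnorm p `]a, b[ Au) / (b - a),
    0 <= D /\ rnorm (bb - (b - a)%:C *: u b) <= (b - a) * D &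
    (D / (b - a)) `^ p <= fine (pnorm p `]a, b[ u') / (b - a)].
Proof.
move=> sol [mu' fu'] [mAu fAu] a0 ab fx; have p0 : 0 < p by exact: lt_trans p1.
have Pu := cauchy_primitive sol; have hi := primitive_itv Pu a0 ab.
have ba : 0 < b - a by rewrite subr_gt0.
have mI : measurable `]a, b[%classic by exact: measurable_itv.
have fI := mu_itvoo_fin a b.
have IR : `]a, b[%classic `<=` (@Rplus R) by exact: itv_Rplus.
have fin v : strongly_measurable (@Rplus R) v -> (Lpnorm p (@Rplus R) v < +oo)%E -> pnorm p `]a,
  b[ v = (fine (pnorm p `]a, b[ v))%:E.
  move=> mv fv; rewrite fineK // ge0_fin_numE ?pnorm_ge0 //.
  apply: le_lt_trans (Lpnorm_pnorm_fin p0 fv); apply: pnorm_subset => //; exact: mRplus.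
have [_ _ ae] := sol.
have hAu : is_bochner_integral `]a, b[ Au (u b - u a - (b - a)%:C *: x).
  have := bochner_sub mI hi (bochner_itv_cst x (ltW ab)).
  apply: bochner_ae => //; first exact: sm_subset mAu.
  apply: (@ae_mono _ _ _ ae) => t ht /= ; rewrite in_itv /= => /andP[at_ tb].
  have [_ _ ->] := ht (le_lt_trans a0 at_); by rewrite (fx _ at_ tb) addrK.
have [bb hbb] : exists bb, is_bochner_integral `]a, b[ u bb.
  apply: bochner_continuous => // e e0;
    have [d d0 hd] := primitive_modulus p1 Pu mu' (Lpnorm_pnorm_fin p0 fu') e0.
  by exists d => // r t ar rt _; apply: hd => //; exact: le_trans ar.
exists (u b - u a - (b - a)%:C *: x), bb, (fine (L1norm `]a, b[ u')); split.
- by rewrite subrK.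
- apply: (hille sgT genA mI fI hbb hAu).
  by apply: (@ae_mono _ _ _ ae) => t ht /IR tp; have [] := ht tp.
- have b1 := bochner_bound mI fI hAu; have fin1 := bochner_L1norm_fin mI fI hAu.
  apply: le_trans (L1norm_Holder p1 ab _ fin1 _).
  + apply: powR_mono; [exact: ltW|by rewrite divr_ge0 ?rnorm_ge0 // ltW|].
    rewrite ler_pM2r ?invr_gt0 // -lee_fin fineK // ge0_fin_numE //; exact: L1norm_ge0.
  + by case: hAu.
  + by rewrite -fin.
- split; first by rewrite fine_ge0 // L1norm_ge0.
  apply: bochner_const_dist hbb _; first exact: ltW.
  move=> t at_ tb; rewrite rdistC;
    apply: (le_trans (primitive_dist Pu (le_trans a0 (ltW at_)) (ltW tb))).
  apply: fine_le.
  + rewrite ge0_fin_numE ?L1norm_ge0 //.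
    exact: (bochner_L1norm_fin (measurable_itv _) (mu_itvoo_fin t b) (primitive_itv Pu (le_trans
      a0 (ltW at_)) tb)).
  + rewrite ge0_fin_numE ?L1norm_ge0 //; exact: (bochner_L1norm_fin mI fI hi).
  + apply: L1norm_subset => //; last by case: hi.
    by move=> s /=; rewrite !in_itv /= => /andP[ts ->]; rewrite (lt_trans at_ ts).
- apply: (primitive_Holder p1 Pu a0 ab); by rewrite -(fin _ mu' fu').
Qed.

(* For the solution [u] with force [phi k] on the [k]-th cell: [U k] is [u (k h)], [a k] and
   [b k] are the integrals of [A u] and [u] over the cell, [al k] and [be k] those of the
   [p]-th powers of the norms of [A u] and [u'], and [D k] that of the norm of [u']. *)
Definition grid_data (h : R) (K : nat) (phi : nat -> X) (U a b : nat -> X) (al be D : nat ->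
  R) : Prop :=
  U 0%N = 0 /\ (forall k, (k < K)%N ->
   [/\ U k.+1 - U k = a k + h%:C *: phi k, dom A (b k) /\ A (b k) = a k,
    (rnorm (a k) / h) `^ p <= al k / h,
    0 <= D k /\ rnorm (b k - h%:C *: U k.+1) <= h * D k &
    [/\ (D k / h) `^ p <= be k / h, 0 <= al k & 0 <= be k]]) /\
  \sum_(0 <= k < K) al k <= C `^ p * \sum_(0 <= k < K) h * rnorm (phi k) `^ p /\
  \sum_(0 <= k < K) be k <= C `^ p * \sum_(0 <= k < K) h * rnorm (phi k) `^ p.

(** [F] chooses one solution for every sequence of forces; the component in the last clause is [U],
    and [cauchy_causal] shows that its value at the end of cell [k] is determined by the forces up
    to that cell. *)
Lemma grid_solution (h : R) (K : nat) : 0 < h ->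
  exists F : (nat -> X) -> (nat -> X) * (nat -> X) * (nat -> X) * (nat -> R) * (nat ->
    R) * (nat -> R),
  (forall phi, let: (U, a, b, al, be, D) := F phi in grid_data h K phi U a b al be D) /\
  (forall phi phi' k, (k < K)%N -> (forall j, (j <= k)%N -> phi j = phi' j) ->
     (F phi).1.1.1.1.1 k.+1 = (F phi').1.1.1.1.1 k.+1).
Proof.
move=> h0; have p0 : 0 < p by exact: lt_trans p1.
have inLp (phi : nat -> X) : in_Lp p (@Rplus R) (cells h K phi).
  split; first exact: sm_cells.
  by apply: pnorm_Lpnorm_fin => //; apply: le_lt_trans (pnorm_cells_eq _ _ h0 p0) _; rewrite ltry.
have : forall phi, exists s : (R -> X) * (R -> X) * (R -> X),
  [/\ cauchy_solution A (cells h K phi) s.1.1 s.1.2 s.2, in_Lp p (@Rplus R) s.1.2,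
  in_Lp p (@Rplus R) s.2 &
   (Lpnorm p (@Rplus R) s.1.2 + Lpnorm p (@Rplus R) s.2 <= C%:E * Lpnorm p (@Rplus R) (cells h K
     phi))%E].
  by move=> phi; have [u [u' [Au hs]]] := regA (inLp phi); exists (u, u', Au).
move=> /choice [s hs].
have kh (k : nat) : 0 <= k%:R * h by rewrite mulr_ge0 // ltW.
have kk (k : nat) : k%:R * h < k.+1%:R * h by rewrite ltr_pM2r // ltr_nat.
have dk (k : nat) : k.+1%:R * h - k%:R * h = h by rewrite -mulrBl -natrB // subSnn mul1r.
have : forall phi k, exists d : X * X * R, (k < K)%N ->
  [/\ (s phi).1.1 (k.+1%:R * h) - (s phi).1.1 (k%:R * h) = d.1.1 + h%:C *: phi k,
      dom A d.1.2 /\ A d.1.2 = d.1.1,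
    (rnorm d.1.1 / h) `^ p <= fine (pnorm p (cell h k) (s phi).2) / h,
    0 <= d.2 /\ rnorm (d.1.2 - h%:C *: (s phi).1.1 (k.+1%:R * h)) <= h * d.2 &
    (d.2 / h) `^ p <= fine (pnorm p (cell h k) (s phi).1.2) / h].
  move=> phi k; have [kK|] := ltnP k K; last by exists (0, 0, 0).
  have [h1 h2 h3 _] := hs phi.
  have := cell_data (x := phi k) h1 h2 h3 (kh k) (kk k).
  rewrite dk => /(_ _)[t ? ?|aa [bb [D hd]]]; last by exists (aa, bb, D).
  exact: (cellsE phi (k := Ordinal kK)).
move=> hd; have {hd}/choice [d hd] : forall phi, exists dd : nat -> X * X * R, forall k,
  (k < K)%N ->
  [/\ (s phi).1.1 (k.+1%:R * h) - (s phi).1.1 (k%:R * h) = (dd k).1.1 + h%:C *: phi k,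
      dom A (dd k).1.2 /\ A (dd k).1.2 = (dd k).1.1,
    (rnorm (dd k).1.1 / h) `^ p <= fine (pnorm p (cell h k) (s phi).2) / h,
    0 <= (dd k).2 /\ rnorm ((dd k).1.2 - h%:C *: (s phi).1.1 (k.+1%:R * h)) <= h * (dd k).2 &
    ((dd k).2 / h) `^ p <= fine (pnorm p (cell h k) (s phi).1.2) / h].
  by move=> phi; have /choice [dd hdd] := hd phi; exists dd.
have sumE (phi : nat -> X) (v : R -> X) : in_Lp p (@Rplus R) v ->
  (Lpnorm p (@Rplus R) v <= C%:E * Lpnorm p (@Rplus R) (cells h K phi))%E ->
  \sum_(0 <= k < K) fine (pnorm p (cell h k) v) <= C `^ p * \sum_(0 <= k < K) h * rnorm (phi k)
    `^ p.
  move=> [mv fv] hv; rewrite !big_mkord -lee_fin -sumEFin.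
  have -> : (\sum_(k < K) (fine (pnorm p (cell h k) v))%:E = \sum_(k < K) pnorm p (cell h k) v)%E.
    apply: eq_bigr => k _; rewrite fineK // ge0_fin_numE ?pnorm_ge0 //.
    apply: le_lt_trans (Lpnorm_pnorm_fin p0 fv); apply: pnorm_subset => //.
    - exact: mRplus.
    - exact: measurable_cell.
    - exact: itv_Rplus.
  apply: (le_trans (pnorm_cells p K h0 mv)); apply: (le_trans (Lpnorm_le_pnorm p0 C0 hv)).
  rewrite EFinM; apply: lee_wpmul2l; first by rewrite lee_fin powR_ge0.
  exact: pnorm_cells_eq.
exists (fun phi => ((fun k : nat => (s phi).1.1 (k%:R * h)), (fun k => (d phi k).1.1), (fun k =>
  (d phi k).1.2),
  (fun k => fine (pnorm p (cell h k) (s phi).2)), (fun k =>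
    fine (pnorm p (cell h k) (s phi).1.2)), (fun k => (d phi k).2))).
split=> [phi|phi phi' k kK hk /=].
  have [h1 h2 h3 h4] := hs phi; split; first by rewrite mul0r; case: h1.
  split; last split.
  - move=> k kK; have [e1 e2 e3 e4 e5] := hd phi k kK; split => //; split => //;
    apply: fine_ge0; exact: pnorm_ge0.
  - apply: sumE => //; apply: le_trans h4; by rewrite leeDr // Lpnorm_ge0.
  - apply: sumE => //; apply: le_trans h4; by rewrite leeDl // Lpnorm_ge0.
have [h1 h2 _ _] := hs phi; have [h1' h2' _ _] := hs phi'.
apply: (cauchy_causal (t0 := k.+1%:R * h) _ h1 h2 h1' h2') => //.
  by rewrite mulr_gt0.
move=> t t0 tk; rewrite /cells; apply: eq_bigr => j _.
have [jk|kj] := leqP j k; first by rewrite hk.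
rewrite indicE memNset ?scale0r // => /cellP[jt _].
have := lt_trans jt tk; rewrite ltr_pM2r // ltr_nat => /ltnSE; by rewrite leqNgt kj.
Qed.

End cells_solution.

(** * Bernoulli paths *)

Section paths.

(** Words grow at their end, so that [take k] is the history of the first [k] trials and a sum over
    words of length [K.+1] splits by the last trial. *)
Fixpoint paths (K : nat) : seq (seq bool) :=
  if K is K'.+1 then [seq rcons s b | s <- paths K', b <- [:: false; true]] else [:: [::]].

Lemma size_paths K w : w \in paths K -> size w = K.
Proof.
elim: K w => [|K IH] w /=; first by rewrite inE => /eqP ->.
by move=> /flattenP [l /mapP [s /IH sK ->]]; rewrite !inE => /orP[]/eqP ->; rewrite size_rcons sK.
Qed.

Lemma sum_paths (V : nmodType) K (F : seq bool -> V) :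
  \sum_(w <- paths K.+1) F w = \sum_(s <- paths K) (F (rcons s false) + F (rcons s true)).
Proof.
by rewrite /= big_flatten big_map; apply: eq_bigr => s _; rewrite big_cons big_seq1.
Qed.

Definition arrivals (w : seq bool) (k : nat) : nat := count id (take k w).

Lemma count_rcons_id s b : count id (rcons s b) = (count id s + b)%N.
Proof. by rewrite -cats1 count_cat /= addn0. Qed.

Context {S : comPzRingType} (q : S).

(** Taken over a ring because it is used both in [R], as a probability, and in [R[i]], as a scalar
    acting on [X]. *)
Definition weight (w : seq bool) : S := q ^+ count id w * (1 - q) ^+ count negb w.

Lemma weight_rcons s b : weight (rcons s b) = weight s * (if b then q else 1 - q).
Proof.
rewrite /weight -cats1 !count_cat /= !addn0 !exprD; case: b => /=.
  by rewrite expr0 mulr1 expr1 mulrAC.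
by rewrite expr0 mulr1 expr1 mulrA.
Qed.

Context {V : lmodType S}.

Lemma sum_paths_weight K (F : seq bool -> V) :
  \sum_(w <- paths K.+1) weight w *: F w =
  \sum_(s <- paths K) weight s *: ((1 - q) *: F (rcons s false) + q *: F (rcons s true)).
Proof.
by rewrite sum_paths; apply: eq_bigr => s _; rewrite !weight_rcons scalerDr !scalerA.
Qed.

(** Each trial after the first [k] contributes the factor [(1 - q) + q = 1]. *)
Lemma sum_paths_take k K (H : seq bool -> V) : (k <= K)%N ->
  \sum_(w <- paths K) weight w *: H (take k w) = \sum_(s <- paths k) weight s *: H s.
Proof.
elim: K => [|K IH]; first by rewrite leqn0 => /eqP ->; rewrite /= !big_seq1.
rewrite leq_eqVlt => /predU1P[->|kK].
  by apply: eq_big_seq => w /size_paths wK; rewrite -wK take_size.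
rewrite -IH // sum_paths_weight; apply: eq_big_seq => s /size_paths sK.
rewrite -!cats1 !take_cat sK; case: ltnP => [_|Kk].
  by rewrite -scalerDl subrK scale1r.
have -> : k = K by apply/eqP; rewrite eqn_leq Kk andbT.
by rewrite subnn !cats0 take_oversize ?sK // -scalerDl subrK scale1r.
Qed.

End paths.

Lemma weight_rmorph (S S' : comPzRingType) (m : {rmorphism S -> S'}) (q : S) w :
  weight (m q) w = m (weight q w).
Proof. by rewrite /weight rmorphM !rmorphXn rmorphB rmorph1. Qed.

Section bernoulli.
Context {R : realType} (q : R).
Hypothesis q01 : 0 < q < 1.

Lemma weight_ge0 w : 0 <= weight q w.
Proof. by case/andP: q01 => q0 q1; rewrite mulr_ge0 // exprn_ge0 ?subr_ge0 // ltW. Qed.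

(* Expectation over the Bernoulli paths of length [K]. *)
Definition ER K (G : seq bool -> R) : R := \sum_(w <- paths K) weight q w * G w.

Lemma ER_take k K G : (k <= K)%N -> ER K (fun w => G (take k w)) = ER k G.
Proof. exact: (sum_paths_take q (V := R^o)). Qed.

Lemma ER_S K G : ER K.+1 G = ER K (fun s => (1 - q) * G (rcons s false) + q * G (rcons s true)).
Proof. exact: (sum_paths_weight q (V := R^o)). Qed.

Lemma ER_le K G G' : (forall w, size w = K -> G w <= G' w) -> ER K G <= ER K G'.
Proof.
move=> GG; rewrite /ER [leLHS]big_seq [leRHS]big_seq; apply: ler_sum => w /size_paths wK.
by rewrite ler_wpM2l ?weight_ge0 // GG.
Qed.

Lemma ER_eq K G G' : (forall w, size w = K -> G w = G' w) -> ER K G = ER K G'.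
Proof. by move=> GG; apply: eq_big_seq => w /size_paths /GG ->. Qed.

Lemma ER_Z K c G : ER K (fun w => c * G w) = c * ER K G.
Proof. by rewrite /ER mulr_sumr; apply: eq_bigr => w _; rewrite mulrCA. Qed.

Lemma ER_D K G G' : ER K (fun w => G w + G' w) = ER K G + ER K G'.
Proof. by rewrite /ER -big_split; apply: eq_bigr => w _; rewrite mulrDr. Qed.

Lemma ER_sum K (I : Type) (r : seq I) (G : I -> seq bool -> R) :
  ER K (fun w => \sum_(i <- r) G i w) = \sum_(i <- r) ER K (G i).
Proof.
rewrite /ER exchange_big /=; apply: eq_bigr => w _; by rewrite mulr_sumr.
Qed.

Lemma ER_cst K c : ER K (fun=> c) = c.
Proof.
elim: K => [|K IH]; first by rewrite /ER big_seq1 /weight !expr0 !mul1r.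
by rewrite ER_S -mulrDl subrK mul1r IH.
Qed.

Lemma ER_ge0 K G : (forall w, size w = K -> 0 <= G w) -> 0 <= ER K G.
Proof. by move=> G0; rewrite -(ER_cst K 0); exact: ER_le. Qed.

(* Markov's inequality for [2^-count]. *)
Lemma tail_bound K n : ER K (fun w => (count id w <= n)%:R) <= 2 ^+ n * (1 - q / 2) ^+ K.
Proof.
have E : ER K (fun w => 2^-1 ^+ count id w) = (1 - q / 2) ^+ K.
  elim: K => [|K IH]; first by rewrite /ER big_seq1 /weight !expr0 !mul1r.
  rewrite ER_S exprS -IH -ER_Z; apply: ER_eq => w _.
  by rewrite !count_rcons_id addn0 addn1 exprS; field.
rewrite -E -ER_Z; apply: ER_le => w _; case: leqP => [wn|_].
  by rewrite exprVn ler_pdivlMr ?exprn_gt0 // mul1r ler_eXn2l // ltr1n.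
by rewrite mulr_ge0 // exprn_ge0 // invr_ge0.
Qed.

(** The event of at most [n] arrivals is left only by an arrival when exactly [n] have occurred, so
    each step lowers its probability by [q] times that of exactly [n]; the sum telescopes. It
    measures both the time spent under the force [f n.+1] and the mass in Jensen's inequality. *)
Lemma occupation K n :
  ER K (fun w => \sum_(0 <= k < K) q * (arrivals w k == n)%:R) = 1 - ER K (fun w =>
    (count id w <= n)%:R).
Proof.
rewrite ER_sum.
have E k : (k <= K)%N -> \sum_(0 <= j < k) ER K (fun w =>
  q * (arrivals w j == n)%:R) = 1 - ER k (fun w => (count id w <= n)%:R); last exact: E.
elim: k => [_|k IH kK]; first by rewrite big_nil /ER big_seq1 /weight !expr0 !mul1r subrr.
rewrite big_nat_recr //= IH ?(ltnW kK) // ER_Z.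
rewrite (ER_take (fun s => (count id s == n)%:R) (ltnW kK)) ER_S.
have -> : ER k (fun s => (1 - q) * (count id (rcons s false) <= n)%:R + q * (count id (rcons s
  true) <= n)%:R) =
   ER k (fun s => (count id s <= n)%:R) - q * ER k (fun s => (count id s == n)%:R).
  rewrite -mulNr -ER_Z -ER_D; apply: ER_eq => s _.
  rewrite !count_rcons_id addn0 addn1; case: (ltngtP (count id s) n) => _ /=; ring.
ring.
Qed.

(** The pairs of a path and a step, weighted by the probability of the path times [q] where [n]
    arrivals occurred, have total mass at most 1 by [occupation]. *)
Lemma jensen_paths K n (c : seq bool -> nat -> R) (p : R) : 1 < p -> (forall w k, 0 <= c w k) ->
  ER K (fun w => \sum_(0 <= k < K) q * (arrivals w k == n)%:R * c w k) `^ p <=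
  ER K (fun w => \sum_(0 <= k < K) q * (arrivals w k == n)%:R * c w k `^ p).
Proof.
move=> p1 c0; have [q0 q1] := andP q01.
pose l := [seq (w, k) | w <- paths K, k <- index_iota 0 K].
have E (g : seq bool -> nat -> R) : ER K (fun w => \sum_(0 <= k < K) g w k) =
    \sum_(i <- l) weight q i.1 * g i.1 i.2.
  by rewrite /l big_allpairs /ER; apply: eq_bigr => w _; rewrite mulr_sumr.
rewrite !E.
under eq_bigr do rewrite mulrA; under [leRHS]eq_bigr do rewrite mulrA.
apply: (jensen_sum (w := fun i =>
  weight q i.1 * (q * (arrivals i.1 i.2 == n)%:R)) (c := fun i => c i.1 i.2)) => //.
- by move=> i; apply: mulr_ge0; [exact: weight_ge0|apply: mulr_ge0 => //; exact: ltW].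
- rewrite -(E (fun w k => q * (arrivals w k == n)%:R)) occupation gerBl.
  by apply: ER_ge0 => w _; case: (_ <= _)%N.
Qed.

End bernoulli.

(** Bernoulli's inequality for the powers of [1 + d = s^-1]. *)
Lemma exprn_lin_bound (R : realType) (s : R) : 0 < s -> s < 1 -> forall K : nat,
  K%:R * s ^+ K <= s / (1 - s).
Proof.
move=> s0 s1 K; pose d := (1 - s) / s.
have d0 : 0 < d by rewrite divr_gt0 // subr_gt0.
have B (n : nat) : 1 + n%:R * d <= (1 + d) ^+ n.
  elim: n => [|n IH]; first by rewrite mul0r addr0 expr0.
  rewrite exprS; apply: le_trans (ler_wpM2l _ IH); last by rewrite addr_ge0 // ltW.
  rewrite -natr1; have : 0 <= d * (n%:R * d) by have d0' := ltW d0; apply: mulr_ge0 => //;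
    exact: mulr_ge0.
  by move: (n%:R) => m; lra.
have ds : 1 + d = s^-1 by rewrite /d mulrBl mul1r divff ?gt_eqF // addrC subrK.
have h : K%:R * d <= s^-1 ^+ K by rewrite -ds; apply: le_trans (B K); rewrite lerDr.
rewrite -invf_div -/d -[leRHS]mul1r ler_pdivlMr // mulrAC -[leRHS](mulVf (x := s ^+ K))
  ?expf_neq0 ?gt_eqF //.
by rewrite ler_pM2r ?exprn_gt0 // -exprVn.
Qed.

(** With [s = 1 - (1 - r) / 3] one has [r <= s ^+ 3]. Two of the three factors [s ^+ K] absorb the
    square of [K] by [exprn_lin_bound], and the third is made small. *)
Lemma geometric_beats_square (R : realType) (r c1 c2 e : R) : 0 < r -> r < 1 -> 0 <= c1 ->
  0 <= c2 -> 0 < e ->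
  exists K : nat, r ^+ K * (c1 * K%:R ^+ 2 + c2) <= e.
Proof.
move=> r0 r1 c10 c20 e0.
pose s := 1 - (1 - r) / 3.
have s0 : 0 < s by rewrite /s; lra.
have s1 : s < 1 by rewrite /s; lra.
have rs : r <= s ^+ 3.
  have -> : s ^+ 3 = 1 - (1 - r) + (1 - r) ^+ 2 / 3 - (1 - r) ^+ 3 / 27 by rewrite /s; field.
  have : 0 <= (1 - r) ^+ 2 * (9 - (1 - r)) by rewrite mulr_ge0 ?sqr_ge0 //; lra.
  by rewrite [in leRHS]exprS; lra.
pose M := (s / (1 - s)); have M0 : 0 <= M by apply: divr_ge0; [exact: ltW|rewrite subr_ge0 ltW].
have hK K := exprn_lin_bound s0 s1 K.
pose c := c1 * M ^+ 2 + c2 + 1;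
  have c0 : 0 < c by rewrite /c ltr_wpDl // addr_ge0 // mulr_ge0 // exprn_ge0.
have [K hs] : exists K : nat, s ^+ K <= e / c.
  have ec : 0 < e / c by rewrite divr_gt0.
  have : s ^+ n @[n --> \oo] --> (0 : R) by apply: cvg_expr; rewrite ger0_norm // ltW.
  move=> /cvgrPdist_le/(_ _ ec)[K _ /(_ K (leqnn K))] /=;
    rewrite sub0r normrN ger0_norm ?exprn_ge0 ?(ltW s0) // => h.
  by exists K.
exists K; have sK0 : 0 <= s ^+ K by rewrite exprn_ge0 // ltW.
have sK1 : s ^+ K <= 1 by rewrite exprn_ile1 // ltW.
have rK : r ^+ K <= s ^+ K * s ^+ K * s ^+ K.
  have -> : s ^+ K * s ^+ K * s ^+ K = (s ^+ 3) ^+ K by rewrite -!exprMn; congr (_ ^+ _); ring.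
  by rewrite lerXn2r // nnegrE ?exprn_ge0 // ltW.
apply: le_trans (ler_wpM2r _ rK) _; first by rewrite addr_ge0 // mulr_ge0 // exprn_ge0.
apply: le_trans (_ : s ^+ K * (c1 * (K%:R * s ^+ K) ^+ 2 + c2) <= _).
  rewrite -!mulrA; apply: ler_wpM2l => //; rewrite !mulrDr; apply: lerD.
    by rewrite [leLHS](_ : _ = c1 * (K%:R * s ^+ K) ^+ 2) //; ring.
  by rewrite mulrA ler_piMl // mulr_ile1.
apply: le_trans (_ : s ^+ K * c <= _); last by rewrite -ler_pdivlMr.
apply: ler_wpM2l => //; rewrite /c; have : c1 * (K%:R * s ^+ K) ^+ 2 <= c1 * M ^+ 2.
  by apply: ler_wpM2l => //; rewrite lerXn2r // ?nnegrE // mulr_ge0.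
lra.
Qed.

(** * Expectations of vectors *)

Section vector_expectation.
Context {R : realType} {X : completeNormedModType R[i]} (q : R).
Hypothesis q01 : 0 < q < 1.

Definition EX K (G : seq bool -> X) : X := \sum_(w <- paths K) (weight q w)%:C *: G w.

Lemma weightC w : weight (q%:C : R[i]) w = (weight q w)%:C.
Proof. exact: (weight_rmorph (real_complex R)). Qed.

Lemma EX_take k K G : (k <= K)%N -> EX K (fun w => G (take k w)) = EX k G.
Proof.
move=> kK; have := sum_paths_take (q%:C : R[i]) G kK.
by under eq_bigr do rewrite weightC; under [RHS]eq_bigr do rewrite weightC.
Qed.

Lemma EX_S K G : EX K.+1 G = EX K (fun s =>
  (1 - q)%:C *: G (rcons s false) + q%:C *: G (rcons s true)).
Proof.
have := sum_paths_weight (q%:C : R[i]) K G.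
under eq_bigr do rewrite weightC; under [RHS]eq_bigr do rewrite weightC.
by rewrite rmorphB.
Qed.

Lemma EX_eq K G G' : (forall w, size w = K -> G w = G' w) -> EX K G = EX K G'.
Proof. by move=> GG; apply: eq_big_seq => w /size_paths /GG ->. Qed.

Lemma EX_Z K (c : R[i]) G : EX K (fun w => c *: G w) = c *: EX K G.
Proof. by rewrite /EX scaler_sumr; apply: eq_bigr => w _; rewrite !scalerA mulrC. Qed.

Lemma EX_D K G G' : EX K (fun w => G w + G' w) = EX K G + EX K G'.
Proof. by rewrite /EX -big_split; apply: eq_bigr => w _; rewrite scalerDr. Qed.

Lemma EX_B K G G' : EX K (fun w => G w - G' w) = EX K G - EX K G'.
Proof.
rewrite -[- EX K G']scaleN1r -EX_Z -EX_D; apply: EX_eq => w _; by rewrite scaleN1r.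
Qed.

Lemma EX_sum K (I : Type) (r : seq I) (G : I -> seq bool -> X) :
  EX K (fun w => \sum_(i <- r) G i w) = \sum_(i <- r) EX K (G i).
Proof. by rewrite /EX exchange_big /=; apply: eq_bigr => w _; rewrite scaler_sumr. Qed.

Lemma rnorm_EX K G : rnorm (EX K G) <= ER q K (fun w => rnorm (G w)).
Proof.
apply: (le_trans (rnorm_sum _ _ _)); apply: ler_sum => w _.
by rewrite rnormZ_ge0 // weight_ge0.
Qed.

Lemma EX_scale K (g : seq bool -> R) (x : X) : EX K (fun w => (g w)%:C *: x) = (ER q K g)%:C *: x.
Proof.
rewrite /EX /ER rmorph_sum scaler_suml; apply: eq_bigr => w _.
by rewrite scalerA -rmorphM.
Qed.

(* An arrival at step [k] is independent of a quantity [G] determined by the first [k] steps. *)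
Lemma EX_arrival K k n (G : seq bool -> X) : (k < K)%N ->
  (forall w w', size w = K -> size w' = K -> take k w = take k w' -> G w = G w') ->
  EX K (fun w => ((arrivals w k.+1 == n)%:R : R)%:C *: G w) =
  (1 - q)%:C *: EX K (fun w => ((arrivals w k == n)%:R : R)%:C *: G w) +
  q%:C *: EX K (fun w => (((arrivals w k).+1 == n)%:R : R)%:C *: G w).
Proof.
(* [G] is controlled on words of length [K] only. Filling up a prefix with [false] to that length
   turns it into a function of the first [k] trials. *)
move=> kK hG; pose g s := G (take k s ++ nseq (K - k) false).
have gE w : size w = K -> G w = g w.
  move=> wK; apply: hG => //.
    by rewrite size_cat size_takel ?wK ?(ltnW kK) // size_nseq subnKC // ltnW.
  by rewrite take_size_cat // size_takel // wK ltnW.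
have g1 w : g w = g (take k w) by rewrite /g take_takel.
have g2 w : g w = g (take k.+1 w) by rewrite /g take_takel // leqnSn.
rewrite (@EX_eq K _ (fun w => ((count id (take k.+1 w) == n)%:R : R)%:C *: g (take k.+1 w)));
  last first.
  by move=> w wK; rewrite gE // g2.
rewrite (EX_take (fun s => ((count id s == n)%:R : R)%:C *: g s)) // EX_S.
rewrite [in RHS](@EX_eq K _ (fun w => ((count id (take k w) == n)%:R : R)%:C *: g (take k w)));
  last first.
  by move=> w wK; rewrite gE // g1.
rewrite (EX_take (fun s => ((count id s == n)%:R : R)%:C *: g s)) ?(ltnW kK) //.
rewrite [X in _ = _ + _ *: X](@EX_eq K _ (fun w =>
  (((count id (take k w)).+1 == n)%:R : R)%:C *: g (take k w))); last first.
  by move=> w wK; rewrite gE // g1.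
rewrite (EX_take (fun s => (((count id s).+1 == n)%:R : R)%:C *: g s)) ?(ltnW kK) //.
rewrite -!EX_Z -EX_D; apply: EX_eq => s sk; rewrite !count_rcons_id addn0 addn1.
have gs b : g (rcons s b) = g s.
  by rewrite /g -cats1 take_size_cat // -{2}sk take_size.
by rewrite !gs.
Qed.

End vector_expectation.

(** * Transference *)

Section transference.
Context {R : realType} {X : completeNormedModType R[i]}.
Context (T : R -> X -> X) (A : operator X) (p C : R).
Hypothesis sgT : C0_semigroup T.
Hypothesis genA : forall x y : X, (dom A x /\ A x = y) <->
  (h^-1)%:C *: (T h x - x) @[h --> (0 : R)^'+] --> y.
Hypothesis p1 : 1 < p.
Hypothesis C0 : 0 <= C.
Hypothesis regA : forall f : R -> X, in_Lp p (@Rplus R) f ->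
  exists u u' Au : R -> X,
    [/\ cauchy_solution A f u u' Au, in_Lp p (@Rplus R) u', in_Lp p (@Rplus R) Au &
        (Lpnorm p (@Rplus R) u' + Lpnorm p (@Rplus R) Au <= C%:E * Lpnorm p (@Rplus R) f)%E].

Section fixed_grid.
Context (tau q : R) (N K : nat) (f : nat -> X).
Hypothesis tau0 : 0 < tau.
Hypothesis q01 : 0 < q < 1.
(** Steps of this length with success probability [q] give waiting times of mean [tau]. *)
Let h := q * tau.
Let q0 : 0 < q. Proof. by case/andP: q01. Qed.
Let h0 : 0 < h. Proof. exact: mulr_gt0. Qed.
Let p0 : 0 < p. Proof. exact: lt_trans p1. Qed.

(** After [n] arrivals the scheme is in its step [n.+1], whence the shift of the index. From the
    [N]-th arrival on there is no force, so later steps add no energy. *)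
Definition force (w : seq bool) (k : nat) : X :=
  if (arrivals w k < N)%N then f (arrivals w k).+1 else 0.

Let chi (w : seq bool) (k n : nat) : R := (arrivals w k == n)%:R.
Let G := \sum_(0 <= n < N) rnorm (f n.+1) `^ p.

Lemma rnorm_force w k : rnorm (force w k) `^ p = \sum_(0 <= n < N) chi w k n * rnorm (f n.+1) `^
  p.
Proof.
rewrite /force /chi big_mkord; case: ltnP => [aN|Na].
  rewrite (bigD1 (Ordinal aN)) //= eqxx mul1r big1 ?addr0 // => j.
  by rewrite -val_eqE /= eq_sym => /negbTE ->; rewrite mul0r.
rewrite rnorm0 powR0 ?gt_eqF // big1 // => j _.
by rewrite gtn_eqF ?mul0r // (leq_trans (ltn_ord j)).
Qed.

(** Maximal regularity is used path by path and then averaged. The term of [f n.+1] is counted with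
    [h] times the expected number of cells preceded by [n] arrivals, at most [tau] by
    [occupation]. *)
Lemma energy_bound (al : seq bool -> nat -> R) :
  (forall w, size w = K -> \sum_(0 <= k < K) al w k <= C `^ p * \sum_(0 <= k < K) h * rnorm
    (force w k) `^ p) ->
  ER q K (fun w => \sum_(0 <= k < K) al w k) / tau <= C `^ p * G.
Proof.
move=> hal; rewrite ler_pdivrMr //; apply: (le_trans (ER_le q01 hal)).
rewrite ER_Z -mulrA ler_wpM2l ?powR_ge0 //.
rewrite (@ER_eq _ _ K _ (fun w =>
  \sum_(0 <= n < N) (tau * rnorm (f n.+1) `^ p) * \sum_(0 <= k < K) q * chi w k n)); last first.
  move=> w _; under eq_bigr do rewrite rnorm_force mulr_sumr.
  rewrite exchange_big /=; apply: eq_bigr => n _; rewrite mulr_sumr; apply: eq_bigr => k _.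
  by rewrite /h; ring.
rewrite ER_sum /G mulr_suml; apply: ler_sum => n _; rewrite ER_Z mulrC [leRHS]mulrC.
rewrite occupation -[leRHS]mul1r ler_wpM2r ?mulr_ge0 ?powR_ge0 ?(ltW tau0) //.
by rewrite gerBl; apply: (ER_ge0 q01) => w _; case: (_ <= _)%N.
Qed.

Lemma G_ge0 : 0 <= G.
Proof. by apply: sumr_ge0 => n _; exact: powR_ge0. Qed.

Lemma CG_root : (C * G `^ p^-1) `^ p = C `^ p * G.
Proof. by rewrite powRM ?powR_ge0 // -powRrM mulVf ?gt_eqF // powRr1 // G_ge0. Qed.

Lemma rnorm_force_le w k : rnorm (force w k) <= G `^ p^-1.
Proof.
apply: (@powR_le_inv _ p) => //; [exact: rnorm_ge0|exact: powR_ge0|].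
rewrite -powRrM mulVf ?gt_eqF // powRr1 ?G_ge0 // rnorm_force /G; apply: ler_sum => n _.
by rewrite ler_piMl ?powR_ge0 // /chi; case: (_ == _).
Qed.

(** As [tau^-1 = q / h], the left side is a mean of the cell averages [c w k / h] with the weights
    of [jensen_paths]. *)
Lemma average_bound (c al : seq bool -> nat -> R) n :
  (forall w k, 0 <= c w k) ->
  (forall w k, size w = K -> (k < K)%N -> (c w k / h) `^ p <= al w k / h) ->
  (tau^-1 * ER q K (fun w => \sum_(0 <= k < K) chi w k n * c w k)) `^ p <=
  ER q K (fun w => \sum_(0 <= k < K) chi w k n * al w k) / tau.
Proof.
move=> c0 hc.
have E (d : seq bool -> nat -> R) : tau^-1 * ER q K (fun w =>
  \sum_(0 <= k < K) chi w k n * d w k) =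
    ER q K (fun w => \sum_(0 <= k < K) q * chi w k n * (d w k / h)).
  rewrite -ER_Z; apply: ER_eq => w _; rewrite mulr_sumr; apply: eq_bigr => k _.
  by rewrite /h; field; rewrite !gt_eqF.
rewrite [leRHS]mulrC !E; apply: le_trans (jensen_paths q01 K n (c := fun w k =>
  c w k / h) p1 _) _.
  by move=> w k; rewrite divr_ge0 // ltW.
apply: (ER_le q01) => w wK; rewrite [leLHS]big_nat [leRHS]big_nat;
  apply: ler_sum => k /andP[_ kK].
by apply: ler_wpM2l; [rewrite mulr_ge0 // ltW|exact: hc].
Qed.

(* [x n.+1] is the expected integral of [u] over the cells before which exactly [n] arrivals
   occurred, divided by [tau]. Summing by parts in [k], it solves the scheme up to the
   effect of stopping after [K] cells and of replacing [u] on a cell by its final value. *)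
Lemma grid_scheme : exists x : nat -> X, [/\ x 0%N = 0,
  forall n, (n < N)%N -> dom A (x n.+1) /\
     rnorm (diff_quot tau x n.+1 - A (x n.+1) - f n.+1) <=
       2 * q * C * G `^ p^-1 + 2 ^+ N * (1 - q / 2) ^+ K * (K%:R ^+ 2 * (C + 1) * q + 1) * G `^
         p^-1 &
  \sum_(0 <= n < N) rnorm (A (x n.+1)) `^ p <= C `^ p * G].
Proof.
have [F [hF cF]] := grid_solution sgT genA p1 C0 regA K h0.
pose U w := (F (force w)).1.1.1.1.1; pose a w := (F (force w)).1.1.1.1.2.
pose b w := (F (force w)).1.1.1.2; pose al w := (F (force w)).1.1.2.
pose be w := (F (force w)).1.2; pose D w := (F (force w)).2.
have data w : grid_data A p C h K (force w) (U w) (a w) (b w) (al w) (be w) (D w).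
  have := hF (force w); rewrite /U /a /b /al /be /D.
  by case: (F (force w)) => [[[[[? ?] ?] ?] ?] ?].
have causal w w' k : (k < K)%N -> take k w = take k w' -> U w k.+1 = U w' k.+1.
  move=> kK tw; apply: cF => // j jk; rewrite /force /arrivals.
  by rewrite -(take_takel w jk) -(take_takel w' jk) tw.
clear hF cF.
(* Index [n] restricts to the cells preceded by exactly [n] arrivals. [Xa] and [Xb] collect the
   integrals of [A u] and [u] over them, and [Y] the final values of [u]; [Z k n] is the state after
   [k] cells. *)
pose Xa n := EX q K (fun w => \sum_(0 <= k < K) (chi w k n)%:C *: a w k).
pose Xb n := EX q K (fun w => \sum_(0 <= k < K) (chi w k n)%:C *: b w k).
pose Y n := EX q K (fun w => \sum_(0 <= k < K) (chi w k n)%:C *: U w k.+1).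
pose Z k n := EX q K (fun w => (chi w k n)%:C *: U w k).
have A_Xb n : dom A (Xb n) /\ A (Xb n) = Xa n.
  have dk w : dom A (\sum_(0 <= k < K) (chi w k n)%:C *: b w k) /\
      A (\sum_(0 <= k < K) (chi w k n)%:C *: b w k) = \sum_(0 <= k < K) (chi w k n)%:C *: a w k.
    rewrite !big_mkord; have [k|d e] := gen_sum sgT genA (index_enum 'I_K) (P := predT) (F :=
      fun k : 'I_K => (chi w k n)%:C *: b w k).
      move=> _; have [_ [hk _]] := data w; have [_ [db _] _ _ _] := hk k (ltn_ord k).
      exact: (genZ sgT genA _ db).1.
    split => //; rewrite e; apply: eq_bigr => k _.
    have [_ [hk _]] := data w; have [_ [db eb] _ _ _] := hk k (ltn_ord k).
    by rewrite (genZ sgT genA _ db).2 eb.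
  rewrite /Xb /EX; have [w _|d e] := gen_sum sgT genA (paths K) (P := predT) (F := fun w =>
    (weight q w)%:C *: (\sum_(0 <= k < K) (chi w k n)%:C *: b w k)).
    exact: (genZ sgT genA _ (dk w).1).1.
  split => //; rewrite e; apply: eq_bigr => w _.
  by rewrite (genZ sgT genA _ (dk w).1).2 (dk w).2.
pose x n := if n is m.+1 then (tau^-1)%:C *: Xb m else 0.
have A_x n : dom A (x n.+1) /\ A (x n.+1) = (tau^-1)%:C *: Xa n.
  by have [d e] := genZ sgT genA (tau^-1)%:C (A_Xb n).1; rewrite e (A_Xb n).2.
pose Yp n := if n is m.+1 then Y m else 0.
(* Summation by parts in [k]: [s1] is the evolution over cell [k], and [s2] the independence of the
   trial that follows it. The boundary term at 0 vanishes since [u 0 = 0]; the one at [K] is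
   [Z K n]. *)
have abel n : (n < N)%N -> q%:C *: (Y n - Yp n) + Z K n =
    Xa n + (h / q * (1 - ER q K (fun w => (count id w <= n)%:R)))%:C *: f n.+1.
  move=> nN.
  have s1 k : (k < K)%N -> EX q K (fun w => (chi w k n)%:C *: U w k.+1) - Z k n =
      EX q K (fun w => (chi w k n)%:C *: a w k) + (h * ER q K (fun w => chi w k n))%:C *: f n.+1.
    move=> kK.
    have -> : (h * ER q K (fun w => chi w k n))%:C *: f n.+1 = EX q K (fun w =>
      h%:C *: ((chi w k n)%:C *: f n.+1)).
      by rewrite EX_Z EX_scale scalerA -rmorphM.
    rewrite -EX_B -EX_D; apply: EX_eq => w wK.
    have [_ [hk _]] := data w; have [e _ _ _ _] := hk k kK.
    rewrite -scalerBr e scalerDr; congr (_ + _); rewrite /force /chi.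
    case: eqP => [->|_]; last by rewrite !scale0r scaler0.
    by rewrite nN !scale1r.
  have s2 k : (k < K)%N -> Z k.+1 n = (1 - q)%:C *: EX q K (fun w => (chi w k n)%:C *: U w k.+1) +
      q%:C *: EX q K (fun w => (((arrivals w k).+1 == n)%:R : R)%:C *: U w k.+1).
    move=> kK; apply: (@EX_arrival _ _ _ K k n (fun w => U w k.+1) kK) => w w' _ _; exact: causal.
  have YE : Y n = \sum_(0 <= k < K) EX q K (fun w =>
    (chi w k n)%:C *: U w k.+1) by rewrite /Y EX_sum.
  have YpE : Yp n = \sum_(0 <= k < K) EX q K (fun w =>
    (((arrivals w k).+1 == n)%:R : R)%:C *: U w k.+1).
    case: n {nN s1 s2 YE} => [|m] /=; last by rewrite /Y EX_sum.
    rewrite big1 // => k _; rewrite /EX big1 // => w _; by rewrite scale0r scaler0.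
  have Z0 : Z 0%N n = 0.
    by rewrite /Z /EX big1 // => w _; have [-> _] := data w; rewrite !scaler0.
  have telZ : \sum_(0 <= k < K) Z k.+1 n - \sum_(0 <= k < K) Z k n = Z K n.
    by rewrite -sumrB telescope_sumr // Z0 subr0.
  have S1 : Y n - \sum_(0 <= k < K) Z k n = Xa n + (h / q * (1 - ER q K (fun w =>
    (count id w <= n)%:R)))%:C *: f n.+1.
    rewrite YE -sumrB (eq_big_nat _ _ (F2 := fun k => EX q K (fun w =>
      (chi w k n)%:C *: a w k) + (h * ER q K (fun w => chi w k n))%:C *: f n.+1));
      last by move=> k /andP[_]; exact: s1.
    rewrite big_split /= /Xa EX_sum; congr (_ + _).
    rewrite -scaler_suml -rmorph_sum -occupation ER_sum; congr (_%:C *: _).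
    rewrite mulr_sumr; apply: eq_bigr => k _; rewrite ER_Z mulrA divfK ?gt_eqF //.
  have S2 : \sum_(0 <= k < K) Z k.+1 n = (1 - q)%:C *: Y n + q%:C *: Yp n.
    rewrite YE YpE !scaler_sumr -big_split; apply: eq_big_nat => k /andP[_]; exact: s2.
  rewrite -S1 -telZ S2 rmorphB scalerBl rmorph1 scale1r scalerBr.
  rewrite addrA; congr (_ - _); rewrite addrAC [_ - _ + _]addrC addrA -addrA.
  set c := q%:C *: Y n; set d := q%:C *: Yp n; change (c + d + (Y n - c - d) = Y n).
  by rewrite -[Y n - c - d]addrA -opprD [LHS]addrC subrK.
(* The quadrature error: the integral of [u] over each cell against [h] times its final value. *)
pose delta n := (tau^-1)%:C *: (Xb n - h%:C *: Y n).
pose deltap n := if n is m.+1 then delta m else 0.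
pose tl n := ER q K (fun w => (count id w <= n)%:R).
have htau : h / tau = q by rewrite /h mulfK ?gt_eqF.
have xS n : x n.+1 = delta n + q%:C *: Y n.
  by rewrite /delta scalerBr scalerA -rmorphM mulrC htau subrK.
have xp n : x n = deltap n + q%:C *: Yp n.
  by case: n => [|n] /=; [rewrite scaler0 addr0|exact: xS].
(* The residual has three sources: quadrature, the state left after the last cell, and the force
   missing on paths with at most [n] arrivals, whose probability is [tl n]. *)
have err n : (n < N)%N -> diff_quot tau x n.+1 - A (x n.+1) - f n.+1 =
    (tau^-1)%:C *: (delta n - deltap n) - (tau^-1)%:C *: Z K n - (tl n)%:C *: f n.+1.
  move=> nN; rewrite /diff_quot (A_x n).2 xS xp /=.
  have := abel n nN; rewrite -/(tl n);
    have -> : h / q = tau by rewrite /h mulrAC mulfV ?gt_eqF // mul1r.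
  move=> /eqP; rewrite eq_sym -subr_eq => /eqP e.
  have -> : delta n + q%:C *: Y n - (deltap n + q%:C *: Yp n) =
      delta n - deltap n + (Xa n + (tau * (1 - tl n))%:C *: f n.+1 - Z K n).
    by rewrite opprD addrACA -scalerBr e.
  have sc (y : R[i]) (u1 u2 u3 u4 : X) : y *: (u1 + (u2 + u3 - u4)) = y *: u1 + (y *: u2 + y *:
    u3 - y *: u4).
    by rewrite scalerDr scalerBr scalerDr.
  have e2 : (tau^-1)%:C *: ((tau * (1 - tl n))%:C *: f n.+1) = f n.+1 - (tl n)%:C *: f n.+1.
    by rewrite scalerA -rmorphM mulKf ?gt_eqF // rmorphB rmorph1 scalerBl scale1r.
  rewrite sc e2; apply/eqP; rewrite !subr_eq; apply/eqP.
  by rewrite -!addrA; congr (_ + _); rewrite [RHS]addrC -!addrA [RHS]addrCA [LHS]addrCA;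
    congr (_ + _); exact: addrCA.
have chi_sum w k (al' : R) : 0 <= al' -> \sum_(0 <= n < N) chi w k n * al' <= al'.
  move=> al0; rewrite -mulr_suml ler_piMl // big_mkord /chi.
  have [aN|Na] := ltnP (arrivals w k) N.
    rewrite (bigD1 (Ordinal aN)) //= eqxx big1 ?addr0 // => j.
    by rewrite -val_eqE /= eq_sym => /negbTE ->.
  by rewrite big1 // => j _; rewrite gtn_eqF // (leq_trans (ltn_ord j)).
have chi01 w k n : 0 <= chi w k n <= 1 by rewrite /chi; case: (_ == _); rewrite lexx ler01.
have delta_le n : rnorm (delta n) <= h * (C * G `^ p^-1).
  (* The absolute value only provides a sign for [k >= K], where [data] says nothing about [D]. *)
  pose c w k := `|D w k|.
  have s1 : rnorm (Xb n - h%:C *: Y n) <= h * ER q K (fun w =>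
    \sum_(0 <= k < K) chi w k n * c w k).
    rewrite -EX_Z -EX_B -ER_Z; apply: (le_trans (rnorm_EX q01 _ _)); apply: (ER_le q01) => w wK.
    rewrite scaler_sumr -sumrB; apply: (le_trans (rnorm_sum _ _ _)); rewrite mulr_sumr.
    rewrite [leLHS]big_nat [leRHS]big_nat; apply: ler_sum => k /andP[_ kK].
    have [_ [hk _]] := data w; have [_ _ _ [D0 hD] _] := hk k kK.
    rewrite scalerA [h%:C * _]mulrC -scalerA -scalerBr rnormZ_ge0;
      last by case/andP: (chi01 w k n).
    rewrite mulrCA; apply: ler_wpM2l; first by case/andP: (chi01 w k n).
    by rewrite /c ger0_norm.
  have s2 : tau^-1 * ER q K (fun w => \sum_(0 <= k < K) chi w k n * c w k) <= C * G `^ p^-1.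
    apply: (@powR_le_inv _ p) => //.
    - rewrite mulr_ge0 ?invr_ge0 ?(ltW tau0) //; apply: (ER_ge0 q01) => w _;
      apply: sumr_ge0 => k _.
      by rewrite mulr_ge0 // /c; case/andP: (chi01 w k n).
    - by rewrite mulr_ge0 ?powR_ge0.
    rewrite CG_root; apply: le_trans (average_bound (al := be) n _ _) _.
    - by move=> w k; exact: normr_ge0.
    - move=> w k wK kK; have [_ [hk _]] := data w; have [_ _ _ [D0 _] [hb _ _]] := hk k kK.
      by rewrite /c ger0_norm.
    apply: le_trans (energy_bound (al := be) _); last by move=> w _; have [_ [_ [_ ]]] := data w.
    rewrite ler_pM2r ?invr_gt0 //; apply: (ER_le q01) => w wK.
    rewrite [leLHS]big_nat [leRHS]big_nat; apply: ler_sum => k /andP[_ kK].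
    have [_ [hk _]] := data w; have [_ _ _ _ [_ _ be0]] := hk k kK.
    by rewrite ler_piMl //; case/andP: (chi01 w k n).
  rewrite rnormZ_ge0; last by rewrite invr_ge0 ltW.
  apply: (le_trans (ler_wpM2l _ s1)); first by rewrite invr_ge0 ltW.
  by rewrite mulrCA ler_pM2l.
have G'0 : 0 <= G `^ p^-1 by exact: powR_ge0.
have deltap_le n : rnorm (deltap n) <= h * (C * G `^ p^-1).
  case: n => [|n] /=; last exact: delta_le.
  by rewrite rnorm0 mulr_ge0 ?(ltW h0) // mulr_ge0.
(* A single cell is bounded by the energy of the whole path. This loses powers of [K], which the
   geometric tail absorbs. *)
have a_le w k : (k < K)%N -> size w = K -> rnorm (a w k) <= h * (K%:R * (C * G `^ p^-1)).
  move=> kK wK; have [_ [hk [hal _]]] := data w; have [_ _ ha _ [_ al0 _]] := hk k kK.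
  have K1 : 1 <= (K%:R : R) by rewrite ler1n (leq_ltn_trans _ kK).
  rewrite mulrC -ler_pdivrMr //; apply: (@powR_le_inv _ p) => //.
  - by rewrite divr_ge0 ?rnorm_ge0 // ltW.
  - by rewrite mulr_ge0 // mulr_ge0.
  apply: (le_trans ha); rewrite powRM ?mulr_ge0 // CG_root ler_pdivrMr //.
  have s1 : al w k <= \sum_(0 <= k < K) al w k.
    rewrite big_mkord (bigD1 (Ordinal kK)) //= lerDl; apply: sumr_ge0 => j _.
    by have [_ _ _ _ [_ ? _]] := hk j (ltn_ord j).
  apply: (le_trans s1); apply: (le_trans hal).
  have -> : K%:R `^ p * (C `^ p * G) * h = C `^ p * (K%:R `^ p * (h * G)) by ring.
  apply: ler_wpM2l; first exact: powR_ge0.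
  apply: le_trans (_ : \sum_(0 <= k < K) h * G <= _).
    apply: ler_sum => j _; rewrite ler_pM2l // rnorm_force; apply: ler_sum => n _.
    by rewrite ler_piMl ?powR_ge0 //; case/andP: (chi01 w j n).
  rewrite sumr_const_nat subn0 -[leLHS]mulr_natl; apply: ler_wpM2r;
    first by rewrite mulr_ge0 ?G_ge0 ?(ltW h0).
  by rewrite -[leLHS]powRr1 // ler_powR // ltW.
have U_le w k : size w = K -> (k <= K)%N ->
  rnorm (U w k) <= k%:R * (h * (K%:R * (C * G `^ p^-1) + G `^ p^-1)).
  move=> wK; elim: k => [_|k IH kK].
    by have [-> _] := data w; rewrite rnorm0 mul0r.
  have [_ [hk _]] := data w; have [/eqP e _ _ _ _] := hk k kK.
  rewrite subr_eq in e; rewrite (eqP e) -natr1 mulrDl mul1r addrC.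
  apply: (le_trans (rnormD _ _)); apply: lerD; first exact/IH/ltnW.
  apply: (le_trans (rnormD _ _)); rewrite mulrDr; apply: lerD; first exact: a_le.
  by rewrite rnormZ_ge0 ?(ltW h0) // ler_pM2l // rnorm_force_le.
have tl_le n : (n < N)%N -> tl n <= 2 ^+ N * (1 - q / 2) ^+ K.
  move=> nN; apply: (le_trans (tail_bound q01 K n)); rewrite ler_wpM2r //.
    by rewrite exprn_ge0 //; case/andP: q01 => _ q1; lra.
  by rewrite ler_weXn2l // ?ler1n // ltnW.
pose B := K%:R * (h * (K%:R * (C * G `^ p^-1) + G `^ p^-1)).
have B0 : 0 <= B.
  have h00 := ltW h0; have CG0 := mulr_ge0 C0 G'0.
  by apply: mulr_ge0 => //; apply: mulr_ge0 => //; apply: addr_ge0 => //; exact: mulr_ge0.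
have Z_le n : rnorm (Z K n) <= tl n * B.
  apply: (le_trans (rnorm_EX q01 _ _)); rewrite mulrC -ER_Z; apply: (ER_le q01) => w wK.
  rewrite rnormZ_ge0; last by case/andP: (chi01 w K n).
  rewrite mulrC; apply: ler_pM; [exact: rnorm_ge0|by case/andP: (chi01 w K n)|exact: U_le|].
  rewrite /chi /arrivals take_oversize ?wK //; case: ltngtP => // _; exact: lexx.
exists x; split => // [n nN|].
  split; first exact: (A_x n).1.
  rewrite (err _ nN); have tau'0 : 0 <= tau^-1 by rewrite invr_ge0 ltW.
  have tl0 : 0 <= tl n by apply: (ER_ge0 q01) => w _; case: (_ <= _)%N.
  apply: (le_trans (rnormB _ _)).
  apply: le_trans (lerD (rnormB _ _) (lexx _)) _.
  rewrite !rnormZ_ge0 //.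
  have b1 : tau^-1 * rnorm (delta n - deltap n) <= 2 * q * C * G `^ p^-1.
    apply: le_trans (ler_wpM2l tau'0 (le_trans (rnormB _ _) (lerD (delta_le n) (deltap_le n)))) _.
    by rewrite -htau le_eqVlt; apply/orP; left; apply/eqP; field; rewrite gt_eqF.
  have b2 : tau^-1 * rnorm (Z K n) <= tl n * (K%:R ^+ 2 * (C + 1) * q * G `^ p^-1).
    apply: le_trans (ler_wpM2l tau'0 (Z_le n)) _; rewrite mulrCA; apply: ler_wpM2l => //.
    have -> : tau^-1 * B = (K%:R * (K%:R * C + 1)) * (q * G `^ p^-1).
      by rewrite /B -htau; field; rewrite gt_eqF.
    rewrite -[leRHS]mulrA; apply: ler_wpM2r; first by rewrite mulr_ge0 // ltW.
    have : (K%:R : R) <= K%:R ^+ 2 by rewrite -natrX ler_nat; case: (K) => // k;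
      rewrite expnS leq_pmulr.
    have -> : K%:R * (K%:R * C + 1) = K%:R ^+ 2 * C + K%:R by ring.
    by move=> hK; rewrite [leRHS]mulrDr mulr1 lerD2l.
  have b3 : tl n * rnorm (f n.+1) <= tl n * G `^ p^-1.
    apply: ler_wpM2l => //; apply: (@powR_le_inv _ p) => //; first exact: rnorm_ge0.
    rewrite -powRrM mulVf ?gt_eqF // powRr1 ?G_ge0 // /G big_mkord (bigD1 (Ordinal nN)) //= lerDl.
    by apply: sumr_ge0 => j _; exact: powR_ge0.
  apply: le_trans (lerD (lerD b1 b2) b3) _; rewrite -addrA lerD2l -mulrDr.
  have -> : K%:R ^+ 2 * (C + 1) * q * G `^ p^-1 + G `^ p^-1 = (K%:R ^+ 2 * (C + 1) * q + 1) * G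
    `^ p^-1 by ring.
  rewrite -[leRHS]mulrA; apply: ler_wpM2r (tl_le n nN); apply: mulr_ge0 => //.
  by apply: addr_ge0 => //; apply: mulr_ge0 (ltW q0); apply: mulr_ge0;
    [exact: exprn_ge0|exact: addr_ge0].
(* For each [n], Jensen's inequality bounds [A (x n.+1)] by the energy of the cells preceded by [n]
   arrivals. Along a path a cell belongs to one [n] only, so the sum over [n] is at most the full
   energy. *)
apply: le_trans (energy_bound (al := al) _); last by move=> w _; have [_ [_ [ ]]] := data w.
apply: le_trans (_ : \sum_(0 <= n < N) ER q K (fun w =>
  \sum_(0 <= k < K) chi w k n * al w k) / tau <= _).
  apply: ler_sum => n _; apply: le_trans (average_bound (c := fun w k => rnorm (a w k)) n _ _).
  - rewrite (A_x n).2 rnormZ_ge0 ?invr_ge0 ?(ltW tau0) //; apply: powR_mono.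
    + exact: ltW.
    + by rewrite mulr_ge0 ?rnorm_ge0 // invr_ge0 ltW.
    rewrite ler_pM2l ?invr_gt0 //; apply: (le_trans (rnorm_EX q01 _ _));
      apply: (ER_le q01) => w wK.
    apply: (le_trans (rnorm_sum _ _ _)); apply: ler_sum => k _.
    by rewrite rnormZ_ge0 //; case/andP: (chi01 w k n).
  - by move=> w k; exact: rnorm_ge0.
  - by move=> w k wK kK; have [_ [hk _]] := data w; have [_ _ ? _ _] := hk k kK.
rewrite -mulr_suml ler_pM2r ?invr_gt0 // -ER_sum; apply: (ER_le q01) => w wK.
rewrite exchange_big /= [leLHS]big_nat [leRHS]big_nat; apply: ler_sum => k /andP[_ kK].
by apply: chi_sum; have [_ [hk _]] := data w; have [_ _ _ _ [_ ? _]] := hk k kK.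
Qed.

End fixed_grid.

End transference.

(** * The resolvent and the backward Euler scheme *)

Section resolvent.
Context {R : realType} {X : completeNormedModType R[i]}.
Context (T : R -> X -> X) (A : operator X) (p C : R).
Hypothesis sgT : C0_semigroup T.
Hypothesis genA : forall x y : X, (dom A x /\ A x = y) <->
  (h^-1)%:C *: (T h x - x) @[h --> (0 : R)^'+] --> y.
Hypothesis p1 : 1 < p.
Hypothesis C0 : 0 <= C.
Hypothesis regA : forall f : R -> X, in_Lp p (@Rplus R) f ->
  exists u u' Au : R -> X,
    [/\ cauchy_solution A f u u' Au, in_Lp p (@Rplus R) u', in_Lp p (@Rplus R) Au &
        (Lpnorm p (@Rplus R) u' + Lpnorm p (@Rplus R) Au <= C%:E * Lpnorm p (@Rplus R) f)%E].

Lemma euler_algebra (al be ga a b g : X) :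
  al + (a + g) - ga - (a - b) = al - be - (ga - be - b - g).
Proof.
rewrite !opprB -!addrA; congr (_ + _).
rewrite addrCA [RHS]addrCA; congr (_ + _).
rewrite addrCA [RHS]addrCA addKr [RHS]addrC; congr (_ + _).
by rewrite addrC subrK.
Qed.

(** In [grid_scheme], [q] is chosen first, to make the quadrature error at most [eps / 2]; then [K],
    depending on [q], does the same for the error of stopping. The energy bound contains neither of
    them. *)
Lemma approximate_scheme (tau : R) (N : nat) (f : nat -> X) (eps : R) : 0 < tau -> 0 < eps ->
  exists x : nat -> X, [/\ x 0%N = 0,
  forall n, (n < N)%N -> dom A (x n.+1) /\
     rnorm (diff_quot tau x n.+1 - A (x n.+1) - f n.+1) <= eps &
  \sum_(0 <= n < N) rnorm (A (x n.+1)) `^ p <= C `^ p * \sum_(0 <= n < N) rnorm (f n.+1) `^ p].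
Proof.
move=> tau0 eps0; pose G' := (\sum_(0 <= n < N) rnorm (f n.+1) `^ p) `^ p^-1.
have G'0 : 0 <= G' by exact: powR_ge0.
have CG0 : 0 <= C * G' by exact: mulr_ge0.
pose q := Num.min (2^-1) (eps / (4 * (C * G' + 1))).
have d0 : 0 < 4 * (C * G' + 1) by rewrite mulr_gt0 // ltr_wpDl.
have q0 : 0 < q by rewrite lt_min invr_gt0 ltr0n divr_gt0.
have q2 : q <= 2^-1 by rewrite ge_min lexx.
have q1 : q < 1 by apply: (le_lt_trans q2); rewrite invf_lt1 // ltr1n.
have qe : 2 * q * C * G' <= eps / 2.
  have : q * (4 * (C * G' + 1)) <= eps by rewrite -ler_pdivlMr // ge_min lexx orbT.
  have -> : q * (4 * (C * G' + 1)) = 2 * (2 * q * C * G') + 4 * q by ring.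
  by rewrite ler_pdivlMr //; lra.
have r0 : 0 < 1 - q / 2 by lra.
have r1 : 1 - q / 2 < 1 by lra.
have N0 : 0 <= (2 ^+ N : R) by rewrite exprn_ge0.
have c10 : 0 <= 2 ^+ N * (C + 1) * q * G'.
  by apply: mulr_ge0 => //; apply: mulr_ge0 (ltW q0); apply: mulr_ge0 => //; exact: addr_ge0.
have c20 : 0 <= 2 ^+ N * G' by exact: mulr_ge0.
have e20 : 0 < eps / 2 by rewrite divr_gt0.
have [K hK] := geometric_beats_square r0 r1 c10 c20 e20.
have q01 : 0 < q < 1 by rewrite q0.
have [x [x0 hx sx]] := grid_scheme sgT genA p1 C0 regA N K f tau0 q01.
exists x; split => // n nN; have [dx ex] := hx n nN; split => //.
apply: (le_trans ex); rewrite -/G'.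
have -> : 2 ^+ N * (1 - q / 2) ^+ K * (K%:R ^+ 2 * (C + 1) * q + 1) * G' =
  (1 - q / 2) ^+ K * (2 ^+ N * (C + 1) * q * G' * K%:R ^+ 2 + 2 ^+ N * G') by ring.
by have := lerD qe hK; rewrite -splitr.
Qed.

(** The bound of [gen_diff_bound] passes from [x m - x n] to [l - x n]. Hence the difference
    quotients of [l] and [x n] differ by at most [M * rnorm (y - A (x n))], uniformly in small
    [h]. *)
Lemma gen_closed (x : nat -> X) (l y : X) : (forall n, dom A (x n)) ->
  x @ \oo --> l -> (fun n => A (x n)) @ \oo --> y -> dom A l /\ A l = y.
Proof.
move=> dx xl xy; have [M M1 hM] := gen_diff_bound sgT genA.
have M0 : 0 < M by apply: lt_le_trans M1.
have key h n : 0 < h -> h <= 1 ->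
  rnorm (T h (l - x n) - (l - x n)) <= h * (M * rnorm (y - A (x n))).
  move=> h0 h1; have [lT cT] : linear (T h) /\ continuous (T h) by case: sgT => /(_ h h0).
  have c1 : rnorm (T h (x m - x n) - (x m - x n)) @[m --> \oo] --> rnorm (T h (l - x n) - (l - x
    n)).
    have c0 : (fun m => x m - x n) @ \oo --> l - x n by apply: cvgB => //; exact: cvg_cst.
    by apply: cvg_rnorm; apply: cvgB => //; exact: (cvg_comp _ _ c0 (cT _)).
  have c2 : h * (M * rnorm (A (x m) - A (x n))) @[m --> \oo] --> h * (M * rnorm (y - A (x n))).
    apply: cvgMr; apply: cvgMr; apply: cvg_rnorm; apply: cvgB => //; exact: cvg_cst.
  apply: (ler_cvg_to c1 c2); apply: nearW => m.
  have [d e] := genB sgT genA (dx m) (dx n); by have := hM h _ d h0 h1; rewrite e.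
apply/genA/cvg_right0P => e e0.
have eM : 0 < e / (2 * (M + 1)) by rewrite divr_gt0 // mulr_gt0 // addr_gt0.
have e2 : 0 < e / 2 by rewrite divr_gt0.
have [n hn] : exists n, rnorm (A (x n) - y) < e / (2 * (M + 1)).
  by have /cvg_seqP/(_ _ eM)[n hn] := xy; exists n; exact: hn.
have /genA/cvg_right0P/(_ _ e2)[d d0 hd] : dom A (x n) /\ A (x n) = A (x n) by split.
exists (Num.min d 1) => [|h h0]; first by rewrite lt_min d0 ltr01.
rewrite lt_min => /andP[hd1 h1]; have lT := sg_linear sgT (ltW h0).
have hi : 0 <= h^-1 by rewrite invr_ge0 ltW.
have -> : (h^-1)%:C *: (T h l - l) - y = (h^-1)%:C *: (T h (l - x n) - (l - x n)) +
    ((h^-1)%:C *: (T h (x n) - x n) - A (x n)) + (A (x n) - y).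
  rewrite [RHS]addrA -[_ + _ + A (x n)]addrA subrK -scalerDr; congr (_ *: _ - _).
  by rewrite (linB lT) addrACA -opprD !subrK.
apply: (le_lt_trans (rnormD _ _)); apply: le_lt_trans (lerD (rnormD _ _) (lexx _)) _.
have b1 : rnorm ((h^-1)%:C *: (T h (l - x n) - (l - x n))) <= M * rnorm (A (x n) - y).
  by rewrite rnormZ_ge0 // ler_pdivrMl // [rnorm (A (x n) - y)]rdistC key // ltW.
have b2 := hd h h0 hd1.
have b3 : (M + 1) * rnorm (A (x n) - y) < e / 2.
  by rewrite -ltr_pdivlMl ?addr_gt0 //; apply: lt_le_trans hn _; rewrite invfM mulrA mulrC.
move: b1 b2 b3; rewrite mulrDl mul1r; move: (rnorm _) (rnorm _) (rnorm _) => u v w.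
by rewrite [X in _ -> _ -> _ -> _ < X](splitr e); lra.
Qed.

(** The inequality [1 + y <= expR y], taken at [y] and at [- y]. *)
Lemma expR_quadratic (y : R) : 0 <= y -> y <= 2^-1 -> 0 <= expR y - 1 - y <= 2 * y ^+ 2.
Proof.
move=> y0 y1; apply/andP; split; first by have := expR_ge1Dx y; lra.
have h1 : 0 < 1 - y by lra.
have h : expR y * (1 - y) <= 1.
  rewrite -[leRHS](expRxMexpNx_1 y) ler_pM2l ?expR_gt0 //; exact: (expR_ge1Dx (- y)).
have : expR y <= 1 + y + 2 * y ^+ 2; last by lra.
rewrite -ler_pdivlMr // in h; apply: (le_trans h); rewrite ler_pdivrMr //.
have -> : (1 + y + 2 * y ^+ 2) * (1 - y) = 1 + y ^+ 2 * (1 - 2 * y) by ring.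
by rewrite lerDl mulr_ge0 ?sqr_ge0 //; lra.
Qed.

Lemma geometric_series (v : nat -> X) (c : R) : 0 <= c -> (forall k,
  rnorm (v k) <= c * 2^-1 ^+ k) ->
  exists2 l : X, (fun n => \sum_(0 <= k < n) v k) @ \oo --> l & rnorm l <= 2 * c.
Proof.
move=> c0 hv.
have part n j : rnorm (\sum_(n <= k < n + j) v k) <= 2 * c * 2^-1 ^+ n - 2 * c * 2^-1 ^+ (n + j).
  elim: j => [|j IH]; first by rewrite addn0 big_geq // rnorm0 subrr.
  rewrite addnS big_nat_recr ?leq_addr //=; apply: (le_trans (rnormD _ _)).
  have := hv (n + j)%N; move: IH; rewrite exprS;
    move: (rnorm _) (rnorm _) (2^-1 ^+ (n + j)) => a b d.
  by lra.
have half0 m : 0 <= (2^-1 : R) ^+ m by rewrite exprn_ge0 // invr_ge0.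
have tail n m : (n <= m)%N -> rnorm (\sum_(0 <= k < m) v k - \sum_(0 <= k < n) v k) <= 2 * c *
  2^-1 ^+ n.
  move=> nm; rewrite (big_cat_nat (n := n)) //= addrAC subrr add0r.
  have := part n (m - n)%N; rewrite subnKC // => /le_trans; apply; rewrite gerBl.
  by apply: mulr_ge0 => //; exact: mulr_ge0.
have [l hl] : exists l : X, (fun n => \sum_(0 <= k < n) v k) @ \oo --> l.
  apply: rnorm_cauchy => e e0; pose d := e / (4 * c + 1).
  have c41 : 0 < 4 * c + 1 by lra.
  have d0 : 0 < d by rewrite divr_gt0.
  have : (2^-1 : R) ^+ n @[n --> \oo] --> (0 : R).
    by apply: cvg_expr; rewrite ger0_norm ?invr_ge0 // invf_lt1 // ltr1n.
  move=> /cvgrPdist_lt/(_ _ d0)[n0 _ /(_ n0 (leqnn n0))] /=;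
    rewrite sub0r normrN ger0_norm // => hd.
  exists n0 => n m hn hm; apply: (le_lt_trans (rnorm_triangle (\sum_(0 <= k < n0) v k) _ _)).
  have := tail _ _ hn; have := tail _ _ hm; rewrite [rnorm (\sum_(0 <= k < n0) v k - _)]rdistC.
  have : (4 * c + 1) * 2^-1 ^+ n0 < e by rewrite -ltr_pdivlMl // mulrC.
  move: (half0 n0); move: (rnorm _) (rnorm _) (2^-1 ^+ n0) => a b g; lra.
exists l => //; apply: (cvgr_to_le (cvg_rnorm hl)); apply: nearW => n.
have := tail 0%N n (leq0n _); by rewrite big_nil subr0 expr0 mulr1.
Qed.

(** One step of the scheme with [tau = lam^-1] and [u_0 = 0] is the resolvent equation. A residual
    of half the norm of [g] is enough for iteration. *)
Lemma approximate_resolvent (lam : R) (g : X) : 0 < lam ->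
  exists x : X, [/\ dom A x, rnorm (g - (lam%:C *: x - A x)) <= rnorm g / 2 & rnorm (A x) <= C *
    rnorm g].
Proof.
move=> lam0; have p0 : 0 < p by exact: lt_trans p1.
have [g0|g0] := eqVneq (rnorm g) 0.
  have [d e] := gen0 sgT genA; exists 0;
    rewrite e (rnorm_eq0 g0) scaler0 !subr0 rnorm0 mul0r mulr0.
  by split => //; exact: lexx.
have gp : 0 < rnorm g by rewrite lt_def g0 rnorm_ge0.
have [||x [x0 hx sx]] := @approximate_scheme lam^-1 1 (fun=> g) (rnorm g / 2);
  [by rewrite invr_gt0|by rewrite divr_gt0|].
have [d e] := hx 0%N isT; exists (x 1%N); split => //.
  move: e; rewrite /diff_quot x0 subr0 invrK /= rdistC; congr (rnorm _ <= _).
move: sx; rewrite !big_nat1 -powRM ?rnorm_ge0 // => h.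
by apply: (@powR_le_inv _ p) => //; rewrite ?mulr_ge0 ?rnorm_ge0.
Qed.

(** The residuals [gs n] halve at each correction, so the corrections, seen through [A], have a sum
    bounded by a geometric series; this doubles [C]. The equation then forces the partial sums [S]
    themselves to converge, and [A] is closed. *)
Lemma resolvent_surjective (lam : R) (g : X) : 0 < lam ->
  exists x : X, [/\ dom A x, lam%:C *: x - A x = g & rnorm (A x) <= 2 * C * rnorm g].
Proof.
move=> lam0.
have /choice [F hF] : forall g, exists x : X, [/\ dom A x,
  rnorm (g - (lam%:C *: x - A x)) <= rnorm g / 2 & rnorm (A x) <= C * rnorm g].
  by move=> g'; exact: approximate_resolvent.
pose gs := fix gs n := if n is m.+1 then gs m - (lam%:C *: F (gs m) - A (F (gs m))) else g.
have gs_le n : rnorm (gs n) <= rnorm g * 2^-1 ^+ n.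
  elim: n => [|n IH]; first by rewrite expr0 mulr1.
  have [_ h _] := hF (gs n); apply: (le_trans h); rewrite exprSr mulrA.
  by rewrite ler_pM2r ?invr_gt0.
have [|k|y hy yle] := @geometric_series (fun n => A (F (gs n))) (C * rnorm g).
- by rewrite mulr_ge0 ?rnorm_ge0.
- have [_ _ h] := hF (gs k); apply: (le_trans h); rewrite -mulrA; exact: ler_wpM2l.
pose S n := \sum_(0 <= k < n) F (gs k).
have AS n : dom A (S n) /\ A (S n) = \sum_(0 <= k < n) A (F (gs k)).
  by apply: (gen_sum sgT genA) => k _; have [] := hF (gs k).
have SE n : lam%:C *: S n = g - gs n + \sum_(0 <= k < n) A (F (gs k)).
  apply/eqP; rewrite -subr_eq; apply/eqP; rewrite /S.
  elim: n => [|n IH]; first by rewrite !big_nil scaler0 !subrr.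
  by rewrite !big_nat_recr //= scalerDr opprD addrACA IH opprB [RHS]addrA addrAC.
have gs0 : gs @ \oo --> (0 : X).
  apply/cvg_rnormP; apply: (@cvg_squeeze0 _ _ _ _ _ (fun n => rnorm g * 2^-1 ^+ n)).
    by apply: nearW => n; rewrite subr0 rnorm_ge0 gs_le.
  rewrite -(mulr0 (rnorm g)); apply: cvgMr; apply: cvg_expr.
  by rewrite ger0_norm ?invr_ge0 // invf_lt1 // ltr1n.
pose x := (lam^-1)%:C *: (g + y).
have Sx : S @ \oo --> x.
  have h : (fun n => (lam^-1)%:C *: (g - gs n + \sum_(0 <= k < n) A (F (gs k)))) @ \oo -->
    (lam^-1)%:C *: (g - 0 + y).
    have h0 : (fun n => g - gs n + \sum_(0 <= k < n) A (F (gs k))) @ \oo --> g - 0 + y.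
      by apply: cvgD => //; apply: cvgB => //; exact: cvg_cst.
    exact: (cvg_comp _ _ h0 (@continuous_scale _ _ _ _)).
  rewrite subr0 in h; apply: cvg_trans h; apply: near_eq_cvg; apply: nearW => n /=.
  by rewrite -SE scalerA -rmorphM mulVf ?gt_eqF // scale1r.
have AS' : (fun n => A (S n)) @ \oo --> y.
  by under eq_fun do rewrite (AS _).2.
have [dx ex] := gen_closed (fun n => (AS n).1) Sx AS'.
exists x; rewrite ex; split => //; last by rewrite -mulrA.
by rewrite /x scalerA -rmorphM mulfV ?gt_eqF // scale1r addrK.
Qed.

(** The function [g] vanishes at 0 and has right derivative zero, because [E h] times [x] and
    [T h x] have the same derivative at 0; [g t = 0] is the claim. *)
Lemma eigenvector_orbit (lam : R) x t : 0 < lam -> dom A x -> A x = lam%:C *: x -> 0 <= t ->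
  T t x = (expR (lam * t))%:C *: x.
Proof.
move=> l0 dx ex t0; have [M M1 hM] := sg_bounded sgT t; have M0 : 0 < M by apply: lt_le_trans M1.
pose E s := expR (lam * s).
have E0 s : 0 < E s by exact: expR_gt0.
have ED s r : E (s + r) = E s * E r by rewrite /E mulrDr expRD.
pose g s := T (t - s) ((E s)%:C *: x) - T t x.
suff : g t = 0.
  rewrite /g subrr; case: sgT => _ -> _ _ /eqP; by rewrite subr_eq0 => /eqP <-.
have x1 : 0 < rnorm x + 1 by rewrite ltr_wpDl ?rnorm_ge0.
have step s r h : 0 <= r -> 0 < h -> s = r + h -> s <= t ->
    rnorm (g s - g r) <= E r * (M * rnorm ((E h)%:C *: x - T h x)).
  move=> r0 h0 sE st; have ts : 0 <= t - s by rewrite subr_ge0.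
  have lT := sg_linear sgT ts.
  have -> : g s - g r = (E r)%:C *: T (t - s) ((E h)%:C *: x - T h x).
    rewrite /g opprB addrA subrK -(linZ lT) scalerBr (linB lT) scalerA -rmorphM /= -ED -sE;
      congr (_ - _).
    rewrite [t - r](_ : _ = (t - s) + h); last by rewrite sE opprD addrA subrK.
    rewrite (sgD sgT _ ts (ltW h0)); congr (T _ _).
    exact: (linZ (sg_linear sgT (ltW h0))).
  rewrite (rnormZ_ge0 _ (ltW (E0 r))) ler_pM2l //; apply: hM => //.
  by rewrite lerBlDr lerDl (le_trans r0) // sE lerDl ltW.
apply: right_derivative0 => // [|s s0 st e e0|s s0 st e e0].
- by rewrite /g subr0 /E mulr0 expR0 scale1r subrr.
- have eM : 0 < e / (2 * (E s * M)) by rewrite divr_gt0 // !mulr_gt0.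
  have /genA/cvg_right0P /(_ _ eM) [d d0 hd] : dom A x /\ A x = A x by split.
  pose d' := e / (2 * (E s * M)) / (2 * lam ^+ 2 * (rnorm x + 1)).
  have d'0 : 0 < d' by rewrite divr_gt0 // mulr_gt0 // mulr_gt0 // exprn_gt0.
  exists (Num.min (Num.min d d') (2 * lam)^-1) => [|h h0].
    by rewrite !lt_min d0 d'0 invr_gt0 mulr_gt0.
  rewrite !lt_min => /andP[/andP[hhd hhd'] hl] sh.
  apply: (le_trans (step _ _ _ s0 h0 erefl sh)).
  have y0 : 0 <= lam * h by rewrite mulr_ge0 // ltW.
  have y1 : lam * h <= 2^-1.
    by move: hl => /ltW; rewrite invfM -[X in _ <= X]mulrC -ler_pdivlMl // mulrC.
  have /andP[E1 E2] := expR_quadratic y0 y1.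
  have b1 : rnorm ((E h - 1 - lam * h)%:C *: x) <= h * (e / (2 * (E s * M))).
    rewrite rnormZ_ge0 //; apply: le_trans (ler_wpM2r (rnorm_ge0 _) E2) _.
    have : h * (2 * lam ^+ 2 * (rnorm x + 1)) <= e / (2 * (E s * M)).
      by rewrite -ler_pdivlMr ?(ltW hhd') // mulr_gt0 // mulr_gt0 // exprn_gt0.
    move=> /(ler_wpM2l (ltW h0)); apply: le_trans.
    rewrite [leLHS](_ : _ = h * (h * (2 * lam ^+ 2 * rnorm x))); last by ring.
    rewrite ler_pM2l // ler_pM2l // ler_pM2l ?lerDl // mulr_gt0 // exprn_gt0 //.
  have b2 : rnorm (T h x - x - (lam * h)%:C *: x) <= h * (e / (2 * (E s * M))).
    have -> : T h x - x - (lam * h)%:C *: x = h%:C *: ((h^-1)%:C *: (T h x - x) - A x).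
      by rewrite ex scalerBr !scalerA -!rmorphM /= mulfV ?gt_eqF // scale1r mulrC.
    by rewrite (rnormZ_ge0 _ (ltW h0)) ler_pM2l // ltW // hd.
  have -> : (E h)%:C *: x - T h x = (E h - 1 - lam * h)%:C *: x - (T h x - x - (lam * h)%:C *: x).
    rewrite !rmorphB !scalerBl rmorph1 scale1r !opprB.
    by rewrite addrA subrK addrA subrK.
  apply: le_trans (_ : E s * (M * (h * (e / (2 * (E s * M))) + h * (e / (2 * (E s * M))))) <= _).
    by rewrite ler_pM2l // ler_pM2l //; apply: (le_trans (rnormB _ _)); exact: lerD.
  by rewrite le_eqVlt; apply/orP; left; apply/eqP; field; rewrite !gt_eqF.
- have eM : 0 < e / (2 * (E s * M)) by rewrite divr_gt0 // !mulr_gt0.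
  have [_ _ _ /(_ x)/cvg_right0P/(_ _ eM)[d d0 hd]] := sgT.
  pose d' := e / (2 * (E s * M)) / (2 * lam * (rnorm x + 1)).
  have d'0 : 0 < d' by rewrite divr_gt0 // mulr_gt0 // mulr_gt0.
  exists (Num.min (Num.min d d') (2 * lam)^-1) => [|r r0 rs].
    by rewrite !lt_min d0 d'0 invr_gt0 mulr_gt0.
  rewrite !lt_min => /andP[/andP[hhd hhd'] hl].
  have h0 : 0 < s - r by rewrite subr_gt0.
  have sE : s = r + (s - r) by rewrite addrC subrK.
  apply: (le_trans (step _ _ _ r0 h0 sE st)); move: h0 hhd hhd' hl;
    set h := s - r => h0 hhd hhd' hl.
  have y0 : 0 <= lam * h by rewrite mulr_ge0 // ltW.
  have y1 : lam * h <= 2^-1.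
    by move: hl => /ltW; rewrite invfM -[X in _ <= X]mulrC -ler_pdivlMl // mulrC.
  have /andP[E1 E2] := expR_quadratic y0 y1.
  have E3 : E h - 1 <= 2 * (lam * h).
    by move: E2; rewrite -/(E h) expr2; have := ler_wpM2l y0 y1; lra.
  have E4 : 0 <= E h - 1 by rewrite /E; lra.
  have b1 : rnorm ((E h - 1)%:C *: x) <= e / (2 * (E s * M)).
    rewrite rnormZ_ge0 //; apply: le_trans (ler_wpM2r (rnorm_ge0 _) E3) _.
    have : h * (2 * lam * (rnorm x + 1)) <= e / (2 * (E s * M)).
      by rewrite -ler_pdivlMr ?(ltW hhd') // mulr_gt0 // mulr_gt0.
    apply: le_trans; rewrite [leLHS](_ : _ = h * (2 * lam * rnorm x)); last by ring.
    by rewrite ler_pM2l // ler_pM2l ?lerDl // mulr_gt0.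
  have b2 := ltW (hd h h0 hhd).
  have -> : (E h)%:C *: x - T h x = (E h - 1)%:C *: x - (T h x - x).
    by rewrite rmorphB scalerBl rmorph1 scale1r opprB addrA subrK.
  have Ers : E r <= E s by rewrite ler_expR ler_pM2l // ltW.
  apply: le_trans (_ : E s * (M * (e / (2 * (E s * M)) + e / (2 * (E s * M)))) <= _).
    apply: ler_pM; [exact: ltW|by rewrite mulr_ge0 ?rnorm_ge0 // ltW|exact: Ers|].
    by rewrite ler_pM2l //; apply: (le_trans (rnormB _ _)); exact: lerD.
  by rewrite le_eqVlt; apply/orP; left; apply/eqP; field; rewrite !gt_eqF.
Qed.

Definition injective_at (lam : R) := forall x : X, dom A x -> A x = lam%:C *: x -> x = 0.

(** [T 1] multiplies an eigenvector by [expR lam >= 1 + lam], which must not exceed its bound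
    [M]. *)
Lemma injective_large : exists2 lam0 : R, 0 < lam0 & forall lam, lam0 <= lam -> injective_at lam.
Proof.
have [lT cT] : linear (T 1) /\ continuous (T 1) by case: sgT => /(_ 1 ltr01).
have [M M0 hM] := bounded_rnorm lT cT.
exists M => // lam Ml x dx ex; have lam0 : 0 < lam by exact: lt_le_trans Ml.
apply: contrapT => x0; have := hM x; rewrite (eigenvector_orbit lam0 dx ex ler01) mulr1.
rewrite rnormZ_ge0 ?expR_ge0 // ler_pM2r; last first.
  by rewrite lt_def rnorm_ge0 andbT; apply/eqP => /rnorm_eq0.
by have := expR_ge1Dx lam; lra.
Qed.

(** By injectivity [x] is the solution that [resolvent_surjective] provides for the right side
    [lam%:C *: x - A x], and inherits its bounds. *)
Lemma apriori (lam : R) x : 0 < lam -> injective_at lam -> dom A x ->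
  rnorm (A x) <= 2 * C * rnorm (lam%:C *: x - A x) /\
  lam * rnorm x <= (1 + 2 * C) * rnorm (lam%:C *: x - A x).
Proof.
move=> lam0 inj dx; have [z [dz ez hz]] := resolvent_surjective (lam%:C *: x - A x) lam0.
have xz : x = z.
  have [d e] := genB sgT genA dx dz.
  apply/eqP; rewrite -subr_eq0; apply/eqP; apply: inj => //.
  rewrite e scalerBr; have -> : lam%:C *: x = lam%:C *: z - A z + A x by rewrite ez subrK.
  by rewrite [RHS]addrAC [lam%:C *: z - A z - _]addrAC subrr add0r addrC.
rewrite -xz in hz; split => //; rewrite -(rnormZ_ge0 _ (ltW lam0)) mulrDl mul1r.
apply: (le_trans (ler_rnorm_dist _ (lam%:C *: x - A x))); rewrite lerD2l.
by rewrite opprB addrC subrK.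
Qed.

(* The a priori bound at [l] yields injectivity on [[th * l, l]], with [th < 1] fixed. *)
Lemma injective_all (lam : R) : 0 < lam -> injective_at lam.
Proof.
have [lam0 l0 hl] := injective_large.
pose K := 1 + 2 * C; have K1 : 1 <= K by rewrite /K; move: C0; lra.
have K0 : 0 < K by apply: lt_le_trans K1.
pose th := 1 - (2 * K)^-1.
have thK : K * (1 - th) = 2^-1 by rewrite /th; field; rewrite gt_eqF.
have th1 : th < 1 by rewrite /th gtrBl invr_gt0 mulr_gt0.
have th0 : 0 < th.
  have : K * (1 - th) < K * 1 by rewrite thK mulr1; apply: lt_le_trans K1;
    rewrite invf_lt1 // ltr1n.
  by rewrite ltr_pM2l //; lra.
(* An eigenvector [x] at [m] satisfies [l%:C *: x - A x = (l - m)%:C *: x], so [apriori] would give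
   [l <= K * (l - m) <= l / 2]; [th] is chosen for the last inequality. *)
have step l m : 0 < l -> injective_at l -> th * l <= m -> m <= l -> injective_at m.
  move=> lp inj ml mm x dx ex; have [_ h] := apriori lp inj dx.
  apply: rnorm_eq0; apply/eqP; rewrite eq_le rnorm_ge0 andbT leNgt; apply/negP => xp.
  move: h; rewrite ex -scalerBl -rmorphB rnormZ_ge0 ?subr_ge0 // mulrA ler_pM2r // -/K.
  have : K * (l - m) <= K * (l - th * l) by rewrite ler_pM2l // lerD2l lerN2.
  have -> : K * (l - th * l) = K * (1 - th) * l by ring.
  by rewrite thK; lra.
have all n l : th ^+ n * lam0 <= l -> injective_at l.
  elim: n l => [|n IH] l; first by rewrite expr0 mul1r; exact: hl.
  have [h _|h hh] := leP (th ^+ n * lam0) l; first exact: IH.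
  have lp : 0 < th ^+ n * lam0 by rewrite mulr_gt0 ?exprn_gt0.
  by apply: (step _ l lp (IH _ (lexx _))) => //; [rewrite mulrA -exprS|exact: ltW].
move=> lamp; have d0 : 0 < lam / lam0 by rewrite divr_gt0.
have : th ^+ n @[n --> \oo] --> (0 : R) by apply: cvg_expr; rewrite ger0_norm // ltW.
move=> /cvgrPdist_lt/(_ _ d0)[n _ /(_ n (leqnn n))] /=.
rewrite sub0r normrN ger0_norm ?exprn_ge0 ?(ltW th0) // ltr_pdivlMr // => /ltW; exact: all.
Qed.

(** * Exact solutions of the scheme *)

Lemma backward_euler_exists (tau : R) (N : nat) (f : nat -> X) : 0 < tau ->
  exists u : nat -> X, backward_euler A tau N f u.
Proof.
move=> tau0; have l0 : 0 < tau^-1 by rewrite invr_gt0.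
have /choice [F hF] : forall g, exists x : X, dom A x /\ (tau^-1)%:C *: x - A x = g.
  by move=> g; have [x [dx ex _]] := resolvent_surjective g l0; exists x.
pose u := fix u n := if n is m.+1 then F ((tau^-1)%:C *: u m + f m.+1) else 0.
exists u; split => // -[|n] // _.
have [d e] := hF ((tau^-1)%:C *: u n + f n.+1); split => //.
rewrite /diff_quot /= scalerBr; apply/eqP; rewrite subr_eq; apply/eqP.
move/eqP: e; rewrite subr_eq => /eqP ->.
by rewrite [LHS]addrC [_ *: _ + _]addrC addrA.
Qed.

(** The difference of the two sequences solves the scheme with the residual as force. One step
    multiplies the error by [1 + 2 * C] by [apriori] and adds [eps] anew, whence the factor
    [2 + 2 * C]. *)
Lemma backward_euler_close (tau : R) (N : nat) (f u x : nat -> X) (eps : R) : 0 < tau ->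
  0 <= eps ->
  backward_euler A tau N f u -> x 0%N = 0 ->
  (forall n, (n < N)%N -> dom A (x n.+1) /\
     rnorm (diff_quot tau x n.+1 - A (x n.+1) - f n.+1) <= eps) ->
  forall n, (n < N)%N -> rnorm (A (u n.+1) - A (x n.+1)) <= 2 * C * (2 + 2 * C) ^+ N * eps.
Proof.
move=> tau0 eps0 [u0 hu] x0 hx; have l0 : 0 < tau^-1 by rewrite invr_gt0.
pose d n := u n - x n.
have C2 : 0 <= 2 * C by rewrite mulr_ge0.
have eq n : (n < N)%N -> [/\ dom A (d n.+1), A (d n.+1) = A (u n.+1) - A (x n.+1) &
   rnorm ((tau^-1)%:C *: d n.+1 - A (d n.+1)) <= tau^-1 * rnorm (d n) + eps].
  move=> nN; have [du eu] := hu n.+1 nN; have [dx ex] := hx n nN.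
  have [dd ed] := genB sgT genA du dx; split => //.
  have -> : (tau^-1)%:C *: d n.+1 - A (d n.+1) = (tau^-1)%:C *: d n - (diff_quot tau x n.+1 - A
    (x n.+1) - f n.+1).
    move: eu; rewrite /diff_quot /= => eu; rewrite /d ed !scalerBr.
    have -> : (tau^-1)%:C *: u n.+1 = (tau^-1)%:C *: u n + (A (u n.+1) + f n.+1).
      by rewrite -eu scalerBr addrC subrK.
    exact: euler_algebra.
  apply: (le_trans (rnormB _ _)); apply: lerD => //; by rewrite rnormZ_ge0 // ltW.
have bound n : (n <= N)%N -> tau^-1 * rnorm (d n) + eps <= (2 + 2 * C) ^+ n * eps.
  elim: n => [_|n IH nN]; first by rewrite /d u0 x0 subrr rnorm0 mulr0 add0r expr0 mul1r.
  have [dd _ h] := eq n nN; have [_ h2] := apriori l0 (injective_all l0) dd.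
  have h3 := IH (ltnW nN).
  have h4 : tau^-1 * rnorm (d n.+1) <= (1 + 2 * C) * ((2 + 2 * C) ^+ n * eps).
    apply: (le_trans h2); apply: ler_wpM2l; first by rewrite addr_ge0.
    exact: le_trans h3.
  have h5 : eps <= (2 + 2 * C) ^+ n * eps.
    by apply: ler_peMl => //; rewrite exprn_ege1 //; lra.
  rewrite exprS -mulrA; move: h4 h5; move: (tau^-1 * _) (_ ^+ n * eps) => a b; lra.
move=> n nN; have [dd <- h] := eq n nN; have [h2 _] := apriori l0 (injective_all l0) dd.
apply: (le_trans h2); rewrite -[leRHS]mulrA; apply: ler_wpM2l => //.
apply: (le_trans h); apply: (le_trans (bound n (ltnW nN))); apply: ler_wpM2r => //.
by apply: ler_weXn2l; [move: C2; lra|exact: ltnW].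
Qed.

Lemma powRD_le (a b : R) : 0 <= a -> 0 <= b -> (a + b) `^ p <= 2 `^ p * (a `^ p + b `^ p).
Proof.
move=> a0 b0; have p0 : 0 <= p by exact/ltW/(lt_trans _ p1).
wlog ab : a b a0 b0 / a <= b.
  move=> h; have [ab|/ltW ba] := leP a b; first exact: h.
  by rewrite addrC [a `^ p + _]addrC; exact: h.
apply: le_trans (_ : (2 * b) `^ p <= _).
  by apply: powR_mono => //; [exact: addr_ge0|rewrite mulr_natl mulr2n lerD2r].
by rewrite powRM // ler_wpM2l ?powR_ge0 // lerDr powR_ge0.
Qed.

(** Comparison with approximate solutions of vanishing residual; the factor 2 in [2 * C] is the loss
    in [powRD_le]. *)
Lemma backward_euler_bound (tau : R) (N : nat) (f u : nat -> X) : 0 < tau ->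
  backward_euler A tau N f u ->
  \sum_(0 <= n < N) rnorm (A (u n.+1)) `^ p <= (2 * C) `^ p * \sum_(0 <= n < N) rnorm (f n.+1)
    `^ p.
Proof.
move=> tau0 hu; have p0 : 0 < p by exact: lt_trans p1.
apply/ler_addgt0Pr => e e0.
pose c := 2 * C * (2 + 2 * C) ^+ N.
have c0 : 0 <= c by rewrite /c; apply: mulr_ge0; [exact: mulr_ge0|apply: exprn_ge0; move: C0;
  lra].
(* The tolerance in each term, so that the [N] errors add up to at most [e]; [eps] is then such that
   [c * eps] to the power [p] is at most [d]. *)
pose d := e / (2 `^ p * (N%:R + 1)).
have N1 : 0 < (N%:R + 1 : R) by rewrite ltr_wpDl.
have p2 : 0 < 2 `^ p :> R by rewrite powR_gt0.
have d0 : 0 < d by rewrite divr_gt0 // mulr_gt0.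
pose eps := d `^ p^-1 / (c + 1).
have eps0 : 0 < eps by rewrite divr_gt0 ?powR_gt0 // ltr_wpDl.
have ceps : (c * eps) `^ p <= d.
  apply: (@le_trans _ _ ((d `^ p^-1) `^ p)).
    apply: powR_mono; [exact: ltW|by rewrite mulr_ge0 // ltW|].
    rewrite /eps mulrA ler_pdivrMr ?ltr_wpDl // mulrC ler_pM2l ?powR_gt0 //; lra.
  by rewrite -powRrM mulVf ?gt_eqF // powRr1 // ltW.
have [x [x0 hx sx]] := approximate_scheme N f tau0 eps0.
have close := backward_euler_close tau0 (ltW eps0) hu x0 hx.
apply: (@le_trans _ _ (\sum_(0 <= n < N) 2 `^ p * (rnorm (A (x n.+1)) `^ p + d))).
  rewrite [leLHS]big_nat [leRHS]big_nat; apply: ler_sum => n /andP[_ nN].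
  apply: le_trans (_ : (rnorm (A (x n.+1)) + c * eps) `^ p <= _).
    apply: powR_mono; [exact: ltW|exact: rnorm_ge0|].
    by apply: (le_trans (ler_rnorm_dist _ (A (x n.+1)))); rewrite lerD2l; exact: close.
  apply: le_trans (powRD_le (rnorm_ge0 _) _) _; first by rewrite mulr_ge0 // ltW.
  by rewrite ler_pM2l // lerD2l.
rewrite -mulr_sumr big_split /= sumr_const_nat subn0 mulrDr; apply: lerD.
  by rewrite powRM // -mulrA ler_pM2l.
rewrite /d -[_ *+ N]mulr_natl; apply: le_trans (_ : 2 `^ p * ((N%:R + 1) * (e / (2 `^ p * (N%:R
  + 1)))) <= _).
  by rewrite ler_pM2l // ler_pM2r // lerDl.
by rewrite le_eqVlt; apply/orP; left; apply/eqP; field; rewrite !gt_eqF.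
Qed.

Lemma lp_normE (N : nat) (v : nat ->
  X) : lp_norm p N v = (\sum_(0 <= n < N) rnorm (v n.+1) `^ p) `^ p^-1.
Proof. by rewrite /lp_norm big_add1. Qed.

Lemma lp_norm_le (N : nat) (v f : nat -> X) (c : R) : 0 <= c ->
  \sum_(0 <= n < N) rnorm (v n.+1) `^ p <= c * \sum_(0 <= n < N) rnorm (f n.+1) `^ p ->
  lp_norm p N v <= c `^ p^-1 * lp_norm p N f.
Proof.
move=> c0 h; have p0 : 0 < p by exact: lt_trans p1.
have S0 (w : nat -> X) : 0 <= \sum_(0 <= n < N) rnorm (w n.+1) `^ p by apply: sumr_ge0 => n _;
  exact: powR_ge0.
rewrite !lp_normE -powRM //; apply: powR_mono => //; by rewrite invr_ge0 ltW.
Qed.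

(** The difference quotient is [A (u n) + f n], so its bound follows from that of [A (u n)] through
    [powRD_le], whence the first summand of the constant. *)
Lemma backward_euler_regularity (tau : R) (N : nat) (f u : nat -> X) : 0 < tau ->
  backward_euler A tau N f u ->
  lp_norm p N (diff_quot tau u) + lp_norm p N (fun n => A (u n)) <=
  ((2 `^ p * ((2 * C) `^ p + 1)) `^ p^-1 + ((2 * C) `^ p) `^ p^-1) * lp_norm p N f.
Proof.
move=> tau0 hu; have hA := backward_euler_bound tau0 hu.
rewrite mulrDl; apply: lerD; apply: lp_norm_le; rewrite ?powR_ge0 //.
  by rewrite mulr_ge0 ?powR_ge0 // addr_ge0 ?powR_ge0.
apply: (@le_trans _ _ (\sum_(0 <= n < N) 2 `^ p * (rnorm (A (u n.+1)) `^ p + rnorm (f n.+1) `^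
  p))).
  rewrite [leLHS]big_nat [leRHS]big_nat; apply: ler_sum => n /andP[_ nN].
  have [_ hu2] := hu; have [_ ->] := hu2 n.+1 nN.
  apply: le_trans (powRD_le (rnorm_ge0 _) (rnorm_ge0 _)).
  by apply: powR_mono; [exact/ltW/(lt_trans _ p1)|exact: rnorm_ge0|exact: rnormD].
rewrite -mulr_sumr big_split /= -mulrA ler_wpM2l ?powR_ge0 // mulrDl mul1r.
by rewrite lerD2r.
Qed.

End resolvent.

Lemma analytic_C0_semigroup (R : realType) (X : completeNormedModType R[i]) (T : R[i] -> X -> X) :
  analytic_semigroup T -> C0_semigroup (fun s : R => T s%:C).
Proof.
move=> [theta /andP[th0 _] [lT T0 sgT _ cT]].
have sec (s : R) : 0 < s -> sector theta s%:C.
  move=> s0; exists s, 0; split => //; first by rewrite normr0.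
  by rewrite cos0 sin0 mulr1 mulr0.
split => // [s s0|s t x s0 t0|x].
- by apply: lT; exact: sec.
- by rewrite rmorphD /=; apply: sgT; exact: sec.
apply/cvg_right0P => e e0.
have /cvg_rnormP/cvgrPdist_lt/(_ _ e0) := cT x.
move=> /nbhs_ballP [_ /gt0_complex [d d0 ->] hd]; exists d => // t t0 td.
have := hd t%:C _ (sec t t0); rewrite sub0r normrN ger0_norm ?rnorm_ge0 //; apply.
by rewrite -ball_normE /= sub0r normrN normc_def /= expr0n /= addr0 sqrtr_sqr ltcR gtr0_norm.
Qed.

Theorem theorem3p1 (R : realType) (X : completeNormedModType R[i]) (p : R)
    (A : operator X) :
  UMD X -> 1 < p -> generates_analytic_semigroup A -> maximal_regularity p A ->
  exists C : R, forall (tau : R) (N : nat) (f : nat -> X),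
    0 < tau -> (1 <= N)%N ->
    (exists u : nat -> X, backward_euler A tau N f u) /\
    (forall u : nat -> X, backward_euler A tau N f u ->
       lp_norm p N (diff_quot tau u) + lp_norm p N (fun n => A (u n))
         <= C * lp_norm p N f).
Proof.
move=> _ p1 [T /analytic_C0_semigroup sgT genA] [C hC].
(* The constant in [maximal_regularity] comes without a sign. *)
pose C' := Num.max C 0; have C0 : 0 <= C' by rewrite le_max lexx orbT.
have regA (f : R -> X) : in_Lp p (@Rplus R) f -> exists u u' Au : R -> X,
    [/\ cauchy_solution A f u u' Au, in_Lp p (@Rplus R) u', in_Lp p (@Rplus R) Au &
        (Lpnorm p (@Rplus R) u' + Lpnorm p (@Rplus R) Au <= C'%:E * Lpnorm p (@Rplus R) f)%E].
  move=> /hC [u [u' [Au [h1 h2 h3 h4]]]]; exists u, u', Au; split => //.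
  apply: (le_trans h4); apply: lee_wpmul2r; first exact: Lpnorm_ge0.
  by rewrite lee_fin le_max lexx.
exists ((2 `^ p * ((2 * C') `^ p + 1)) `^ p^-1 + ((2 * C') `^ p) `^ p^-1) => tau N f tau0 _;
  split.
  exact: (backward_euler_exists sgT genA p1 C0 regA).
by move=> u; exact: (backward_euler_regularity sgT genA p1 C0 regA).
Qed.
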